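(* The function $\phi$ from the set of facets of $AX(c)$ to $\mathrm{NCP}_c$ taking a facet $F$ with forward vertices $\tau_{i_1}<\tau_{i_2}<\dots<\tau_{i_k}$ to the product $R(\tau_{i_k})R(\tau_{i_{k-1}})\cdots R(\tau_{i_1})$ is a bijection.
   Context: $W$ is an irreducible finite real reflection group of rank $n$ acting (essentially, by orthogonal transformations) on $\mathbf{R}^n$. Fix a fundamental chamber with inward unit normals (simple roots) $\alpha_1,\dots,\alpha_n$, and let $R_i$ be the reflection in $\alpha_i^\perp$. The simple roots are ordered so that $S_1=\{\alpha_1,\dots,\alpha_s\}$ and $S_2=\{\alpha_{s+1},\dots,\alpha_n\}$ are orthonormal sets; $c=R_1R_2\cdots R_n$ is the corresponding bipartite Coxeter element, $h$ is its order (the Coxeter number), and $c_+=R_1\cdots R_s$. Roots are the vectors $w(\alpha_i)$, $w\in W$ (all of unit length); $R(\tau)$ is the reflection in $\tau^\perp$. $\mathbf{T}$ is the set of all reflections in $W$; $\ell(w)=\min\{k\ge 0\mid w=T_1\cdots T_k,\ T_i\in\mathbf{T}\}$; $u\preceq w$ iff $\ell(u)+\ell(u^{-1}w)=\ell(w)$; $\mathrm{NCP}_c=\{w\in W\mid w\preceq c\}$; $M(w)$ is the orthogonal complement of the fixed subspace of $w$. For $i\ge1$, $\rho_i=R_1R_2\cdots R_{i-1}(\alpha_i)$ with the indices of $R_j,\alpha_i$ taken cyclically modulo $n$; extend to all integers by $\rho_{i+nh}=\rho_i$. The positive roots are $\rho_1,\dots,\rho_{nh/2}$. $EX(c)$ is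 the simplicial complex with vertex set $\{\rho_{-n+s+1},\dots,\rho_0,\rho_1,\dots,\rho_{nh/2},\dots,\rho_{nh/2+s}\}$, ordered by $<$ in the listed order, with a simplex on each subset $\{\tau_1<\dots<\tau_k\}$ such that $\ell(R(\tau_1)\cdots R(\tau_k)c)=n-k$. $AX(c)$ is the simplicial complex obtained by applying $c_+$ to $EX(c)$; its vertex set is $\{\rho_1,\dots,\rho_{nh/2+n}\}$, ordered by $\rho_1<\rho_2<\dots<\rho_{nh/2+n}$. A facet $F$ of $AX(c)$ has $n$ vertices $\tau_1<\dots<\tau_n$, with $c=R(\tau_n)R(\tau_{n-1})\cdots R(\tau_1)$. For $w\in\mathrm{NCP}_c$, $X(w)$ is the subcomplex of $EX(c)$ of those simplices whose vertices are positive roots lying in $M(w)$; its facets have $\ell(w)$ vertices. Facets of $X(w)$ are ordered lexicographically by their increasing vertex sequences; the first facet of $X(w)$ is the lexicographically first one. For a facet $F$ of $AX(c)$ with ordered vertices $\tau_1<\tau_2<\dots<\tau_n$ and for $1\le i\le n$, put $v_i=R(\tau_i)\cdots R(\tau_2)R(\tau_1)\in\mathrm{NCP}_c$. The vertex $\tau_i$ is a forward vertex of $F$ if $\tau_i$ is a vertex of the first facet of $X(v_i)$; otherwise it is a backward vertex of $F$. An empty product is the identity. *)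

(* Defs.v *)
From HB Require Import structures.
From mathcomp Require Import all_boot all_order all_algebra.
From mathcomp Require Import finmap.
From mathcomp Require Import all_classical reals.

Set Implicit Arguments.
Unset Strict Implicit.
Unset Printing Implicit Defensive.

Import Order.TTheory GRing.Theory Num.Theory.

Local Open Scope classical_set_scope.
Local Open Scope ring_scope.

(* Vectors of R^n are columns and a matrix g acts by v |-> g *m v, so a product
   of matrices is the composite of the corresponding maps, rightmost first. *)

Definition dot (R : realType) (n : nat) (u v : 'cV[R]_n) : R :=
  \sum_(i < n) u i 0 * v i 0.

(* The reflection in the hyperplane orthogonal to t (meaningful for t != 0):
   v |-> v - 2 (t, v) / (t, t) t. *)
Definition reflmx (R : realType) (n : nat) (t : 'cV[R]_n) : 'M[R]_n :=
  1%:M - (2 / dot t t) *: (t *m t^T).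

Section ReflectionGroups.
Context {R : realType} {n : nat}.
Implicit Types (W : set 'M[R]_n) (alpha : n.-tuple 'cV[R]_n).

Definition orthogonal_group W : Prop :=
  [/\ W 1%:M,
      forall g k, W g -> W k -> W (g *m k),
      forall g, W g -> W (invmx g)
    & forall g, W g -> g^T *m g = 1%:M].

Definition reflections W : set 'M[R]_n :=
  [set g | W g /\ exists2 t : 'cV[R]_n, t != 0 & g = reflmx t].

(* The inverse of a reflection is itself, hence products of reflections are all
   of the subgroup that the reflections generate. *)
Definition finite_reflection_group W : Prop :=
  [/\ finite_set W, orthogonal_group W
    & forall g, W g -> exists2 s : seq 'M[R]_n,
        (forall k, k \in s -> reflections W k) & g = \big[mulmx/1%:M]_(k <- s) k].

Definition essential W : Prop :=
  forall v : 'cV[R]_n, (forall g, W g -> g *m v = v) -> v = 0.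

Definition irreducible_group W : Prop :=
  (0 < n)%N /\
  forall U : {vspace 'cV[R]_n},
    (forall g v, W g -> v \in U -> g *m v \in U) -> U = 0%VS \/ U = fullv.

(* A chamber consists of the points that lie strictly on the same side as a
   given point x, itself on no reflecting hyperplane, of every reflecting
   hyperplane. *)
Definition chamber W (C : set 'cV[R]_n) : Prop :=
  exists2 x : 'cV[R]_n,
    (forall t, t != 0 -> W (reflmx t) -> dot t x != 0)
  & C = [set y | forall t, t != 0 -> W (reflmx t) -> 0 < dot t x * dot t y].

(* For an essential group of rank n a chamber is a simplicial cone with exactly
   n walls, so none of the n half-spaces below is redundant and the vectors of
   alpha are the inward unit normals of the walls, each listed once. *)
Definition simple_roots W alpha : Prop :=
  (forall i, dot (tnth alpha i) (tnth alpha i) = 1 /\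
             W (reflmx (tnth alpha i))) /\
  chamber W [set y | forall i, 0 < dot (tnth alpha i) y].

(* With 0-based indices: the first s simple roots form an orthonormal set, and
   so do the other n - s. *)
Definition bipartite_order alpha (s : nat) : Prop :=
  [/\ (s <= n)%N,
      forall i j : 'I_n, (i < s)%N -> (j < s)%N ->
        dot (tnth alpha i) (tnth alpha j) = (i == j)%:R
    & forall i j : 'I_n, (s <= i)%N -> (s <= j)%N ->
        dot (tnth alpha i) (tnth alpha j) = (i == j)%:R].

(* alpha_i for i >= 1, the index being taken modulo n. *)
Definition sroot alpha (i : nat) : 'cV[R]_n := nth 0 alpha (i.-1 %% n).

(* R_1 R_2 ... R_k *)
Definition sprod alpha (k : nat) : 'M[R]_n :=
  \big[mulmx/1%:M]_(1 <= j < k.+1) reflmx (sroot alpha j).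

Definition coxeter alpha : 'M[R]_n := sprod alpha n.

Definition mx_order (g : 'M[R]_n) (h : nat) : Prop :=
  [/\ (0 < h)%N, iter h (mulmx g) 1%:M = 1%:M
    & forall m, (0 < m < h)%N -> iter m (mulmx g) 1%:M <> 1%:M].

Definition refl_factors W (w : 'M[R]_n) (k : nat) : Prop :=
  exists s : seq 'M[R]_n,
    [/\ size s = k, forall t, t \in s -> reflections W t
      & w = \big[mulmx/1%:M]_(t <- s) t].

(* The value 0 is a default for matrices outside of W. *)
Definition reflen W (w : 'M[R]_n) : nat :=
  xget 0%N [set k | refl_factors W w k /\
                    forall j, refl_factors W w j -> (k <= j)%N].

Definition refl_le W (u w : 'M[R]_n) : Prop :=
  (reflen W u + reflen W (invmx u *m w) = reflen W w)%N.

Definition NCP W (c : 'M[R]_n) : set 'M[R]_n := [set w | W w /\ refl_le W w c].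

(* v is in M(w) *)
Definition in_moved (w : 'M[R]_n) (v : 'cV[R]_n) : Prop :=
  forall u : 'cV[R]_n, w *m u = u -> dot u v = 0.

Definition rho_nat alpha (i : nat) : 'cV[R]_n :=
  sprod alpha i.-1 *m sroot alpha i.

(* The extension by periodicity nh to all integers of rho_1, ..., rho_nh. *)
Definition rho alpha (h : nat) (i : int) : 'cV[R]_n :=
  rho_nat alpha (absz ((i - 1) %% (n * h)%:Z)%Z).+1.

Definition pos_roots alpha (h : nat) : seq 'cV[R]_n :=
  [seq rho alpha h i%:Z | i <- iota 1 (n * h)./2].

(* rho_(-n+s+1), ..., rho_(nh/2+s) *)
Definition EX_vertices alpha (s h : nat) : seq 'cV[R]_n :=
  [seq rho alpha h (s%:Z - n%:Z + i%:Z) | i <- iota 1 ((n * h)./2 + n)].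

Definition AX_vertices alpha (h : nat) : seq 'cV[R]_n :=
  [seq rho alpha h i%:Z | i <- iota 1 ((n * h)./2 + n)].

(* The elements of F in increasing order, for the order of the list vs. *)
Definition increasing (vs : seq 'cV[R]_n) (F : {fset 'cV[R]_n}) :
    seq 'cV[R]_n :=
  [seq v <- vs | v \in F].

(* R(t_1) R(t_2) ... R(t_k) *)
Definition refl_prod (ts : seq 'cV[R]_n) : 'M[R]_n :=
  \big[mulmx/1%:M]_(t <- ts) reflmx t.

(* A simplicial complex is given by its set of simplices. *)
Definition facets (K : set {fset 'cV[R]_n}) : set {fset 'cV[R]_n} :=
  [set F | K F /\ forall G, K G -> (F `<=` G)%fset -> G = F].

Definition EX W alpha (s h : nat) : set {fset 'cV[R]_n} :=
  [set F | {subset F <= EX_vertices alpha s h} /\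
           (reflen W (refl_prod (increasing (EX_vertices alpha s h) F)
                      *m coxeter alpha) + #|` F| = n)%N].

Definition AX W alpha (s h : nat) : set {fset 'cV[R]_n} :=
  [set [fset sprod alpha s *m v | v in E]%fset | E in EX W alpha s h].

Definition X W alpha (s h : nat) (w : 'M[R]_n) : set {fset 'cV[R]_n} :=
  [set F | EX W alpha s h F /\
           forall v, v \in F -> v \in pos_roots alpha h /\ in_moved w v].

(* The increasing sequence of the positions of the vertices of F in the ordered
   vertex set of EX(c), for lexicographic comparison. *)
Definition positions alpha (s h : nat) (F : {fset 'cV[R]_n}) : seqlexi nat :=
  [seq index v (EX_vertices alpha s h)
     | v <- increasing (EX_vertices alpha s h) F].

Definition first_facet W alpha (s h : nat) (w : 'M[R]_n)
    (F : {fset 'cV[R]_n}) : Prop :=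
  facets (X W alpha s h w) F /\
  forall G, facets (X W alpha s h w) G ->
    (positions alpha s h F <= positions alpha s h G)%O.

(* For t the i-th vertex t_i of the simplex F of AX(c), R(t_i) ... R(t_1). *)
Definition partial_prod alpha (h : nat) (F : {fset 'cV[R]_n})
    (t : 'cV[R]_n) : 'M[R]_n :=
  let ts := increasing (AX_vertices alpha h) F in
  refl_prod (rev (take (index t ts).+1 ts)).

Definition forward W alpha (s h : nat) (F : {fset 'cV[R]_n})
    (t : 'cV[R]_n) : Prop :=
  exists2 G : {fset 'cV[R]_n},
    first_facet W alpha s h (partial_prod alpha h F t) G & t \in G.

Definition phi W alpha (s h : nat) (F : {fset 'cV[R]_n}) : 'M[R]_n :=
  refl_prod (rev [seq t <- increasing (AX_vertices alpha h) F
                 | `[< forward W alpha s h F t >]]).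

End ReflectionGroups.

(* Main.v *)
(** Let [b] be the Euler form of [c], determined by [b ((1 - c) v, y) = 2 v.y]. An
element [w] of [W] is noncrossing iff the same identity holds on its moved space
[M(w)], and [R(t_1) ... R(t_k) c] has length [n - k] iff [b (t_j, t_i) = 0] for
[i < j]; so simplices are exceptional sequences. In the order [rho_1 < rho_2 < ...]
positive roots [x < y] satisfy [b (x, y) >= 0 >= b (y, x)], and nothing else about
the order is used: the facets of [AX(c)] become "clusters" for a list [L] of positive
roots ordered in this way, and [t_i] is forward iff [R(t_1) ... R(t_{i-1}) t_i] is
positive. Moving the first root [r] of [L] to the end, as [- r], gives a list with the
same properties, and one can follow how clusters and their forward products change
under this rotation. Rotating until a root of [M(v)] comes first, and inducting on the
rank, every noncrossing [v] is the forward product of exactly one cluster.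

That [rho_1, ..., rho_(nh/2)] has the required sign properties is read off from the
coefficients of the roots on the simple roots; which of the [rho_i] are positive is
decided by their coordinates in the plane of the Perron vector of the Coxeter graph. *)

Require Import Defs.
From mathcomp Require Import all_boot all_order all_algebra.
From mathcomp Require Import finmap.
From mathcomp Require Import all_classical reals.
From mathcomp Require Import topology normedtype derive.
From mathcomp Require Import lra zify.

Set Implicit Arguments.
Unset Strict Implicit.
Unset Printing Implicit Defensive.

Import Order.TTheory GRing.Theory Num.Theory.
Import numFieldNormedType.Exports.

Local Open Scope ring_scope.

(** * Reflections *)

(** The identity defining the Euler form makes [w] act on [M(w)] as a Serre functor:
    [b (w x, y) = - b (y, x)]. This is the calculus of exceptional sequences over a hereditary
    algebra, done with vectors only. Call a positive root [t] of [M(w)] projective for [w] when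
    [w^-1 t] is negative; equivalently, [b (t, y) >= 0] for all positive roots [y] of [M(w)]. The
    first facet of [X(w)] consists of these roots, which turns a lexicographic condition into one on
    signs. The obstacle is that the first root [r] of the list need not lie in [M(D)], where [D] is
    the element to be reached, so the rank cannot always be lowered by removing [r]. Consider the
    clusters [F] of [C] with forward product [D]. If [r] is in [M(D)], it is a vertex of [F], and
    its removal replaces [C], [D] by [C R(r)], [D R(r)]. Otherwise the same [F] are the clusters for
    the rotated list with forward product [D], except that [D] becomes [D R(r)] when [r] is in
    [M(C)] and [b (x, r) = 0] on [M(D)]. For [D = 1], where there is no root of [M(D)] to wait for,
    this exception creates one. *)

Section Dot.
Context {R : realType} {n : nat}.
Implicit Types (u v x y t : 'cV[R]_n) (A : 'M[R]_n) (a : R).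

Lemma dotE u v : dot u v = (u^T *m v) 0 0.
Proof. by rewrite mxE; apply: eq_bigr => i _; rewrite mxE. Qed.

Lemma dotC u v : dot u v = dot v u.
Proof. by apply: eq_bigr => i _; rewrite mulrC. Qed.

Lemma dotDl x y v : dot (x + y) v = dot x v + dot y v.
Proof. by rewrite !dotE linearD /= mulmxDl mxE. Qed.

Lemma dotDr v x y : dot v (x + y) = dot v x + dot v y.
Proof. by rewrite !(dotC v) dotDl. Qed.

Lemma dotZl a x v : dot (a *: x) v = a * dot x v.
Proof. by rewrite !dotE linearZ /= -scalemxAl mxE. Qed.

Lemma dotZr a v x : dot v (a *: x) = a * dot v x.
Proof. by rewrite !(dotC v) dotZl. Qed.

Lemma dotNl x v : dot (- x) v = - dot x v.
Proof. by rewrite -scaleN1r dotZl mulN1r. Qed.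

Lemma dotNr v x : dot v (- x) = - dot v x.
Proof. by rewrite !(dotC v) dotNl. Qed.

Lemma dot0l v : dot 0 v = 0.
Proof. by rewrite -(scale0r 0) dotZl mul0r. Qed.

Lemma dot0r v : dot v 0 = 0.
Proof. by rewrite dotC dot0l. Qed.

Lemma dot_sumr (I : Type) (r : seq I) (P : pred I) (F : I -> 'cV[R]_n) v :
  dot v (\sum_(i <- r | P i) F i) = \sum_(i <- r | P i) dot v (F i).
Proof.
by elim/big_rec2: _ => [|i x y _ <-]; rewrite ?dot0r ?dotDr.
Qed.

Lemma dot_adj A u v : dot (A *m u) v = dot u (A^T *m v).
Proof. by rewrite !dotE trmx_mul mulmxA. Qed.

Lemma dot_ge0 v : 0 <= dot v v.
Proof. by apply: sumr_ge0 => i _; rewrite -expr2 sqr_ge0. Qed.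

Lemma dot_eq0 v : (dot v v == 0) = (v == 0).
Proof.
apply/eqP/eqP => [/eqP|->]; last exact: dot0r.
rewrite psumr_eq0 => [/allP v0|i _]; last by rewrite -expr2 sqr_ge0.
apply/colP => i; rewrite mxE; apply/eqP.
by have := v0 i (mem_index_enum _); rewrite mulf_eq0 orbb.
Qed.

Lemma dot_inj x y : (forall v, dot x v = dot y v) -> x = y.
Proof.
move=> xy; apply/eqP; rewrite -subr_eq0 -dot_eq0.
by rewrite dotDl dotNl xy subrr.
Qed.

Definition dotDE := (dotDl, dotDr, dotZl, dotZr, dotNl, dotNr).

Lemma mx_ext (m : nat) (A A' : 'M[R]_(m, n)) :
  (forall v, A *m v = A' *m v) -> A = A'.
Proof.
move=> AA'; apply/matrixP => i j.
by have := AA' (delta_mx j 0); rewrite -!colE => /colP/(_ i); rewrite !mxE.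
Qed.

Lemma reflmxE t v : reflmx t *m v = v - (2 * dot t v / dot t t) *: t.
Proof.
rewrite /reflmx mulmxBl mul1mx -scalemxAl -mulmxA.
have -> : t^T *m v = (dot t v)%:M.
  by apply/matrixP => i j; rewrite !ord1 -dotE mxE eqxx mulr1n.
by rewrite mul_mx_scalar scalerA mulrAC.
Qed.

Lemma reflmx1E t v : dot t t = 1 -> reflmx t *m v = v - (2 * dot t v) *: t.
Proof. by move=> t1; rewrite reflmxE t1 divr1. Qed.

Lemma tr_reflmx t : (reflmx t)^T = reflmx t.
Proof. by rewrite /reflmx linearB linearZ /= trmx1 trmx_mul trmxK. Qed.

Lemma reflmxN t : reflmx (- t) = reflmx t.
Proof.
by rewrite /reflmx dotNl dotNr opprK linearN /= mulNmx mulmxN opprK.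
Qed.

Lemma reflmxZ a t : a != 0 -> reflmx (a *: t) = reflmx t.
Proof.
move=> a0; apply: mx_ext => v; rewrite !reflmxE !dotDE scalerA; congr (_ - _ *: _).
(* When [dot t t = 0] both quotients vanish, as [0^-1 = 0]. *)
have [->|t0] := eqVneq (dot t t) 0; first by rewrite !mulr0 invr0 !mulr0 mul0r.
rewrite mulrAC (_ : 2 * _ * a = 2 * dot t v * (a * a)); last by lra.
rewrite (_ : a * (a * _) = dot t t * (a * a)); last by lra.
by rewrite -mulf_div divff ?mulr1 // mulf_neq0.
Qed.

Lemma reflmxK t : t != 0 -> reflmx t *m reflmx t = 1%:M.
Proof.
rewrite -dot_eq0 => t0; apply: mx_ext => v; rewrite -mulmxA mul1mx !reflmxE.
rewrite !dotDE -addrA -opprD -scalerDl.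
rewrite divfK // -mulrDl (_ : 2 * _ + _ = 0) ?mul0r ?scale0r ?subr0 //.
by lra.
Qed.

Lemma reflmx_id t : t != 0 -> reflmx t *m t = - t.
Proof.
rewrite -dot_eq0 => t0; rewrite reflmxE mulfK // scaler_nat mulr2n.
by rewrite opprD addrA subrr sub0r.
Qed.

Lemma reflmx_conj A t : A^T *m A = 1%:M ->
  A *m reflmx t *m A^T = reflmx (A *m t).
Proof.
move=> AA; rewrite /reflmx mulmxBr mulmx1 mulmxBl.
rewrite (mulmx1C AA) -scalemxAr -scalemxAl; congr (_ - _ / _ *: _).
  by rewrite dot_adj mulmxA AA mul1mx.
by rewrite trmx_mul !mulmxA.
Qed.

End Dot.

(** * The Perron vector of a symmetric nonnegative matrix *)

Section PerronVector.
Context {R : realType} {n : nat} (a : 'I_n -> 'I_n -> R).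
Context (n_gt0 : (0 < n)%N) (a_sym : forall i j, a i j = a j i).
Context (a_ge0 : forall i j, 0 <= a i j).

Let A : 'M[R]_n := \matrix_(i, j) a i j.
Let Q (v : 'rV[R]_n) := dot (A *m v^T) v^T.
Let N (v : 'rV[R]_n) := dot v^T v^T.

Let continuous_sum (F : 'I_n -> 'rV[R]_n -> R) : (forall i, continuous (F i)) ->
  continuous (fun v => \sum_i F i v).
Proof.
move=> cF v; apply: cvg_big; first exact: add_continuous.
  exact: nbhs_filter.
by move=> i _; exact: cF.
Qed.

Let continuous_Q : continuous Q.
Proof.
rewrite (_ : Q = fun v => \sum_i ((\sum_j a i j * v 0 j) * v 0 i)).
  apply: continuous_sum => i v; apply: cvgM; [exact: nbhs_filter| |exact: coord_continuous].
  apply: (@continuous_sum (fun j u => a i j * u 0 j)) => j u.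
  by apply: cvgM; [exact: nbhs_filter | exact: cst_continuous | exact: coord_continuous].
apply/funext => v; rewrite /Q /dot; apply: eq_bigr => i _; rewrite !mxE; congr (_ * _).
by apply: eq_bigr => j _; rewrite !mxE.
Qed.

Let continuous_N : continuous N.
Proof.
rewrite (_ : N = fun v => \sum_i (v 0 i * v 0 i)).
  by apply: continuous_sum => i v; apply: cvgM; [exact: nbhs_filter | exact: coord_continuous..].
by apply/funext => v; apply: eq_bigr => i _; rewrite !mxE.
Qed.

Let dot_delta (u : 'cV[R]_n) i : dot u (delta_mx i 0) = u i 0.
Proof.
rewrite /dot (bigD1 i) //= mxE !eqxx mulr1 big1 ?addr0 // => j ji.
by rewrite mxE (negPf ji) mulr0.
Qed.

(** Variational proof: [Q], the quadratic form of the matrix, attains its maximum over the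
    nonnegative unit vectors at some [v]. First-order optimality along each basis vector gives
    [A v <= Q(v) v]. As [v . (Q(v) v - A v) = 0], equality holds where [v] is positive; where [v]
    vanishes it follows from [A v >= 0]. *)
Lemma perron : exists lam (p : 'I_n -> R),
  [/\ forall i, 0 <= p i, exists i, 0 < p i & forall i, \sum_j a i j * p j = lam * p i].
Proof.
pose K := ([set v : 'rV[R]_n | forall i, (`[0 : R, 1 : R]%classic) (v ord0 i)]
  `&` N @^-1` [set 1])%classic.
have cK : compact K.
  apply: compact_closedI; first by apply: (@rV_compact R n (fun=> `[0 : R, 1 : R]%classic)) => i; exact: segment_compact.
  by apply: preimage_closed => [v _|]; [exact: continuous_N | exact: closed_eq].
have NE (u : 'rV[R]_n) : N u = \sum_i (u 0 i * u 0 i).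
  by apply: eq_bigr => i _; rewrite !mxE.
have K0 : (K !=set0)%classic.
  pose i0 := Ordinal n_gt0; exists (delta_mx 0 i0); split.
    by move=> i; rewrite /= in_itv /= mxE eqxx /=; case: eqP => _; rewrite ?ler01 ?lexx.
  by rewrite /= /N trmx_delta dot_delta mxE !eqxx.
have [v vK vmax] := EVT_max_rV K0 cK (continuous_subspaceT continuous_Q).
have [v01 Nv] : K v by rewrite -in_setE.
have v_ge0 i : 0 <= v 0 i by have := v01 i; rewrite /= in_itv /= => /andP[].
(* Homogeneity extends maximality from unit vectors to all nonnegative vectors. *)
have Qmax (u : 'rV[R]_n) : (forall i, 0 <= u 0 i) -> Q u <= Q v * N u.
  move=> u0; have [Nu0|Nu0] := eqVneq (N u) 0.
    by rewrite Nu0 mulr0 /Q; move/eqP: Nu0; rewrite /N dot_eq0 => /eqP->; rewrite dot0r.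
  have Nu : 0 < N u by rewrite lt_def Nu0 dot_ge0.
  pose k := (Num.sqrt (N u))^-1.
  have k2 : k * k * N u = 1.
    by rewrite -expr2 /k exprVn sqr_sqrtr ?ltW // mulVf.
  have k0 : 0 <= k by rewrite invr_ge0 sqrtr_ge0.
  have QZ : Q (k *: u) = k * k * Q u.
    by rewrite /Q linearZ /= -scalemxAr dotZl dotZr mulrA.
  have NZ : N (k *: u) = 1.
    by rewrite -k2 /N linearZ /= dotZl dotZr mulrA.
  have : Q (k *: u) <= Q v.
    apply: vmax; rewrite in_setE; split=> // i /=.
    rewrite in_itv /= mxE mulr_ge0 ?u0 //=.
    have : (k * u 0 i) * (k * u 0 i) <= 1.
      rewrite -NZ NE (bigD1 i) //= !mxE lerDl; apply: sumr_ge0 => j _.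
      by rewrite -expr2 sqr_ge0.
    by have := mulr_ge0 k0 (u0 i); nra.
  by rewrite QZ => H; have := ler_wpM2r (ltW Nu) H; rewrite mulrAC k2 mul1r.
pose w i := \sum_j a i j * v 0 j.
have wE i : (A *m v^T) i 0 = w i.
  by rewrite mxE; apply: eq_bigr => j _; rewrite !mxE.
have A_sym : A^T = A by apply/matrixP => i j; rewrite !mxE a_sym.
have w_ge0 i : 0 <= w i by apply: sumr_ge0 => j _; rewrite mulr_ge0.
have Nv1 : dot v^T v^T = 1 by exact: Nv.
have wle i : w i <= Q v * v 0 i.
  have dii : dot (A *m delta_mx i 0) (delta_mx i 0) = a i i.
    by rewrite dot_delta -colE !mxE.
  have QD (e : R) : Q (v + e *: delta_mx 0 i) = Q v + 2 * e * w i + e * e * a i i.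
    rewrite /Q linearD linearZ /= trmx_delta mulmxDr -scalemxAr !dotDE dii.
    have Ed : dot (A *m delta_mx i 0) v^T = w i by rewrite dot_adj A_sym dotC dot_delta wE.
    by rewrite dot_delta wE Ed; lra.
  have ND (e : R) : N (v + e *: delta_mx 0 i) = 1 + 2 * e * v 0 i + e * e.
    rewrite /N linearD linearZ /= trmx_delta !dotDE Nv1 [dot (delta_mx _ _) v^T]dotC.
    by rewrite !dot_delta !mxE !eqxx /=; lra.
  have key (e : R) : 0 < e -> 2 * (w i - Q v * v 0 i) <= e * (Q v - a i i).
    move=> e0; have := Qmax (v + e *: delta_mx 0 i).
    rewrite QD ND => H; have {}H : Q v + 2 * e * w i + e * e * a i i <=
        Q v * (1 + 2 * e * v 0 i + e * e).
      by apply: H => j; rewrite !mxE; apply: addr_ge0 => //; apply: mulr_ge0; [exact: ltW | exact: ler0n].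
    by rewrite -(ler_pM2l e0); nra.
  rewrite leNgt; apply/negP; rewrite -subr_gt0; set D := _ - _ => D0.
  have d0 : 0 < `|Q v - a i i| + 1 by rewrite ltr_wpDl.
  (* With this [e] the right side of [key] is at most [D - e], which is less than [2 D]. *)
  have := key (D / (`|Q v - a i i| + 1)); rewrite divr_gt0 // -/D => /(_ isT).
  have e0 : 0 < D / (`|Q v - a i i| + 1) by rewrite divr_gt0.
  have := ler_wpM2l (ltW e0) (ler_norm (Q v - a i i)).
  have := divfK (lt0r_neq0 d0) D; rewrite mulrDr mulr1.
  by set e := _ / _ in e0 * => E le1 le2; clear -D0 e0 E le1 le2; lra.
have v_pos : exists i, 0 < v 0 i.
  apply: contrapT => nex; move: Nv1; rewrite -/(N v) NE big1 => [/eqP|i _].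
    by rewrite eq_sym oner_eq0.
  suff -> : v 0 i = 0 by rewrite mulr0.
  apply/eqP; rewrite eq_le v_ge0 andbT leNgt; apply/negP => vi.
  by apply: nex; exists i.
exists (Q v), (v 0); split=> // i; apply/eqP; rewrite eq_le wle /=.
have S0 : \sum_i v 0 i * (Q v * v 0 i - w i) = 0.
  have : \sum_i v 0 i * (Q v * v 0 i - w i) = Q v * N v - Q v.
    rewrite NE mulr_sumr {3}/Q /dot -sumrB; apply: eq_bigr => j _.
    by rewrite wE mxE; lra.
  by rewrite /N Nv1 mulr1 subrr.
have [->|vi] := eqVneq (v 0 i) 0; first by rewrite mulr0 w_ge0.
move/eqP: S0; rewrite psumr_eq0 => [/allP/(_ i (mem_index_enum _))|j _].
  by rewrite /= mulf_eq0 (negPf vi) /= subr_eq0 => /eqP->.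
by rewrite mulr_ge0 // subr_ge0.
Qed.

End PerronVector.

(** * Noncrossing elements *)

Section Group.
Context {R : realType} {n : nat} (W : set 'M[R]_n).
Context (W_orth : orthogonal_group W).
Implicit Types (u v x y t : 'cV[R]_n) (g k w : 'M[R]_n) (ts : seq 'cV[R]_n).

Definition unit_root t := dot t t = 1 /\ W (reflmx t).

Lemma group1 : W 1%:M. Proof. by case: W_orth. Qed.
Lemma groupM g k : W g -> W k -> W (g *m k). Proof. by case: W_orth => ? + ? ?; apply. Qed.
Lemma group_tr_mul g : W g -> g^T *m g = 1%:M. Proof. by case: W_orth => ? ? ? +; apply. Qed.
Lemma group_mul_tr g : W g -> g *m g^T = 1%:M. Proof. by move=> /group_tr_mul/mulmx1C. Qed.

Lemma group_inv g : W g -> invmx g = g^T.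
Proof.
move=> /group_mul_tr gg; have [gu _] := mulmx1_unit gg.
by rewrite -[LHS]mulmx1 -gg mulmxA mulVmx // mul1mx.
Qed.

Lemma group_tr g : W g -> W g^T.
Proof. by move=> gW; rewrite -group_inv //; case: W_orth => ? ? + ?; apply. Qed.

Lemma group_dot g u v : W g -> dot (g *m u) (g *m v) = dot u v.
Proof. by move=> gW; rewrite dot_adj mulmxA group_tr_mul // mul1mx. Qed.

Lemma group_trK g v : W g -> g^T *m (g *m v) = v.
Proof. by move=> gW; rewrite mulmxA group_tr_mul // mul1mx. Qed.

Lemma group_Ktr g v : W g -> g *m (g^T *m v) = v.
Proof. by move=> gW; rewrite mulmxA group_mul_tr // mul1mx. Qed.

Lemma root_unit t : unit_root t -> dot t t = 1. Proof. by case. Qed.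
Lemma root_group t : unit_root t -> W (reflmx t). Proof. by case. Qed.

Lemma root_neq0 t : unit_root t -> t != 0.
Proof. by case=> t1 _; rewrite -dot_eq0 t1 oner_eq0. Qed.

Lemma root_opp t : unit_root t -> unit_root (- t).
Proof. by case=> t1 tW; split; rewrite ?reflmxN // dotNl dotNr opprK. Qed.

Lemma root_neqN t : unit_root t -> - t <> t.
Proof.
move=> /root_unit t1 tN; have : dot (- t) t = dot t t by rewrite tN.
by rewrite dotNl t1; lra.
Qed.

Lemma root_image g t : W g -> unit_root t -> unit_root (g *m t).
Proof.
move=> gW [t1 tW]; split; first by rewrite group_dot.
by rewrite -reflmx_conj ?group_tr_mul //; do !apply: groupM => //; exact: group_tr.
Qed.

Lemma reflmx_root t v : unit_root t -> reflmx t *m v = v - (2 * dot t v) *: t.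
Proof. by case=> t1 _; exact: reflmx1E. Qed.

Lemma rootKmx t : unit_root t -> reflmx t *m reflmx t = 1%:M.
Proof. by move=> /root_neq0/reflmxK. Qed.

Lemma rootK t v : unit_root t -> reflmx t *m (reflmx t *m v) = v.
Proof. by move=> tr; rewrite mulmxA rootKmx // mul1mx. Qed.

Lemma root_self t : unit_root t -> reflmx t *m t = - t.
Proof. by move=> /root_neq0/reflmx_id. Qed.

Lemma reflmx_image g t : W g -> reflmx (g *m t) = g *m reflmx t *m g^T.
Proof. by move=> gW; rewrite reflmx_conj // group_tr_mul. Qed.

Lemma reflection_root g : reflections W g -> exists2 t, unit_root t & g = reflmx t.
Proof.
move=> [gW [t t0 gE]]; pose a := (Num.sqrt (dot t t))^-1.
have s0 : 0 < Num.sqrt (dot t t) by rewrite sqrtr_gt0 lt_def dot_ge0 dot_eq0 t0.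
have a0 : a != 0 by rewrite invr_eq0 gt_eqF.
exists (a *: t); last by rewrite reflmxZ.
split; last by rewrite reflmxZ // -gE.
rewrite dotZl dotZr -(sqr_sqrtr (dot_ge0 t)) expr2.
by rewrite /a mulKf ?mulVf // gt_eqF.
Qed.

Lemma root_reflection t : unit_root t -> reflections W (reflmx t).
Proof. by move=> tr; split; [exact: root_group | exists t => //; exact: root_neq0]. Qed.

Lemma refl_prod_nil : @refl_prod R n [::] = 1%:M.
Proof. exact: big_nil. Qed.

Lemma refl_prod_cons t ts : refl_prod (t :: ts) = reflmx t *m refl_prod ts.
Proof. exact: big_cons. Qed.

Lemma refl_prod_cat ts us : refl_prod (ts ++ us) = refl_prod ts *m refl_prod us.
Proof.
elim: ts => [|t ts IH] /=; first by rewrite refl_prod_nil mul1mx.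
by rewrite !refl_prod_cons IH mulmxA.
Qed.

Lemma refl_prod1 t : refl_prod [:: t] = reflmx t.
Proof. by rewrite refl_prod_cons refl_prod_nil mulmx1. Qed.

Lemma refl_prod_rcons ts t : refl_prod (rcons ts t) = refl_prod ts *m reflmx t.
Proof. by rewrite -cats1 refl_prod_cat refl_prod1. Qed.

Lemma refl_prod_group ts : (forall t, t \in ts -> unit_root t) -> W (refl_prod ts).
Proof.
elim: ts => [|t ts IH] tsr; first by rewrite refl_prod_nil; exact: group1.
rewrite refl_prod_cons; apply: groupM; first by apply: root_group; apply: tsr; rewrite mem_head.
by apply: IH => x xts; apply: tsr; rewrite in_cons xts orbT.
Qed.

Lemma tr_refl_prod ts : (refl_prod ts)^T = refl_prod (rev ts).
Proof.
elim: ts => [|t ts IH]; first by rewrite refl_prod_nil trmx1.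
by rewrite rev_cons refl_prod_rcons refl_prod_cons trmx_mul tr_reflmx IH.
Qed.

(** The image of [1 - w]. For [w] in the group this is [M(w)] ([in_movedP]), but membership comes
    with a preimage to compute with. *)
Definition moved w v := exists u, v = u - w *m u.

Lemma moved0 w : moved w 0.
Proof. by exists 0; rewrite mulmx0 subr0. Qed.

Lemma movedD w x y : moved w x -> moved w y -> moved w (x + y).
Proof.
by move=> [u ->] [v ->]; exists (u + v); rewrite mulmxDr opprD addrACA.
Qed.

Lemma movedZ w a x : moved w x -> moved w (a *: x).
Proof. by move=> [u ->]; exists (a *: u); rewrite -scalemxAr scalerBr. Qed.

Lemma movedN w x : moved w x -> moved w (- x).
Proof. by rewrite -scaleN1r; exact: movedZ. Qed.

Lemma movedB w x y : moved w x -> moved w y -> moved w (x - y).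
Proof. by move=> xw yw; apply: movedD xw _; apply: movedN. Qed.

Lemma moved_sub w x : moved w (x - w *m x). Proof. by exists x. Qed.

Lemma moved_mul w x : moved w x -> moved w (w *m x).
Proof. by move=> xw; rewrite -[w *m x](subKr x); exact: movedB xw (moved_sub w x). Qed.

Lemma moved_tr w x : W w -> moved w x -> moved w (w^T *m x).
Proof.
move=> wW [u ->]; exists (w^T *m u).
by rewrite mulmxBr group_trK // group_Ktr.
Qed.

Lemma moved1 x : moved 1%:M x -> x = 0.
Proof. by case=> u ->; rewrite mul1mx subrr. Qed.

Lemma moved_eq0 w : (forall x, moved w x -> x = 0) -> w = 1%:M.
Proof.
move=> w0; apply: mx_ext => v; rewrite mul1mx.
by apply/esym/eqP; rewrite -subr_eq0; apply/eqP/w0; exists v.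
Qed.

Lemma moved_submx w x : reflect (moved w x) (x^T <= (1%:M - w)^T)%MS.
Proof.
apply: (iffP submxP) => [[D /(congr1 trmx)]|[u ->]].
  by rewrite trmxK trmx_mul trmxK => ->; exists D^T; rewrite mulmxBl mul1mx.
by exists u^T; rewrite -trmx_mul mulmxBl mul1mx.
Qed.

Lemma fixed_dot_moved w u v : W w -> w *m u = u -> moved w v -> dot u v = 0.
Proof.
move=> wW wu [x ->]; rewrite dotDr dotNr dotC -(group_dot _ _ wW) wu.
by rewrite [dot u _]dotC subrr.
Qed.

Lemma in_movedP w v : W w -> in_moved w v <-> moved w v.
Proof.
move=> wW; split=> [wv|wv u wu]; last exact: fixed_dot_moved wv.
suff /submxP[D vE] : (v^T <= 1%:M - w)%MS.
  (* Since [(1 - w^T) x = (1 - w) (- w^T x)], the row space of [1 - w] lies in the image of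
     [1 - w]. *)
  exists (- (w^T *m D^T)); rewrite -[v]trmxK vE trmx_mul linearB /= trmx1.
  by rewrite mulmxBl mul1mx mulmxN mulmxA group_mul_tr // mul1mx opprK addrC.
rewrite submxE; apply/eqP/matrixP => i j; rewrite ord1 !mxE.
set x := col j (cokermx (1%:M - w)).
have wx : w *m x = x.
  apply/eqP; rewrite eq_sym -subr_eq0 -{1}[x]mul1mx -mulmxBl.
  by rewrite /x colE mulmxA mulmx_coker mul0mx.
have := wv x wx; rewrite dotC /dot => E; rewrite -[RHS]E.
by apply: eq_bigr => k _; rewrite !mxE.
Qed.

Definition codim w := \rank (1%:M - w).

Lemma rank_refl_mul t w : (codim (reflmx t *m w) <= (codim w).+1)%N.
Proof.
rewrite /codim; have -> : 1%:M - reflmx t *m w = (1%:M - w) + (2 / dot t t) *: (t *m t^T) *m w.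
  by rewrite /reflmx mulmxBl mul1mx opprB addrA addrAC.
apply: leq_trans (mxrank_add _ _) _; rewrite -[(\rank _).+1]addn1 leq_add //.
apply: leq_trans (mxrankM_maxl _ _) _.
by apply: leq_trans (mxrank_scale _ _) _; apply: leq_trans (mxrankM_maxl _ _) (rank_leq_col _).
Qed.

Lemma rank_refl_prod ts : (codim (refl_prod ts) <= size ts)%N.
Proof.
elim: ts => [|t ts IH]; first by rewrite /codim refl_prod_nil subrr mxrank0.
by rewrite refl_prod_cons; apply: leq_trans (rank_refl_mul _ _) _.
Qed.

(** The moved space of a product lies in the span of the factors' roots; when its dimension is the
    number of factors it is the whole span. *)
Lemma root_span_refl_prod ts :
  size ts = codim (refl_prod ts) ->
  forall t, t \in ts -> moved (refl_prod ts) t.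
Proof.
move=> sz; pose S := \matrix_(i < size ts) (nth 0 ts i)^T.
have mem_S t : t \in ts -> (t^T <= S)%MS.
  move=> tts; have it : (index t ts < size ts)%N by rewrite index_mem.
  by have := row_sub (Ordinal it) S; rewrite rowK /= nth_index.
have sub us : (forall t, t \in us -> t \in ts) -> ((1%:M - refl_prod us)^T <= S)%MS.
  elim: us => [|t us IH] usts; first by rewrite refl_prod_nil subrr trmx0 sub0mx.
  have -> : 1%:M - refl_prod (t :: us) =
      (1%:M - refl_prod us) + (2 / dot t t) *: (t *m (t^T *m refl_prod us)).
    rewrite refl_prod_cons /reflmx mulmxBl mul1mx opprB addrA addrAC.
    by rewrite -scalemxAl -mulmxA.
  rewrite linearD /= addmx_sub ?IH // => [y yx|].
    by rewrite usts // in_cons yx orbT.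
  by rewrite linearZ /= scalemx_sub // trmx_mul mulmx_sub // mem_S // usts ?mem_head.
have [_ E] := mxrank_leqif_sup (sub ts (fun _ => id)).
move=> t tts; apply/moved_submx; apply: submx_trans (mem_S _ tts) _.
rewrite -E eqn_leq mxrankS ?sub //= mxrank_tr.
by apply: leq_trans (rank_leq_row S) _; rewrite sz.
Qed.

Lemma moved_subset_submx w w' : (forall x, moved w' x -> moved w x) ->
  ((1%:M - w')^T <= (1%:M - w)^T)%MS.
Proof.
move=> sub; apply/rV_subP => u /submxP[D ->]; apply/submxP.
have /sub[v vE] : moved w' (D *m (1%:M - w')^T)^T.
  by exists D^T; rewrite trmx_mul trmxK mulmxBl mul1mx.
exists v^T; apply: trmx_inj; rewrite vE trmx_mul !trmxK.
by rewrite mulmxBl mul1mx.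
Qed.

Lemma codim_leq w w' : (forall x, moved w' x -> moved w x) -> (codim w' <= codim w)%N.
Proof.
by move=> /moved_subset_submx sub; rewrite /codim -mxrank_tr -[X in (_ <= X)%N]mxrank_tr mxrankS.
Qed.

Lemma rank_moved_ltn w w' r : (forall x, moved w' x -> moved w x) ->
  moved w r -> ~ moved w' r -> (codim w' < codim w)%N.
Proof.
move=> sub wr w'r; rewrite /codim -mxrank_tr -[X in (_ < X)%N]mxrank_tr.
apply: rank_ltmx; rewrite ltmxE moved_subset_submx //=.
apply/negP => ww'; apply: w'r; apply/moved_submx.
by apply: submx_trans ww'; apply/moved_submx.
Qed.

End Group.

(** * The Euler form on moved spaces; removing and adding a reflection *)

Section Noncrossing.
Context {R : realType} {n : nat} (W : set 'M[R]_n).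
Context (W_orth : orthogonal_group W) (b : 'M[R]_n).
Context (b_def : forall x, dot (b *m x) x = dot x x).
Implicit Types (u v x y t : 'cV[R]_n) (g k w : 'M[R]_n) (ts : seq 'cV[R]_n).

Local Notation unit_root := (unit_root W).

Definition bil x y := dot (b *m x) y.

Lemma bilDl x y z : bil (x + y) z = bil x z + bil y z.
Proof. by rewrite /bil mulmxDr dotDl. Qed.
Lemma bilDr z x y : bil z (x + y) = bil z x + bil z y.
Proof. by rewrite /bil dotDr. Qed.
Lemma bilZl a x z : bil (a *: x) z = a * bil x z.
Proof. by rewrite /bil -scalemxAr dotZl. Qed.
Lemma bilZr a z x : bil z (a *: x) = a * bil z x.
Proof. by rewrite /bil dotZr. Qed.
Lemma bilNl x z : bil (- x) z = - bil x z.
Proof. by rewrite /bil mulmxN dotNl. Qed.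
Lemma bilNr z x : bil z (- x) = - bil z x.
Proof. by rewrite /bil dotNr. Qed.
Lemma bil0l z : bil 0 z = 0.
Proof. by rewrite /bil mulmx0 dot0l. Qed.
Lemma bil0r z : bil z 0 = 0.
Proof. by rewrite /bil dot0r. Qed.

Definition bilE := (bilDl, bilDr, bilZl, bilZr, bilNl, bilNr).

Lemma bilxx x : bil x x = dot x x. Proof. exact: b_def. Qed.

Lemma bil_sym x y : bil x y + bil y x = 2 * dot x y.
Proof.
have := bilxx (x + y); rewrite !bilE !dotDE !bilxx [dot y x]dotC.
by lra.
Qed.

Lemma root_bil t : unit_root t -> bil t t = 1.
Proof. by rewrite bilxx; exact: root_unit. Qed.

Definition nc w :=
  W w /\ forall u y, moved w y -> bil (u - w *m u) y = 2 * dot u y.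

Lemma nc_group w : nc w -> W w. Proof. by case. Qed.

Lemma nc1 : nc 1%:M.
Proof.
by split=> [|u y /moved1->]; [exact: (group1 W_orth) | rewrite bil0r dot0r mulr0].
Qed.

(** Serre duality on [M(w)]: the identity in [nc] at [u = x], compared with the symmetrisation
    [b (x, y) + b (y, x) = 2 x . y]. *)
Lemma nc_serre w x y : nc w -> moved w x -> moved w y -> bil (w *m x) y = - bil y x.
Proof.
move=> [_ wE] wx wy; have := wE x y wy; have := bil_sym x y.
by rewrite !bilE; lra.
Qed.

Lemma nc_serre_tr w x y : nc w -> moved w x -> moved w y ->
  bil x y = - bil y (w^T *m x).
Proof.
move=> ncw wx wy; have wW := nc_group ncw.
rewrite -{1}(group_Ktr W_orth x wW) (nc_serre ncw) //; exact: (moved_tr W_orth).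
Qed.

Lemma nc_bil w x y : nc w -> moved w x -> moved w y -> bil (w *m x) (w *m y) = bil x y.
Proof. by move=> ncw wx wy; rewrite !nc_serre ?opprK //; exact: moved_mul. Qed.

Section RemoveRight.
Context w t (ncw : nc w) (tr : unit_root t) (wt : moved w t).

Let mulE v : (w *m reflmx t) *m v = w *m v - (2 * dot t v) *: (w *m t).
Proof. by rewrite -mulmxA (reflmx_root _ tr) mulmxBr scalemxAr. Qed.

(** As [b (u - w u, t) = 2 u . t], the vector [u - w u] is left orthogonal to [t] iff [u] is
    orthogonal to [t], and then [w] and [w R(t)] agree on [u]. *)
Lemma moved_mul_reflmx y : moved (w *m reflmx t) y <-> moved w y /\ bil y t = 0.
Proof.
have [wW wE] := ncw; have t1 := root_bil tr.
have wtt := nc_serre ncw wt wt.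
split=> [[u ->]|[[u ->] ut]].
  split; last by have := wE u t wt; rewrite mulE !bilE wtt dotC t1; lra.
  rewrite mulE opprB addrCA; apply: movedD; last exact: moved_sub.
  exact/movedZ/moved_mul.
exists u; rewrite mulE; have := wE u t wt; rewrite ut dotC => /esym/eqP.
by rewrite mulf_eq0 pnatr_eq0 /= => /eqP->; rewrite mulr0 scale0r subr0.
Qed.

Lemma nc_mul_reflmx : nc (w *m reflmx t).
Proof.
have [wW wE] := ncw; split; first exact/(groupM W_orth)/(root_group tr).
move=> u y /moved_mul_reflmx[wy yt]; rewrite mulE.
have := nc_serre ncw wt wy; have := wE u y wy; rewrite !bilE yt => *; nra.
Qed.

End RemoveRight.

Section RemoveLeft.
Context w t (ncw : nc w) (tr : unit_root t) (wt : moved w t).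

Let wW : W w. Proof. exact: nc_group ncw. Qed.

(** Removal of [t] on the left is removal of [w^-1 t] on the right; Serre duality then turns left
    orthogonality to [w^-1 t] into right orthogonality to [t]. *)
Let flip : reflmx t *m w = w *m reflmx (w^T *m t).
Proof.
rewrite (reflmx_image W_orth _ (group_tr W_orth wW)) trmxK !mulmxA.
by rewrite (group_mul_tr W_orth wW) mul1mx.
Qed.

Let tr' : unit_root (w^T *m t).
Proof. by apply: (root_image W_orth _ tr); exact: group_tr. Qed.

Lemma moved_reflmx_mul y : moved (reflmx t *m w) y <-> moved w y /\ bil t y = 0.
Proof.
rewrite flip (moved_mul_reflmx ncw tr' (moved_tr W_orth wW wt)).
split=> -[wy ty]; split=> //; first by rewrite (nc_serre_tr ncw) // ty oppr0.
by apply: oppr_inj; rewrite -(nc_serre_tr ncw) // ty oppr0.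
Qed.

Lemma nc_reflmx_mul : nc (reflmx t *m w).
Proof. by rewrite flip; apply: (nc_mul_reflmx ncw tr'); exact: (moved_tr W_orth). Qed.

End RemoveLeft.

Section AddLeft.
Context w t (ncw : nc w) (tr : unit_root t).
Context (wt : forall y, moved w y -> bil t y = 0).

Let mulE v : (reflmx t *m w) *m v = w *m v - (2 * dot t (w *m v)) *: t.
Proof. by rewrite -mulmxA (reflmx_root _ tr). Qed.

Lemma add_left_not_moved : ~ moved w t.
Proof. by move=> /wt; rewrite (root_bil tr) => /eqP; rewrite oner_eq0. Qed.

(** [t] is not in [M(w)], so some fixed vector of [w] is not orthogonal to [t]; [R(t) w] moves it by
    a nonzero multiple of [t]. *)
Lemma add_left_moved_root : moved (reflmx t *m w) t.
Proof.
have [u wu ut] : exists2 u, w *m u = u & dot u t != 0.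
  apply: contrapT => nex; apply: add_left_not_moved.
  apply/(in_movedP W_orth _ (nc_group ncw)) => u wu.
  by apply/eqP/negPn/negP => ut; apply: nex; exists u.
exists ((2 * dot u t)^-1 *: u); rewrite mulE -scalemxAr wu dotZr [dot t u]dotC.
have -> : 2 * ((2 * dot u t)^-1 * dot u t) = 1.
  by rewrite mulrCA mulVf // mulf_neq0 // pnatr_eq0.
by rewrite scale1r opprB addrCA subrr addr0.
Qed.

Lemma add_left_moved y :
  moved (reflmx t *m w) y <-> exists a x, moved w x /\ y = x + a *: t.
Proof.
split=> [[u ->]|[a [x [[u ->] ->]]]].
  by exists (2 * dot t (w *m u)), (u - w *m u); rewrite mulE opprB addrCA addrC; split=> //; exists u.
have -> : u - w *m u = (u - (reflmx t *m w) *m u) - (2 * dot t (w *m u)) *: t.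
  by rewrite mulE opprB addrCA [RHS]addrC addKr.
have wt' := add_left_moved_root.
apply: movedD (movedZ _ wt'); apply: movedB (movedZ _ wt'); exact: moved_sub.
Qed.

Lemma nc_add_left : nc (reflmx t *m w).
Proof.
have [wW wE] := ncw; split; first exact/(groupM W_orth _ wW)/(root_group tr).
move=> u y /add_left_moved[a [x [wx ->]]].
have ux := wE u x wx; have tx := wt wx.
have ut := bil_sym (u - w *m u) t; rewrite (wt (moved_sub w u)) !dotDE !bilE in ut.
rewrite mulE !bilE tx (root_bil tr) !dotDE; rewrite !bilE in ux.
by rewrite [dot t _]dotC; nra.
Qed.

End AddLeft.

Section AddRight.
Context w t (ncw : nc w) (tr : unit_root t).
Context (wt : forall y, moved w y -> bil y t = 0).

Let wW : W w. Proof. exact: nc_group ncw. Qed.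

Let flip : w *m reflmx t = reflmx (w *m t) *m w.
Proof. by rewrite (reflmx_image W_orth _ wW) -!mulmxA (group_tr_mul W_orth wW) mulmx1. Qed.

Let tr' : unit_root (w *m t). Proof. by apply: (root_image W_orth wW tr). Qed.

Let wt' y : moved w y -> bil (w *m t) y = 0.
Proof.
move=> wy; have [_ /(_ t y wy)] := ncw; have := bil_sym t y.
by rewrite wt // !bilE; lra.
Qed.

Lemma nc_add_right : nc (w *m reflmx t).
Proof. by rewrite flip; apply: nc_add_left. Qed.

Lemma add_right_moved y :
  moved (w *m reflmx t) y <-> exists a x, moved w x /\ y = x + a *: t.
Proof.
rewrite flip (add_left_moved ncw tr' wt').
split=> -[a [x [wx ->]]]; exists a.
  exists (x - a *: (t - w *m t)); split; first by apply/(movedB wx)/movedZ/moved_sub.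
  by rewrite -addrA -scalerN -scalerDr opprB subrK.
exists (x + a *: (t - w *m t)); split; first by apply/(movedD wx)/movedZ/moved_sub.
by rewrite -addrA -scalerDr subrK.
Qed.

Lemma add_right_moved_root : moved (w *m reflmx t) t.
Proof. by apply/add_right_moved; exists 1, 0; split; [exact: moved0 | rewrite scale1r add0r]. Qed.

Lemma add_right_sub y : moved w y -> moved (w *m reflmx t) y.
Proof. by move=> wy; apply/add_right_moved; exists 0, y; rewrite scale0r addr0. Qed.

End AddRight.

(** Linear induction over the span of the factors' roots, which contains the moved space of the
    product. *)
Lemma moved_refl_prod_ind (P : 'cV[R]_n -> Prop) ts :
  P 0 -> (forall x y, P x -> P y -> P (x + y)) -> (forall a x, P x -> P (a *: x)) ->
  (forall t, t \in ts -> P t) -> forall y, moved (refl_prod ts) y -> P y.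
Proof.
move=> P0 PD PZ Pts y [u ->]; elim: ts Pts => [|t ts IH] Pts.
  by rewrite refl_prod_nil mul1mx subrr.
rewrite refl_prod_cons -mulmxA reflmxE opprB addrCA.
apply: PD; first by apply/PZ/Pts/mem_head.
by apply: IH => x xts; apply: Pts; rewrite in_cons xts orbT.
Qed.

(** Convention: the form vanishes from a later root to an earlier one. The matching product is
    [refl_prod (rev ts)], with the last root leftmost. *)
Definition exceptional ts := pairwise (fun x y => bil y x == 0) ts.

Lemma bil_moved_l ts z : (forall t, t \in ts -> bil t z = 0) ->
  forall y, moved (refl_prod ts) y -> bil y z = 0.
Proof.
apply: moved_refl_prod_ind => [|x y xz yz|a x xz]; first exact: bil0l.
  by rewrite bilDl xz yz addr0.
by rewrite bilZl xz mulr0.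
Qed.

Lemma bil_moved_r ts z : (forall t, t \in ts -> bil z t = 0) ->
  forall y, moved (refl_prod ts) y -> bil z y = 0.
Proof.
apply: moved_refl_prod_ind => [|x y xz yz|a x xz]; first exact: bil0r.
  by rewrite bilDr xz yz addr0.
by rewrite bilZr xz mulr0.
Qed.

Lemma exceptional_rcons ts t :
  exceptional (rcons ts t) = exceptional ts && all (fun x => bil t x == 0) ts.
Proof. by rewrite /exceptional -cats1 pairwise_cat allrel1r /= andbT andbC. Qed.

Lemma exceptional_nc ts : (forall t, t \in ts -> unit_root t) -> exceptional ts ->
  nc (refl_prod (rev ts)) /\ (forall t, t \in ts -> moved (refl_prod (rev ts)) t).
Proof.
elim/last_ind: ts => [|ts t IH] tsr.
  by rewrite refl_prod_nil; split=> //; exact: nc1.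
rewrite exceptional_rcons => /andP[ets /allP tts].
have [|ncts mts] := IH _ ets.
  by move=> x xts; apply: tsr; rewrite mem_rcons in_cons xts orbT.
have tr : unit_root t by apply: tsr; rewrite mem_rcons mem_head.
have wt y : moved (refl_prod (rev ts)) y -> bil t y = 0.
  by apply: bil_moved_r => x; rewrite mem_rev => /tts/eqP.
rewrite rev_rcons refl_prod_cons; split; first exact: nc_add_left.
move=> x; rewrite mem_rcons in_cons => /predU1P[->|/mts xm].
  exact: add_left_moved_root.
by apply/(add_left_moved ncts tr wt); exists 0, x; rewrite scale0r addr0.
Qed.

(** In a factorisation of length [codim w] each root lies in the moved space, so taking off the
    leftmost factor confines the others to its right orthogonal. *)
Lemma refl_prod_exceptional w ts : nc w -> (forall t, t \in ts -> unit_root t) ->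
  w = refl_prod ts -> size ts = codim w -> exceptional (rev ts).
Proof.
elim: ts w => [|t ts IH] w ncw tsr wE sz //.
have tr : unit_root t by apply: tsr; exact: mem_head.
have tsr' x : x \in ts -> unit_root x.
  by move=> xts; apply: tsr; rewrite in_cons xts orbT.
have wt : moved w t by rewrite wE; apply: root_span_refl_prod; rewrite -?wE ?mem_head.
have w'E : reflmx t *m w = refl_prod ts.
  by rewrite wE refl_prod_cons mulmxA (rootKmx tr) mul1mx.
have sz' : size ts = codim (refl_prod ts).
  apply/eqP; rewrite eqn_leq rank_refl_prod andbT -ltnS.
  by rewrite -[(size ts).+1]/(size (t :: ts)) sz wE refl_prod_cons rank_refl_mul.
have ncw' := nc_reflmx_mul ncw tr wt; rewrite w'E in ncw'.
rewrite rev_cons exceptional_rcons; apply/andP; split; first exact: (IH _ ncw').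
apply/allP => x; rewrite mem_rev => xts. apply/eqP.
have : moved (refl_prod ts) x by exact: root_span_refl_prod.
by rewrite -w'E => /(moved_reflmx_mul ncw tr wt)[].
Qed.

End Noncrossing.

(** * Clusters and their rotation *)

Section SeqIndex.
Context {T : eqType}.
Implicit Types (s F : seq T) (x y : T).

Lemma pairwise_index s : uniq s -> pairwise (fun x y => index x s < index y s)%N s.
Proof.
elim: s => //= x s IH /andP[xs us]; rewrite eqxx; apply/andP; split.
  by apply/allP => y ys; case: eqP ys xs => [-> ->|].
apply: (@sub_in_pairwise _ (mem s)) (IH us); last exact/allP.
move=> y z ys zs; case: eqP ys xs => [-> ->|_ _ xs] //.
by case: eqP zs xs => [-> ->|].
Qed.

Lemma subseq_index s F1 x F2 y : uniq s -> subseq (F1 ++ x :: F2) s -> y \in F1 ->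
  (index y s < index x s)%N.
Proof.
move=> us sF yF1; have := subseq_pairwise sF (pairwise_index us).
by rewrite pairwise_cat => /and3P[/allrelP/(_ y x yF1 (mem_head _ _))].
Qed.

Lemma subseq_index_cat s s' F1 x F2 y : uniq (s ++ s') ->
  subseq (F1 ++ x :: F2) (s ++ s') -> x \in s -> y \in F1 ->
  y \in s /\ (index y s < index x s)%N.
Proof.
move=> us sF xs yF1; have := subseq_index us sF yF1.
rewrite !index_cat xs; case: ifP => // ys.
by rewrite ltnNge (leq_trans _ (leq_addr _ _)) // index_size.
Qed.

Lemma subseq_pairwise_cat s s' F1 x F2 : uniq (s ++ s') ->
  subseq (F1 ++ x :: F2) (s ++ s') -> x \in s ->
  pairwise (fun y z => index y s < index z s)%N F1.
Proof.
move=> us sF xs; have := subseq_pairwise sF (pairwise_index us).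
rewrite pairwise_cat => /and3P[_ + _]; apply: (@sub_in_pairwise _ (mem s)).
  by move=> y z ys zs; rewrite !index_cat ys zs.
by apply/allP => y yF1; have [] := subseq_index_cat us sF xs yF1.
Qed.

End SeqIndex.

Section Rotation.
Context {R : realType} {n : nat} (W : set 'M[R]_n).
Context (W_orth : orthogonal_group W) (b : 'M[R]_n).
Context (b_def : forall x, dot (b *m x) x = dot x x).
Implicit Types (u v x y t r : 'cV[R]_n) (g k w C : 'M[R]_n).
Implicit Types (L M F ts : seq 'cV[R]_n).

Local Notation unit_root := (unit_root W).
Local Notation bil := (bil b).
Local Notation nc := (nc W b).
Local Notation exceptional := (exceptional b).
Local Notation root_image := (root_image W_orth).

(** No chamber is mentioned, so that the rotated lists, which belong to other positive systems,
    satisfy the same definition. *)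
Definition ordered_positive L :=
  [/\ uniq L, forall t, t \in L -> unit_root t,
      forall t, unit_root t -> (t \in L) || (- t \in L),
      forall t, t \in L -> - t \notin L
    & pairwise (fun x y => (0 <= bil x y) && (bil y x <= 0)) L].

(** Rotating [L] rotates this list cyclically, so a subsequence that avoids the moved root stays a
    subsequence. *)
Definition window L := L ++ map -%R L.

(* Only the negative roots [- t] with [C^T (- t)] positive occur as vertices: they
   form the last part of the vertex set of [AX(c)], where their order is irrelevant. *)
Definition cluster L C F :=
  [/\ subseq F (window L), exceptional F, C = refl_prod (rev F)
    & forall t, t \in F -> (t \in L) || (C^T *m t \in L)].

(** For sequences that need not span [M(C)], lying in [M(C)] takes the place of the product
    condition of [cluster]. *)
Definition simplex L C F :=
  [/\ subseq F (window L), exceptional F, forall t, t \in F -> moved C t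
    & forall t, t \in F -> (t \in L) || (C^T *m t \in L)].

(* [g] is the product of the reflections in the vertices before [F]. The vertex [t] lies
   in the first facet of [X(R(t) g^-1)] iff it is the positive image of a negative root
   under this element, that is, iff [g t] is positive. *)
Fixpoint forward_roots L g F :=
  if F is t :: F' then
    let F'' := forward_roots L (g *m reflmx t) F' in
    if (t \in L) && (g *m t \in L) then t :: F'' else F''
  else [::].

Lemma forward_roots_cat L g F1 F2 : forward_roots L g (F1 ++ F2) =
  forward_roots L g F1 ++ forward_roots L (g *m refl_prod F1) F2.
Proof.
elim: F1 g => [|t F1 IH] g /=; first by rewrite refl_prod_nil mulmx1.
by rewrite IH refl_prod_cons mulmxA; case: ifP.
Qed.

Lemma forward_roots_subseq L g F : subseq (forward_roots L g F) F.
Proof.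
elim: F g => //= t F IH g; case: ifP => _; first by rewrite /= eqxx.
exact: subseq_trans (IH _) (subseq_cons _ _).
Qed.

Lemma forward_roots_congr L1 L2 g1 g2 F :
  (forall F1 t F2, F = F1 ++ t :: F2 ->
    (t \in L1) && (g1 *m refl_prod F1 *m t \in L1) =
    (t \in L2) && (g2 *m refl_prod F1 *m t \in L2)) ->
  forward_roots L1 g1 F = forward_roots L2 g2 F.
Proof.
elim: F g1 g2 => //= t F IH g1 g2 E.
have := E [::] t F erefl; rewrite refl_prod_nil !mulmx1 => ->.
rewrite (IH (g1 *m reflmx t) (g2 *m reflmx t)) // => F1 x F2 FE.
by have := E (t :: F1) x F2; rewrite FE refl_prod_cons !mulmxA => ->.
Qed.

Definition forward_prod L F := refl_prod (rev (forward_roots L 1%:M F)).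

Section OrderedPositive.
Context L (pL : ordered_positive L).

Lemma pos_uniq : uniq L. Proof. by case: pL. Qed.
Lemma pos_root t : t \in L -> unit_root t. Proof. by case: pL => _ + _ _ _; apply. Qed.
Lemma pos_cover t : unit_root t -> (t \in L) || (- t \in L).
Proof. by case: pL => _ _ + _ _; apply. Qed.
Lemma pos_opp t : t \in L -> - t \notin L. Proof. by case: pL => _ _ _ + _; apply. Qed.

Lemma negP_pos t : unit_root t -> t \notin L -> - t \in L.
Proof. by move=> /pos_cover/orP[->|]. Qed.

Lemma pos_index x y : x \in L -> y \in L -> (index x L < index y L)%N ->
  0 <= bil x y /\ bil y x <= 0.
Proof.
move=> xL yL xy; case: pL => _ _ _ _ /(pairwiseP 0) H.
have := H (index x L) (index y L); rewrite !inE !index_mem !nth_index //.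
by move=> /(_ xL yL xy)/andP[].
Qed.

(** Otherwise three roots of [L] satisfy [x + a y + z = 0] with [a > 0]. Pairing the earliest of
    them, on the left, with this sum gives a positive number. *)
Lemma pos_convex x y a : x \in L -> y \in L -> 0 <= a -> unit_root (x + a *: y) ->
  x + a *: y \in L.
Proof.
move=> xL yL a0 xyr; apply/negPn/negP => /(negP_pos xyr); set z := - _ => zL.
move: a0; rewrite le_eqVlt => /orP[/eqP a0|a0].
  by have := pos_opp xL; rewrite -[x]addr0 -(scale0r y) a0 zL.
have zE v : bil v x + a * bil v y + bil v z = 0.
  by rewrite /z !(bilNr, bilDr, bilZr); lra.
have le v v' : v \in L -> v' \in L -> (index v L <= index v' L)%N -> 0 <= bil v v'.
  move=> vL v'L; rewrite leq_eqVlt => /orP[/eqP vv'|]; last by move/(pos_index vL v'L) => [].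
  rewrite -(nth_index 0 vL) vv' (nth_index 0 v'L) (root_bil b_def (pos_root v'L)).
  exact: ler01.
have one v : v \in L -> bil v v = 1 by move=> /pos_root/(root_bil b_def).
case: (leqP (index x L) (index y L)) => xy.
  case: (leqP (index x L) (index z L)) => xz.
    have := zE x; have := one x xL; have := le _ _ xL yL xy; have := le _ _ xL zL xz.
    by nra.
  have := zE z; have := one z zL; have := le _ _ zL xL (ltnW xz).
  by have := le _ _ zL yL (ltnW (leq_trans xz xy)); nra.
case: (leqP (index y L) (index z L)) => yz.
  have := zE y; have := one y yL; have := le _ _ yL xL (ltnW xy); have := le _ _ yL zL yz.
  by nra.
have := zE z; have := one z zL; have := le _ _ zL yL (ltnW yz).
by have := le _ _ zL xL (ltnW (ltn_trans yz xy)); nra.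
Qed.

Lemma window_root t : t \in window L -> unit_root t.
Proof.
rewrite mem_cat => /orP[/pos_root//|/mapP[x /pos_root xr ->]]; exact: root_opp.
Qed.

Lemma window_uniq : uniq (window L).
Proof.
rewrite cat_uniq pos_uniq (map_inj_uniq oppr_inj) pos_uniq andbT /=.
by apply/hasPn => _ /mapP[x xL ->]; exact: pos_opp.
Qed.

(** Serre duality gives [b (t, y) = b (y, t')] with [t' = - w^-1 t]. The order makes the left side
    nonnegative unless [y] precedes [t], and the right side unless [t'] precedes [y]. Both at once
    would put [t'] before [t] and give [b (t, t') <= 0], whereas [b (t, t') = b (t', t') = 1]. *)
Lemma projective_bil w t y : nc w -> t \in L -> moved w t -> - (w^T *m t) \in L ->
  y \in L -> moved w y -> 0 <= bil t y.
Proof.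
move=> ncw tL wt t'L yL wy; set t' := - _ in t'L.
have tyE : bil t y = bil y t'.
  by rewrite /t' bilNr -(nc_serre_tr W_orth b_def).
have [ty|yt] := leqP (index t L) (index y L).
  move: ty; rewrite leq_eqVlt => /orP[/eqP ty|/pos_index[]//].
  rewrite -(nth_index 0 yL) -ty nth_index // (root_bil b_def (pos_root tL)).
  exact: ler01.
have [t'y|yt'] := ltnP (index t' L) (index y L).
  have [_] := pos_index t'L tL (ltn_trans t'y yt).
  have wt' : moved w t' by apply: movedN; apply: (moved_tr W_orth) wt; exact: nc_group ncw.
  have -> : bil t t' = bil t' t'.
    by rewrite (nc_serre_tr W_orth b_def ncw wt wt') -bilNr.
  by rewrite (root_bil b_def (pos_root t'L)); lra.
move: yt'; rewrite tyE leq_eqVlt => /orP[/eqP ty|/pos_index[]//].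
rewrite -(nth_index 0 yL) ty nth_index // (root_bil b_def (pos_root t'L)).
exact: ler01.
Qed.

(** Otherwise [w^-1 t] is a positive root of [M(w)], and [b (t, w^-1 t) = - 1] by Serre duality. *)
Lemma bil_projective w t : nc w -> t \in L -> moved w t ->
  (forall y, y \in L -> moved w y -> 0 <= bil t y) -> - (w^T *m t) \in L.
Proof.
move=> ncw tL wt t_ge0; have wW := nc_group ncw.
have t'r : unit_root (w^T *m t) by apply: root_image (pos_root tL); exact: group_tr.
apply: negP_pos => //; apply/negP => t'L.
have wt' : moved w (w^T *m t) by exact: (moved_tr W_orth).
have := t_ge0 _ t'L wt'.
rewrite (nc_serre_tr W_orth b_def ncw) // (root_bil b_def (pos_root t'L)).
by lra.
Qed.

End OrderedPositive.

(** * An exceptional sequence cut at one vertex *)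

Section Split.
Context F1 t F2 (ex : exceptional (F1 ++ t :: F2)).
Context (rt : forall x, x \in F1 ++ t :: F2 -> unit_root x).

Local Notation w1 := (refl_prod (rev F1)).
Local Notation w := (refl_prod (rev (rcons F1 t))).
(** [u = w1^-1 t = - w^-1 t] is the root whose sign decides whether a positive [t] is forward, that
    is, projective for the partial product [w]. *)
Local Notation u := (refl_prod F1 *m t).

Let ex1 : exceptional F1 /\ forall x, x \in F1 -> bil t x = 0.
Proof.
move: ex; rewrite /exceptional pairwise_cat => /and3P[/allrelP al -> _]; split=> // x xF1.
by apply/eqP/al => //; exact: mem_head.
Qed.

Let rt1 x : x \in F1 -> unit_root x.
Proof. by move=> xF1; apply: rt; rewrite mem_cat xF1. Qed.

Lemma split_root : unit_root t.
Proof. by apply: rt; rewrite mem_cat mem_head orbT. Qed.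

Lemma split_nc1 : nc w1.
Proof. by have [ex1' _] := ex1; have [] := exceptional_nc W_orth b_def rt1 ex1'. Qed.

Lemma split_moved1 x : x \in F1 -> moved w1 x.
Proof. by have [ex1' _] := ex1; have [_] := exceptional_nc W_orth b_def rt1 ex1'; apply. Qed.

Lemma split_orth y : moved w1 y -> bil t y = 0.
Proof. by apply: bil_moved_r => x; rewrite mem_rev; exact: (proj2 ex1). Qed.

Lemma split_prodE : w = reflmx t *m w1.
Proof. by rewrite rev_rcons refl_prod_cons. Qed.

Lemma split_nc : nc w.
Proof. by rewrite split_prodE; apply: (nc_add_left W_orth b_def split_nc1 split_root split_orth). Qed.

Lemma split_moved : moved w t.
Proof. by rewrite split_prodE; apply: (add_left_moved_root W_orth b_def split_nc1 split_root split_orth). Qed.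

Lemma split_mul1 : w1 *m u = t.
Proof. by rewrite -[refl_prod F1]trmxK tr_refl_prod (group_Ktr W_orth) //; exact: nc_group split_nc1. Qed.

Lemma split_mul : w *m u = - t.
Proof. by rewrite split_prodE -mulmxA split_mul1; exact: root_self split_root. Qed.

Lemma split_tr : w^T *m t = - u.
Proof.
apply: oppr_inj; rewrite opprK -mulmxN -split_mul (group_trK W_orth) //.
exact: nc_group split_nc.
Qed.

Lemma split_moved_u : moved w u.
Proof.
rewrite -[u]opprK -split_tr; apply: movedN.
by apply: (moved_tr W_orth) split_moved; exact: nc_group split_nc.
Qed.

Lemma split_root_u : unit_root u.
Proof. by apply: root_image split_root; apply: (refl_prod_group W_orth) => x /rt1. Qed.

Lemma split_moved1_sub : moved w1 (u - t).
Proof. by exists u; rewrite split_mul1. Qed.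

End Split.

Lemma exceptional_subseq F F' : subseq F F' -> exceptional F' -> exceptional F.
Proof. exact: subseq_pairwise. Qed.

Lemma moved_subset ts us : {subset ts <= us} ->
  (forall x, x \in us -> moved (refl_prod (rev us)) x) ->
  forall y, moved (refl_prod (rev ts)) y -> moved (refl_prod (rev us)) y.
Proof.
move=> sub mus; apply: moved_refl_prod_ind; [exact: moved0|exact: movedD|exact: movedZ|].
by move=> x; rewrite mem_rev => /sub/mus.
Qed.

(** * Forward vertices as projective roots *)

Section ForwardProjective.
Context L (pL : ordered_positive L).

(** Induction on the last vertex [t]. If [t] is forward, it is projective for the full product, so
    it pairs nonnegatively with the positive roots of the smaller moved space of the forward product
    and is projective there too. For an earlier forward [a], the new image is the old one plus
    [b (a, t)] times that of [t]; here [b (a, t) >= 0] because [a] precedes [t], and [pos_convex]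
    applies. *)
Lemma forward_projective F a : subseq F (window L) -> exceptional F ->
  a \in forward_roots L 1%:M F ->
  - ((forward_prod L F)^T *m a) \in L.
Proof.
elim/last_ind: F a => [|F t IH] a //= sFt eFt.
have Ftr x : x \in rcons F t -> unit_root x.
  by move=> /(mem_subseq sFt); exact: window_root.
have sF : subseq F (window L) := subseq_trans (subseq_rcons F t) sFt.
have eF : exceptional F by move: eFt; rewrite exceptional_rcons => /andP[].
have {}IH := IH _ sF eF.
rewrite /forward_prod -(cats1 F t) forward_roots_cat /= mul1mx.
case: ifP => [/andP[tL uL]|_]; last by rewrite cats0; exact: IH.
rewrite cats1; set A := forward_roots L 1%:M F in IH *.
have sA : subseq (rcons A t) (rcons F t).
  by rewrite -!cats1 cat_subseq // forward_roots_subseq.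
have eA := exceptional_subseq sA eFt.
have Ar x : x \in rcons A t -> unit_root x by move=> /(mem_subseq sA)/Ftr.
have [ncF mF] := exceptional_nc W_orth b_def Ftr eFt.
have [ncA mA] := exceptional_nc W_orth b_def Ar eA.
have trF : (refl_prod (rev (rcons F t)))^T *m t = - (refl_prod F *m t).
  have := @split_tr F t [::]; rewrite cats1; exact.
have uA : - ((refl_prod (rev (rcons A t)))^T *m t) \in L.
  apply: (bil_projective pL ncA tL) => [|y yL my]; first by apply: mA; rewrite mem_rcons mem_head.
  apply: (projective_bil pL ncF tL) => //.
  - by apply: mF; rewrite mem_rcons mem_head.
  - by rewrite trF opprK.
  - by apply: moved_subset my => //; exact: mem_subseq.
rewrite mem_rcons in_cons => /predU1P[->//|aA].
have aL : a \in L.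
  move: aA; rewrite /A; elim: (F) (1%:M) => //= x F' IHF g.
  by case: ifP => [/andP[xL _]|_ /IHF//]; rewrite in_cons => /predU1P[->|/IHF].
have aF : a \in F by exact: (mem_subseq (forward_roots_subseq _ _ _) aA).
have [_ at_lt] : a \in L /\ (index a L < index t L)%N.
  move: sFt; rewrite -cats1 => sFt.
  exact: subseq_index_cat (window_uniq pL) sFt tL aF.
have [at_ge0 _] := pos_index pL aL tL at_lt.
have ta : bil t a = 0.
  by move: eFt; rewrite exceptional_rcons => /andP[_ /allP/(_ a aF)/eqP].
have tr : unit_root t by apply: Ftr; rewrite mem_rcons mem_head.
have E : - ((refl_prod (rev (rcons A t)))^T *m a) =
    - ((refl_prod (rev A))^T *m a) +
    bil a t *: - ((refl_prod (rev (rcons A t)))^T *m t).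
  rewrite rev_rcons refl_prod_cons trmx_mul tr_reflmx -!mulmxA (root_self tr).
  rewrite (reflmx_root _ tr) -(bil_sym b_def) ta add0r.
  by rewrite mulmxN opprK mulmxBr -scalemxAr opprB addrC.
rewrite E; apply: (pos_convex pL) => //; first exact: IH.
rewrite -E; apply: root_opp; apply: root_image; last exact: (pos_root pL).
exact: (group_tr W_orth (nc_group ncA)).
Qed.

Lemma mem_forward_roots F g x : x \in forward_roots L g F -> x \in F /\ x \in L.
Proof.
elim: F g => //= t F IH g; case: ifP => [/andP[tL _]|_].
  by rewrite !in_cons => /predU1P[->|/IH[->]]; rewrite ?eqxx ?orbT.
by rewrite in_cons => /IH[-> ->]; rewrite orbT.
Qed.

Lemma forward_nc C F : cluster L C F -> nc (forward_prod L F) /\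
  (forall x, x \in forward_roots L 1%:M F -> moved (forward_prod L F) x).
Proof.
move=> [sF eF _ _]; have sA := forward_roots_subseq L 1%:M F.
apply: exceptional_nc (exceptional_subseq sA eF) => // x /(mem_subseq sA).
by move=> /(mem_subseq sF); exact: window_root.
Qed.

End ForwardProjective.

(** * One step of rotation *)

Section Head.
Context r M (pL : ordered_positive (r :: M)).

Local Notation L := (r :: M).
Local Notation L' := (rcons M (- r)).

Let rL : r \in L. Proof. exact: mem_head. Qed.
Let rr : unit_root r. Proof. exact: (pos_root pL). Qed.
Let r1 : bil r r = 1. Proof. exact: (root_bil b_def rr). Qed.

Lemma head_bil y : y \in L -> y != r -> 0 <= bil r y /\ bil y r <= 0.
Proof.
move=> yL yr; apply: (pos_index pL) => //.
by rewrite /= eqxx eq_sym (negPf yr).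
Qed.

Lemma head_bil_ge0 y : y \in L -> 0 <= bil r y.
Proof. by move=> yL; have [->|/(head_bil yL)[]//] := eqVneq y r; rewrite r1 ler01. Qed.

Lemma mem_rotate t : t != r -> t != - r -> (t \in L') = (t \in L).
Proof. by move=> tr tNr; rewrite mem_rcons !in_cons (negPf tr) (negPf tNr). Qed.

Lemma head_notin_rotate : r \notin L'.
Proof.
have /= /andP[rM _] := pos_uniq pL.
rewrite mem_rcons in_cons negb_or rM andbT eq_sym.
by apply/eqP; exact: (root_neqN rr).
Qed.

Lemma head_opp_in_rotate : - r \in L'.
Proof. by rewrite mem_rcons mem_head. Qed.

Lemma rotate_positive : ordered_positive L'.
Proof.
have /= /andP[rM uM] := pos_uniq pL; have rNL := pos_opp pL rL.
have rNM : - r \notin M by move: rNL; rewrite in_cons negb_or => /andP[].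
split.
- by rewrite rcons_uniq rNM.
- move=> t; rewrite mem_rcons in_cons => /predU1P[->|tM]; first exact: root_opp.
  by apply: (pos_root pL); rewrite in_cons tM orbT.
- move=> t tr; have [->|t_r] := eqVneq t r; first by rewrite head_opp_in_rotate orbT.
  have [->|tNr] := eqVneq t (- r); first by rewrite head_opp_in_rotate.
  rewrite !mem_rotate // ?(pos_cover pL) //; first by rewrite eqr_oppLR.
  by rewrite eqr_opp.
- move=> t; rewrite mem_rcons in_cons => /predU1P[->|tM].
    by rewrite opprK; exact: head_notin_rotate.
  have tL : t \in L by rewrite in_cons tM orbT.
  rewrite mem_rcons in_cons negb_or eqr_opp; have := pos_opp pL tL.
  rewrite in_cons negb_or => /andP[_ ->]; rewrite andbT.
  by apply: contraNneq rM => <-.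
- rewrite -cats1 pairwise_cat andbT /= allrel1r.
  case: pL => _ _ _ _ /= /andP[rp ->]; rewrite andbT.
  by apply: sub_all rp => x /andP[]; rewrite bilNr bilNl oppr_ge0 oppr_le0 => -> ->.
Qed.

Let pL' := rotate_positive.

Lemma head_projective w : nc w -> moved w r -> - (w^T *m r) \in L.
Proof.
move=> ncw wr; apply: (bil_projective pL) => // y yL _; exact: head_bil_ge0.
Qed.

(** Serre duality gives [b (- w r, r) = 1], so [- w r] is neither [- r] nor one of the roots [y]
    after [r], for which [b (y, r) <= 0]. *)
Lemma mul_head_in_rotate w : nc w -> moved w r -> w *m r \in L'.
Proof.
move=> ncw wr; have wW := nc_group ncw; have r'r := root_image wW rr.
apply/negPn/negP => /(negP_pos pL' r'r) wrL'.
have := nc_serre b_def ncw wr wr; rewrite r1 => wrr.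
have [wrE|wr_r] := eqVneq (- (w *m r)) (- r).
  by move: wrr; rewrite (oppr_inj wrE) r1; lra.
move: (wrL'); rewrite mem_rcons in_cons (negPf wr_r) /= => wrM.
have wrL : - (w *m r) \in L by rewrite in_cons wrM orbT.
have [|_] := head_bil wrL.
  by apply: contraNneq head_notin_rotate => E; rewrite -{1}E.
by rewrite bilNl wrr; lra.
Qed.

Lemma reflmx_orth_head y : bil y r = 0 -> reflmx r *m y = y - bil r y *: r.
Proof.
move=> yr; rewrite (reflmx_root _ rr) -(bil_sym b_def) yr addr0; congr (_ - _ *: _).
Qed.

(** On the left orthogonal of [r] the reflection is [y - b (r, y) r]. If its opposite [z] were
    positive, then [b (z, r) = b (r, y) >= 0]; as [r] comes first, either [z = r], which forces
    [y = 0], or [b (r, y) = 0], which makes [z = - y]. *)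
Let reflmx_head_pos y : bil y r = 0 -> y \in L -> reflmx r *m y \in L.
Proof.
move=> yr yL; have yroot := pos_root pL yL.
have y_r : y != r by apply: contra_eq_neq yr => ->; rewrite r1 oner_neq0.
apply/negPn/negP => /(negP_pos pL (root_image (root_group rr) yroot)).
rewrite reflmx_orth_head // opprB; set z := _ - _ => zL.
have zr : bil z r = bil r y by rewrite /z bilDl bilZl bilNl r1 yr; lra.
have [zE|z_r] := eqVneq z r.
  move: zr; rewrite zE r1 => yr1; move: zE.
  rewrite /z -yr1 scale1r => /eqP; rewrite -subr_eq0 addrAC subrr sub0r oppr_eq0.
  by rewrite (negPf (root_neq0 yroot)).
have [_] := head_bil zL z_r; rewrite zr => yr_le0.
have yr0 : bil r y = 0 by apply/eqP; rewrite eq_le yr_le0 head_bil_ge0.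
by have := pos_opp pL yL; rewrite -sub0r -(scale0r r) -yr0 zL.
Qed.

Lemma mem_reflmx_head y : unit_root y -> bil y r = 0 ->
  (reflmx r *m y \in L) = (y \in L).
Proof.
move=> yroot yr; apply/idP/idP => [|]; last exact: reflmx_head_pos.
move=> ryL; apply/negPn/negP => /(negP_pos pL yroot) yNL.
have /(pos_opp pL) : reflmx r *m (- y) \in L.
  by apply: reflmx_head_pos => //; rewrite bilNl yr oppr0.
by rewrite mulmxN opprK ryL.
Qed.


Let wL : seq 'cV[R]_n := M ++ - r :: map -%R M.

Lemma window_head : window L = r :: wL. Proof. by []. Qed.

Lemma window_rotate : window L' = rcons wL r.
Proof. by rewrite /window map_rcons opprK -rcons_cat cat_rcons. Qed.

Let subseq_head F : r \notin F -> subseq F (window L) = subseq F wL.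
Proof. by case: F => [|x F]; rewrite ?sub0seq //= in_cons negb_or => /andP[/negPf rx _]; rewrite eq_sym rx. Qed.

Let subseq_rotate F : r \notin F -> subseq F (window L') = subseq F wL.
Proof.
move=> rF; rewrite window_rotate -subseq_rev rev_rcons -[RHS]subseq_rev.
move: rF; rewrite -mem_rev; case: (rev F) => [|x F']; rewrite ?sub0seq //=.
by rewrite in_cons negb_or => /andP[/negPf rx _]; rewrite eq_sym rx.
Qed.

Lemma cluster_root L0 C F t : ordered_positive L0 -> cluster L0 C F -> t \in F -> unit_root t.
Proof. by move=> pL0 [/mem_subseq sF _ _ _] /sF; exact: window_root. Qed.

Lemma cluster_moved L0 C F t : ordered_positive L0 -> cluster L0 C F -> t \in F -> moved C t.
Proof.
move=> pL0 clF; have Fr := cluster_root pL0 clF; case: clF => _ ex -> _.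
by have [_] := exceptional_nc W_orth b_def Fr ex; apply.
Qed.

Lemma clusterE L0 C F : ordered_positive L0 ->
  cluster L0 C F <-> simplex L0 C F /\ C = refl_prod (rev F).
Proof.
move=> pL0; split=> [clF|[[sF eF _ cF] CE]]; last by [].
by have Fm := cluster_moved pL0 clF; case: clF.
Qed.

Lemma simplex_rotate_fixed C F : nc C -> ~ moved C r -> simplex L C F <-> simplex L' C F.
Proof.
move=> ncC Cr.
have CNr : ~ moved C (- r) by move=> /movedN; rewrite opprK.
have off t : moved C t -> (t \in L') = (t \in L).
  move=> Ct; apply: mem_rotate; apply: contra_not_neq Cr => tE; first by rewrite -tE.
  by rewrite -[r]opprK -tE; exact: movedN.
have offC t : moved C t -> (C^T *m t \in L') = (C^T *m t \in L).
  by move=> Ct; apply/off/(moved_tr W_orth) => //; exact: nc_group ncC.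
split=> -[sF eF Fm cF].
  have rF : r \notin F by apply/negP => /Fm.
  split=> // [|t tF]; first by rewrite subseq_rotate // -subseq_head.
  by rewrite off ?offC ?cF //; exact: Fm.
have rF : r \notin F by apply/negP => /Fm.
split=> // [|t tF]; first by rewrite subseq_head // -subseq_rotate.
by rewrite -off -?offC ?cF //; exact: Fm.
Qed.

Lemma cluster_rotate_fixed C F : nc C -> ~ moved C r -> cluster L C F <-> cluster L' C F.
Proof.
move=> ncC Cr; have E := simplex_rotate_fixed F ncC Cr.
split=> clF.
  have [sF CE] := (proj1 (clusterE C F pL)) clF.
  by apply/(clusterE C F pL'); split=> //; apply/E.
have [sF CE] := (proj1 (clusterE C F pL')) clF.
by apply/(clusterE C F pL); split=> //; apply/E.
Qed.

Lemma simplex_rotate C F : nc C -> moved C r ->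
  simplex L C F /\ r \notin F <-> simplex L' C F /\ - (C *m r) \notin F.
Proof.
move=> ncC Cr; have CW := nc_group ncC.
have CrL' := mul_head_in_rotate ncC Cr; have CtrL := head_projective ncC Cr.
have rL' := head_notin_rotate; have NrL := pos_opp pL rL.
split=> -[[sF eF CE cF] nF].
  have CrF : - (C *m r) \notin F.
    apply/negP => CrF; move: (cF _ CrF); rewrite mulmxN (group_trK W_orth) // (negPf NrL) orbF.
    move=> CrL; have := pos_opp pL' CrL'; rewrite mem_rotate ?CrL //.
      by apply: contraNneq nF => <-.
    by apply: contraNneq NrL => <-.
  split=> //; split=> // [|t tF]; first by rewrite subseq_rotate // -subseq_head.
  have [->|tNr] := eqVneq t (- r); first by rewrite head_opp_in_rotate.
  have t_r : t != r by apply: contraNneq nF => <-.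
  have := cF t tF; rewrite mem_rotate //; case: (boolP (t \in L)) => //= tL yL.
  rewrite mem_rotate //; last by apply: contraTneq yL => ->.
  apply: contraNneq tL => yE; rewrite -(mem_rotate t_r tNr).
  by rewrite -(group_Ktr W_orth t CW) yE.
have rF : r \notin F.
  apply/negP => rF; have := cF r rF; rewrite (negPf rL') /= => yL'.
  have y_r : C^T *m r != r by apply: contraTneq yL' => ->.
  have y_Nr : C^T *m r != - r.
    apply: contraNneq nF => yE; rewrite -mulmxN -yE (group_Ktr W_orth) //.
  by have := pos_opp pL CtrL; rewrite opprK -mem_rotate ?yL'.
split=> //; split=> // [|t tF]; first by rewrite subseq_head // -subseq_rotate.
have [->|tNr] := eqVneq t (- r); first by rewrite mulmxN CtrL orbT.
have t_r : t != r by apply: contraNneq rF => <-.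
have := cF t tF; rewrite mem_rotate //; case: (boolP (t \in L)) => //= tL yL.
rewrite -mem_rotate //; first by apply: contraTneq yL => ->.
apply: contraNneq nF => yE.
by rewrite -mulmxN -yE (group_Ktr W_orth).
Qed.

Lemma cluster_rotate C F : nc C -> moved C r ->
  cluster L C F /\ r \notin F <-> cluster L' C F /\ - (C *m r) \notin F.
Proof.
move=> ncC Cr; have E := simplex_rotate F ncC Cr.
split=> -[clF nF].
  have [sF CE] := (proj1 (clusterE C F pL)) clF.
  have [sF' nF'] := (proj1 E) (conj sF nF).
  by split=> //; apply/(clusterE C F pL').
have [sF CE] := (proj1 (clusterE C F pL')) clF.
have [sF' nF'] := (proj2 E) (conj sF nF).
by split=> //; apply/(clusterE C F pL).
Qed.

Lemma mem_tr_mul_reflmx C t : nc C -> moved C r -> unit_root t ->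
  moved (C *m reflmx r) t -> ((C *m reflmx r)^T *m t \in L) = (C^T *m t \in L).
Proof.
move=> ncC Cr tr mt; have nc1 := nc_mul_reflmx W_orth b_def ncC rr Cr.
have C1W := nc_group nc1; set z := _ *m t.
have /(moved_mul_reflmx b_def ncC rr Cr)[_ zr] : moved (C *m reflmx r) z.
  exact: (moved_tr W_orth).
rewrite -mem_reflmx_head //; last exact: root_image (group_tr W_orth C1W) tr.
by rewrite /z trmx_mul tr_reflmx -mulmxA (rootK _ rr).
Qed.

(** The other vertices are left orthogonal to [r], hence lie in [M(C R(r))]; there [R(r)] preserves
    positivity, so the condition on negative vertices is unaffected. *)
Lemma head_cluster C F : nc C -> moved C r ->
  cluster L C (r :: F) <-> cluster L (C *m reflmx r) F.
Proof.
move=> ncC Cr; have nc1 := nc_mul_reflmx W_orth b_def ncC rr Cr.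
have Er := moved_mul_reflmx b_def ncC rr Cr.
split=> clF.
  have Fr := cluster_root pL clF.
  case: clF => sF; rewrite /exceptional /= => /andP[/allP tr eF] CE cF.
  have C1E : C *m reflmx r = refl_prod (rev F).
    by rewrite CE rev_cons refl_prod_rcons -mulmxA (rootKmx rr) mulmx1.
  have Fr' t : t \in F -> unit_root t by move=> tF; apply: Fr; rewrite in_cons tF orbT.
  have [_ Fm] := exceptional_nc W_orth b_def Fr' eF; rewrite -C1E in Fm.
  split=> // [|t tF]; first exact: subseq_trans (subseq_cons _ _) sF.
  rewrite mem_tr_mul_reflmx //; [|exact: Fr'|exact: Fm].
  by apply: cF; rewrite in_cons tF orbT.
have Fr := cluster_root pL clF; have Fm := cluster_moved pL clF.
case: clF => sF eF CE cF.
have tr t : t \in F -> bil t r = 0 by move=> /Fm/Er[].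
have rF : r \notin F by apply/negP => /tr/eqP; rewrite r1 oner_eq0.
split=> /=.
- by rewrite eqxx -subseq_head.
- by rewrite /exceptional /= -/(exceptional F) eF andbT; apply/allP => t /tr/eqP.
- by rewrite rev_cons refl_prod_rcons -CE -mulmxA (rootKmx rr) mulmx1.
- move=> t; rewrite in_cons => /predU1P[->|tF]; first by rewrite rL.
  by rewrite -mem_tr_mul_reflmx; [exact: cF| | |exact: Fr|exact: Fm].
Qed.

Lemma split_orth_head F F1 t F2 : (forall x, x \in F -> unit_root x) ->
  exceptional F -> (forall x, x \in F -> bil x r = 0) -> F = F1 ++ t :: F2 ->
  bil (refl_prod F1 *m t) r = 0.
Proof.
move=> Fr eF Fx FE; rewrite FE in eF Fr.
apply: bil_moved_l (split_moved_u eF Fr) => x.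
rewrite mem_rev mem_rcons => xF; apply: Fx; rewrite FE mem_cat in_cons.
by move: xF; rewrite in_cons => /orP[->|->]; rewrite ?orbT.
Qed.

(** [r] is forward, being first, and the deciding root of each later vertex is only reflected in
    [r], which does not change its sign. *)
Lemma forward_roots_head C F : nc C -> moved C r -> cluster L (C *m reflmx r) F ->
  forward_roots L 1%:M (r :: F) = r :: forward_roots L 1%:M F.
Proof.
move=> ncC Cr clF; rewrite [LHS]/= !mul1mx rL /=; congr (_ :: _).
have Fr := cluster_root pL clF; have Fm := cluster_moved pL clF.
case: clF => sF eF CE cF.
have Fx x : x \in F -> bil x r = 0 by move=> /Fm/(moved_mul_reflmx b_def ncC rr Cr)[].
apply: forward_roots_congr => F1 t F2 FE; rewrite mul1mx -mulmxA; congr (_ && _).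
rewrite mem_reflmx_head //; last exact: split_orth_head FE.
by rewrite FE in Fr; exact: split_root_u Fr.
Qed.

(** Only [r] and [- r] change sign. If [u = - r], then [t = w r] is positive for [L'] and becomes
    forward. If [u = r], then [t = - w r] is negative, and if [t = - r], then [- u = - w^-1 r] is
    positive; in neither case is [t] forward for either list. *)
Lemma forward_rotate F1 t F2 : exceptional (F1 ++ t :: F2) ->
  (forall x, x \in F1 ++ t :: F2 -> unit_root x) -> t != r ->
  (t \in L') && (refl_prod F1 *m t \in L') =
  (t \in L) && (refl_prod F1 *m t \in L) || (refl_prod F1 *m t == - r).
Proof.
move=> ex rt t_r; have ncw := split_nc ex rt; have wu := split_mul ex rt.
have mu := split_moved_u ex rt; have mt := split_moved ex rt; have wt := split_tr ex rt.
set u := _ *m t in wu mu wt *; set w := refl_prod _ in ncw wu mu mt wt.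
have [uE|uNr] := eqVneq u (- r).
  rewrite orbT uE head_opp_in_rotate andbT -[t]opprK -wu uE mulmxN opprK.
  by apply: mul_head_in_rotate => //; rewrite -[r]opprK -uE; exact: movedN.
rewrite orbF; have [uE|u_r] := eqVneq u r.
  have tL' : t \notin L'.
    rewrite -[t]opprK -wu uE; apply: (pos_opp pL').
    by apply: mul_head_in_rotate => //; rewrite -uE.
  rewrite (negPf tL') /=; apply/esym/negbTE; rewrite negb_and.
  apply/orP; left; apply: contraNN tL' => tL; rewrite mem_rotate //.
  by apply: contraTneq tL => ->; exact: (pos_opp pL).
rewrite (mem_rotate u_r uNr); have [tE|tNr] := eqVneq t (- r); last by rewrite mem_rotate.
rewrite tE head_opp_in_rotate (negPf (pos_opp pL rL)) /=.
apply/negbTE; rewrite -[u]opprK; apply: (pos_opp pL).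
rewrite -wt tE mulmxN; apply: head_projective => //.
by rewrite -[r]opprK -tE; exact: movedN.
Qed.

Section Orthogonal.
Context F (eF : exceptional F) (rF : forall x, x \in F -> unit_root x).
Context (Fr : forall x, x \in F -> bil x r = 0).

Local Notation w := (refl_prod (rev F)).

Let ncw : nc w. Proof. by have [] := exceptional_nc W_orth b_def rF eF. Qed.

Let moved_r y : moved w y -> bil y r = 0.
Proof. by apply: bil_moved_l => x; rewrite mem_rev; exact: Fr. Qed.

Lemma opp_mul_head_in_rotate : - (w *m r) \in L'.
Proof.
have := mul_head_in_rotate (nc_add_right W_orth b_def ncw rr moved_r)
  (add_right_moved_root W_orth b_def ncw rr moved_r).
by rewrite -mulmxA (root_self rr) mulmxN.
Qed.

Lemma mul_head_bil : bil (w *m r) r = 1.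
Proof.
have := moved_r (moved_sub w r); rewrite bilDl bilNl r1 => /eqP.
by rewrite subr_eq0 => /eqP.
Qed.

Lemma bil_mul_head y : (forall x, x \in F -> bil y x = 0) -> bil y (w *m r) = bil y r.
Proof.
move=> yF; have : bil y (r - w *m r) = 0.
  by apply: (@bil_moved_r _ _ _ (rev F)); [move=> x; rewrite mem_rev; exact: yF | exact: moved_sub].
by rewrite bilDr bilNr => /eqP; rewrite subr_eq0 => /eqP.
Qed.

End Orthogonal.

(** Omitting a vertex [t] that is not forward does not change the image of [r]. With [q0 = - w r]
    for [w] the product before [t], [b (q0, t) <= 0] because [t] precedes [q1 = q0 - b (q0, t) t],
    and [b (q0, t) = b (r, - u) >= 0] because the deciding root [u] is negative. So [R(t)] fixes
    [q0]. *)
Lemma forward_roots_mul_head F : exceptional F -> (forall x, x \in F -> unit_root x) ->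
  (forall x, x \in F -> bil x r = 0) -> {subset F <= L'} ->
  pairwise (fun x y => index x L' < index y L')%N F ->
  (forall x, x \in F -> index x L' < index (- (refl_prod (rev F) *m r)) L')%N ->
  refl_prod (rev (forward_roots L 1%:M F)) *m r = refl_prod (rev F) *m r.
Proof.
elim/last_ind: F => [//|F t IH] eFt rFt Ft_r FtL' pFt q1_gt.
have inF x : x \in F -> x \in rcons F t by rewrite mem_rcons in_cons orbC => ->.
have int : t \in rcons F t by rewrite mem_rcons mem_head.
have eF : exceptional F by move: eFt; rewrite exceptional_rcons => /andP[].
have tF x : x \in F -> bil t x = 0.
  by move: eFt; rewrite exceptional_rcons => /andP[_ /allP H] /H/eqP.
have rF x : x \in F -> unit_root x by move=> /inF/rFt.
have Fr x : x \in F -> bil x r = 0 by move=> /inF/Ft_r.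
have FL' : {subset F <= L'} by move=> x /inF/FtL'.
have tr := rFt t int; have tr0 := Ft_r t int; have tL' := FtL' t int.
have t_r : t != r by apply: contra_eq_neq tr0 => ->; rewrite r1 oner_neq0.
have t_Nr : t != - r by apply: contra_eq_neq tr0 => ->; rewrite bilNl r1 oppr_eq0 oner_neq0.
have pF : pairwise (fun x y => index x L' < index y L')%N F.
  by move: pFt; rewrite pairwise_rcons => /andP[].
have Ft_lt x : x \in F -> (index x L' < index t L')%N.
  by move: pFt; rewrite pairwise_rcons => /andP[/allP H _] /H.
set w := refl_prod (rev F); set q0 := - (w *m r).
have q0L' : q0 \in L' by apply: opp_mul_head_in_rotate.
have q0r : bil q0 r = - 1 by rewrite bilNl mul_head_bil.
have tq0 : bil t q0 = 0 by rewrite bilNr bil_mul_head // tr0 oppr0.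
have q0_t : q0 != t.
  by apply/eqP => q0t; move: q0r; rewrite q0t tr0; lra.
have wE : refl_prod (rev (rcons F t)) = reflmx t *m w by rewrite rev_rcons refl_prod_cons.
have q1E : - (refl_prod (rev (rcons F t)) *m r) = q0 - bil q0 t *: t.
  rewrite wE -mulmxA -mulmxN -/q0 (reflmx_root _ tr) dotC -(bil_sym b_def).
  by rewrite tq0 addr0.
have t_q1 := q1_gt t int; have q1L' := opp_mul_head_in_rotate eFt rFt Ft_r.
rewrite q1E in t_q1 q1L'.
have tq1 : 0 <= bil t (q0 - bil q0 t *: t) by have [] := pos_index pL' tL' q1L' t_q1.
rewrite bilDr tq0 add0r bilNr bilZr (root_bil b_def tr) mulr1 oppr_ge0 in tq1.
(* For the induction hypothesis: if [q0] preceded [t], then [b (q0, t) >= 0], hence [q1 = q0],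
   although [q1] comes after [t]. *)
have t_q0 : (index t L' < index q0 L')%N.
  rewrite ltnNge; apply/negP; rewrite leq_eqVlt => /orP[/eqP qt|q_t].
    by move: q0_t; rewrite -(nth_index 0 q0L') qt nth_index ?eqxx.
  have [q0t _] := pos_index pL' q0L' tL' q_t.
  have E : bil q0 t = 0 by apply/eqP; rewrite eq_le tq1 q0t.
  by move: t_q1; rewrite E scale0r subr0 ltnNge (ltnW q_t).
have {}IH : refl_prod (rev (forward_roots L 1%:M F)) *m r = w *m r.
  by apply: IH => // x /Ft_lt xt; exact: ltn_trans t_q0.
rewrite -{1}(cats1 F t) forward_roots_cat /= mul1mx rev_cat refl_prod_cat.
have exu := split_root_u (F1 := F) (t := t) (F2 := [::]); rewrite cats1 in exu.
have ur := exu rFt; set u := _ *m t in ur *.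
have tL : t \in L by rewrite -mem_rotate.
rewrite tL /=; case: ifP => uL /=.
  by rewrite refl_prod1 -mulmxA IH wE -mulmxA.
rewrite refl_prod_nil mul1mx IH.
have uNL : - u \in L by apply: (negP_pos pL) ur _; rewrite uL.
have uE : bil u r = 0 by apply: split_orth_head (_ : rcons F t = F ++ t :: [::]) => //; rewrite cats1.
suff E : bil q0 t = 0.
  by apply: oppr_inj; rewrite q1E E scale0r subr0.
apply/eqP; rewrite eq_le tq1 /=.
have := bil_sym b_def q0 t; rewrite tq0 addr0 => ->.
have := head_bil_ge0 uNL; rewrite bilNr; have := bil_sym b_def r u; rewrite uE addr0 => ->.
have -> : dot q0 t = - dot r u.
  rewrite /q0 dotNl dot_adj /u tr_refl_prod revK //.
by lra.
Qed.

(* The forward status of a vertex changes under rotation only if its image [g t] is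
   [- r]; then all the other forward vertices are orthogonal to [r]. *)
Section Switch.
Context F1 t F2 (ex : exceptional (F1 ++ t :: F2)).
Context (rt : forall x, x \in F1 ++ t :: F2 -> unit_root x).
Context (rF : r \notin F1 ++ t :: F2) (tE : refl_prod F1 *m t = - r).

Local Notation F := (F1 ++ t :: F2).
Local Notation w1 := (refl_prod (rev F1)).

Let t_head : t = - (w1 *m r).
Proof. by rewrite -mulmxN -tE (split_mul1 ex rt). Qed.

Let t_r : t != r.
Proof. by apply: contraNneq rF => <-; rewrite mem_cat mem_head orbT. Qed.

Lemma switch_moved : moved (refl_prod (rev (rcons F1 t))) r.
Proof. by rewrite -[r]opprK -tE; apply/movedN/(split_moved_u ex rt). Qed.

Lemma switch_in_rotate : t \in L'.
Proof.
rewrite -[t]opprK -(split_mul ex rt) tE mulmxN opprK.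
exact: mul_head_in_rotate (split_nc ex rt) switch_moved.
Qed.

Let orth1 x : x \in F1 -> bil x r = 0.
Proof.
move=> xF1; have mx := split_moved1 ex rt xF1.
have [_ /(_ r x mx)] := split_nc1 ex rt; rewrite -(bil_sym b_def) bilDl.
by rewrite -t_head (split_orth ex mx) addr0 => /eqP; rewrite -subr_eq0 opprD addrA subrr sub0r oppr_eq0 => /eqP.
Qed.

Let orth2 x : x \in F2 -> bil x r = 0.
Proof.
move=> xF2; apply: bil_moved_r switch_moved => y.
rewrite mem_rev mem_rcons in_cons => yF; apply/eqP.
move: ex; rewrite /exceptional pairwise_cat => /and3P[/allrelP H _ /= /andP[/allP H' _]].
by case/predU1P: yF => [->|yF1]; [exact: H' | apply: H; rewrite // in_cons xF2 orbT].
Qed.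

Lemma switch_forward_roots : forward_roots L 1%:M F =
  forward_roots L 1%:M F1 ++ forward_roots L (refl_prod F1 *m reflmx t) F2.
Proof.
rewrite forward_roots_cat mul1mx /= tE (negPf (pos_opp pL rL)) andbF.
by [].
Qed.

Lemma switch_orth x : x \in forward_roots L 1%:M F -> bil x r = 0.
Proof.
rewrite switch_forward_roots mem_cat.
by case/orP=> /(mem_subseq (forward_roots_subseq _ _ _)); [exact: orth1 | exact: orth2].
Qed.

Let forward1 : forward_roots L' 1%:M F1 = forward_roots L 1%:M F1.
Proof.
have ex1 : exceptional F1 by move: ex; rewrite /exceptional pairwise_cat => /and3P[].
have rt1 x : x \in F1 -> unit_root x by move=> xF1; apply: rt; rewrite mem_cat xF1.
apply: forward_roots_congr => G1 x G2 GE; rewrite mul1mx.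
have := split_orth_head rt1 ex1 orth1 GE; set u := _ *m x => ur.
rewrite GE in ex1 rt1; rewrite (forward_rotate ex1 rt1).
  suff /negPf-> : u != - r by rewrite orbF.
  by apply: contra_eq_neq ur => ->; rewrite bilNl r1 oppr_eq0 oner_neq0.
by apply: contraNneq rF => <-; rewrite mem_cat GE mem_cat mem_head orbT.
Qed.

Let forward2 : forward_roots L' (refl_prod F1 *m reflmx t) F2 =
  forward_roots L (refl_prod F1 *m reflmx t) F2.
Proof.
apply: forward_roots_congr => G1 x G2 GE.
rewrite -!(mulmxA _ (reflmx t)) -refl_prod_cons -refl_prod_cat.
have FE : F = (F1 ++ t :: G1) ++ x :: G2 by rewrite GE -catA.
have ex' := ex; have rt' := rt; rewrite FE in ex' rt'.
rewrite (forward_rotate ex' rt').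
  suff /negPf-> : refl_prod (F1 ++ t :: G1) *m x != - r by rewrite orbF.
  apply/eqP => uE; have := split_mul1 ex' rt'; rewrite uE mulmxN => xE.
  have mr : moved (refl_prod (rev (F1 ++ t :: G1))) r.
    apply: moved_refl_prod_ind switch_moved; [exact: moved0|exact: movedD|exact: movedZ|].
    move=> y; rewrite mem_rev mem_rcons in_cons => yF; apply: (split_moved1 ex' rt').
    by rewrite mem_cat in_cons; case/orP: yF => ->; rewrite ?orbT.
  have : moved (refl_prod (rev (F1 ++ t :: G1))) x.
    by rewrite -xE; apply/movedN/moved_mul.
  move=> /(split_orth ex'); rewrite (root_bil b_def (split_root rt')) => /eqP.
  by rewrite oner_eq0.
apply: contraNneq rF => <-; rewrite FE mem_cat mem_head orbT //.
Qed.

(** For [L'] the vertex [t] is inserted among the forward roots and nothing else changes. With [D]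
    the forward product of [F1], the claim is [R(t) D = D R(r)], that is [D r = - t] up to sign;
    [forward_roots_mul_head] replaces [D] by the product of all of [F1]. *)
Lemma switch_forward_prod : subseq F (window L') ->
  forward_prod L' F = forward_prod L F *m reflmx r.
Proof.
move=> sF; rewrite /forward_prod switch_forward_roots forward_roots_cat mul1mx /=.
rewrite switch_in_rotate tE head_opp_in_rotate /= forward1 forward2.
rewrite !rev_cat rev_cons cat_rcons !refl_prod_cat refl_prod_cons -!mulmxA; congr (_ *m _).
have ex1 : exceptional F1 by move: ex; rewrite /exceptional pairwise_cat => /and3P[].
have rt1 x : x \in F1 -> unit_root x by move=> xF1; apply: rt; rewrite mem_cat xF1.
have before x := subseq_index_cat (window_uniq pL') sF switch_in_rotate (y := x).
set D := refl_prod _.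
have DW : W D.
  apply: (refl_prod_group W_orth) => x; rewrite mem_rev.
  by move=> /(mem_subseq (forward_roots_subseq _ _ _)); exact: rt1.
have Dr : D *m r = - t.
  rewrite t_head opprK; apply: forward_roots_mul_head => // [x /before[]//||x xF1].
    exact: subseq_pairwise_cat (window_uniq pL') sF switch_in_rotate.
  by rewrite -t_head; have [] := before x xF1.
rewrite -[t]opprK reflmxN -Dr (reflmx_image W_orth _ DW) -!mulmxA.
by rewrite (group_tr_mul W_orth DW) mulmx1.
Qed.

End Switch.

(** Otherwise every forward root [a] has [b (a, r) <= 0], as [r] comes first, and
    [b (a, r) = b (r, - D^-1 a) >= 0] for the forward product [D], by [forward_projective]. Then
    [M(D)] is left orthogonal to [r], which contradicts [b (r, r) = 1]. *)
Lemma forward_prod_head C F : cluster L C F -> moved (forward_prod L F) r -> r \in F.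
Proof.
move=> clF mr; have [ncA mA] := forward_nc pL clF; case: clF => sF eF _ _.
apply/negPn/negP => rF; suff: bil r r = 0 by move/eqP; rewrite r1 oner_eq0.
apply: bil_moved_l (mr) => a; rewrite mem_rev => aA.
have [aF aL] := mem_forward_roots aA.
have a_r : a != r by apply: contraNneq rF => <-.
have := head_bil_ge0 (forward_projective pL sF eF aA).
have [_] := head_bil aL a_r; rewrite bilNr -(nc_serre_tr W_orth b_def ncA (mA a aA) mr).
by move=> a_le a_ge; apply/eqP; rewrite eq_le a_le.
Qed.

(** The vertex is the first [t] with [b (t, r)] nonzero; it exists because [F] spans [M(C)]. Its
    deciding root satisfies [b (u, r) = b (t, r)]. As [r] is the only positive root [y] with
    [b (y, r) > 0], it suffices that [- u] is positive and [b (- u, r) > 0]. *)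
Lemma switch_exists C F : nc C -> moved C r -> cluster L C F -> r \notin F ->
  (forall x, x \in forward_roots L 1%:M F -> bil x r = 0) ->
  exists F1 t F2, F = F1 ++ t :: F2 /\ refl_prod F1 *m t = - r.
Proof.
move=> ncC Cr clF rF Ar; have Fr := cluster_root pL clF; have Fm := cluster_moved pL clF.
have [F1 [t [F2 [FE F1r tr0]]]] : exists F1 t F2, [/\ F = F1 ++ t :: F2,
    forall x, x \in F1 -> bil x r = 0 & bil t r != 0].
  have: ~~ all (fun x => bil x r == 0) F.
    apply/negP => /allP F0; suff: bil r r = 0 by move/eqP; rewrite r1 oner_eq0.
    case: clF Cr => _ _ -> _; apply: bil_moved_l => x; rewrite mem_rev => /F0/eqP//.
  elim: (F) => //= x F' IH; rewrite negb_and.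
  case: (boolP (bil x r == 0)) => [/eqP xr /=/IH[F1 [t [F2 [-> F1r tr]]]]|xr _].
    by exists (x :: F1), t, F2; split=> // y; rewrite in_cons => /predU1P[->|/F1r].
  by exists [::], x, F'.
exists F1, t, F2; split=> //; have [sF ex CE cF] := clF; rewrite FE in ex.
have rt x : x \in F1 ++ t :: F2 -> unit_root x by rewrite -FE; exact: Fr.
have tF : t \in F by rewrite FE mem_cat mem_head orbT.
have t_r : t != r by apply: contraNneq rF => <-.
set u := _ *m t; have ur : unit_root u := split_root_u rt.
have utE : bil u r = bil t r.
  have : bil (u - t) r = 0.
    by apply: bil_moved_l (split_moved1_sub ex rt) => x; rewrite mem_rev; exact: F1r.
  by rewrite bilDl bilNl => /eqP; rewrite subr_eq0 => /eqP.
apply: oppr_inj; rewrite opprK; case: (boolP (t \in L)) => tL.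
  have [_ tr_le0] := head_bil tL t_r.
  have uL : u \notin L.
    apply: contraNN tr0 => uL; apply/eqP/Ar.
    by rewrite FE forward_roots_cat mem_cat /= !mul1mx tL uL mem_head orbT.
  apply/eqP/negPn/negP => uNr.
  have [_] := head_bil (negP_pos pL ur uL) uNr; rewrite bilNl utE => tr_ge0.
  by move: tr0; rewrite eq_le tr_le0 -oppr_le0 tr_ge0.
(* For a negative [t], [C^-1 t] is positive, so [b (t, r) = - b (r, C^-1 t) <= 0]; applied to [- t]
   this forces [t = - r]. *)
have yL := cF t tF; rewrite (negPf tL) /= in yL.
have PL : - t \in L := negP_pos pL (Fr t tF) tL.
have tE : t = - r.
  apply: oppr_inj; rewrite opprK; apply/eqP/negPn/negP => P_r.
  have [_] := head_bil PL P_r; rewrite bilNl (nc_serre_tr W_orth b_def ncC (Fm t tF) Cr) opprK => le0.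
  move: tr0; rewrite (nc_serre_tr W_orth b_def ncC (Fm t tF) Cr).
  by rewrite oppr_eq0 eq_le le0 head_bil_ge0.
have mr : moved (refl_prod (rev (rcons F1 t))) r.
  by rewrite -[r]opprK -tE; apply: movedN; exact: split_moved ex rt.
have uNL : - u \in L.
  have := head_projective (split_nc ex rt) mr.
  by rewrite -mulmxN -tE (split_tr ex rt).
apply/eqP/negPn/negP => uNr; have [_] := head_bil uNL uNr.
by rewrite bilNl utE tE bilNl r1 opprK; lra.
Qed.

Lemma forward_roots_rotate F : exceptional F -> (forall x, x \in F -> unit_root x) ->
  r \notin F -> (forall F1 t F2, F = F1 ++ t :: F2 -> refl_prod F1 *m t <> - r) ->
  forward_roots L' 1%:M F = forward_roots L 1%:M F.
Proof.
move=> eF Fr rF noswitch; apply: forward_roots_congr => F1 t F2 FE.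
have := noswitch _ _ _ FE; rewrite mul1mx => /eqP/negPf uNr.
rewrite FE in eF Fr rF; rewrite (forward_rotate eF Fr) ?uNr ?orbF //.
by apply: contraNneq rF => <-; rewrite mem_cat mem_head orbT.
Qed.

Lemma cluster_exceptional L0 C F : ordered_positive L0 -> cluster L0 C F ->
  exceptional F /\ forall x, x \in F -> unit_root x.
Proof. by move=> pL0 clF; split; [case: clF | move=> x; exact: cluster_root clF]. Qed.

(** By Serre duality the claim is [b (C r, t) = 0]. For [t] before [- (C r)] this is exceptionality.
    A later [t] is negative, and the order of the opposites [C r] and [- t] gives [b (C r, t) <= 0],
    while [b (C r, t) = b (r, C^-1 t) >= 0]. *)
Lemma opp_head_orth C F t : nc C -> moved C r -> cluster L' C F ->
  - (C *m r) \in F -> t \in F -> t != - (C *m r) -> bil t r = 0.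
Proof.
move=> ncC Cr clF qF tF t_q; have Ct := cluster_moved pL' clF tF.
have CW := nc_group ncC; have CrL' := mul_head_in_rotate ncC Cr.
apply: oppr_inj; rewrite oppr0 -(nc_serre b_def ncC Cr Ct).
have [eF Fr] := cluster_exceptional pL' clF; have [sF _ _ cF] := clF.
case/splitPr: qF => F1 F2 in sF eF Fr cF tF *.
move: eF; rewrite /exceptional pairwise_cat /= => /and3P[/allrelP H1 _ /andP[/allP H2 _]].
move: tF; rewrite mem_cat in_cons (negPf t_q) /= => /orP[tF1|tF2].
  have /eqP := H1 _ _ tF1 (mem_head _ _).
  by rewrite bilNl => /eqP; rewrite oppr_eq0 => /eqP.
have := H2 t tF2; rewrite bilNr oppr_eq0 => /eqP tCr.
have [F3 [F4 F2E]] : exists F3 F4, F2 = F3 ++ t :: F4.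
  by case/splitPr: tF2 => F3 F4; exists F3, F4.
have tL' : t \notin L'.
  apply/negP => tL'; have sF' : subseq ((F1 ++ - (C *m r) :: F3) ++ t :: F4) (window L').
    by rewrite -catA cat_cons -F2E.
  have := subseq_index_cat (window_uniq pL') sF' tL' (y := - (C *m r)).
  rewrite mem_cat mem_head orbT => /(_ erefl)[qL' _].
  by move: (pos_opp pL' CrL'); rewrite qL'.
have tFF : t \in F1 ++ - (C *m r) :: F2 by rewrite mem_cat in_cons tF2 !orbT.
have yL' := cF t tFF; rewrite (negPf tL') /= in yL'.
have QL' : - t \in L' by apply: (negP_pos pL') tL'; exact: Fr.
have idx : (index (C *m r) L' < index (- t) L')%N.
  have sF' : subseq ((F1 ++ - (C *m r) :: F3) ++ t :: F4) (window L').
    by rewrite -catA cat_cons -F2E.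
  have := subseq_index (window_uniq pL') sF' (y := - (C *m r)).
  rewrite mem_cat mem_head orbT => /(_ erefl).
  rewrite !index_cat (negPf tL') (negPf (pos_opp pL' CrL')) ltn_add2l.
  by rewrite -{1}[t]opprK !(index_map oppr_inj).
have [ge0 _] := pos_index pL' CrL' QL' idx.
have y_Nr : C^T *m t != - r.
  by apply: contraNneq t_q => yE; rewrite -mulmxN -yE (group_Ktr W_orth).
have y_r : C^T *m t != r.
  by apply: contraTneq yL' => ->; exact: head_notin_rotate.
have yL : C^T *m t \in L by rewrite -mem_rotate.
have E : bil (C *m r) t = bil r (C^T *m t).
  by rewrite -(nc_bil b_def ncC Cr (moved_tr W_orth CW Ct)) (group_Ktr W_orth).
apply/eqP; rewrite eq_le E head_bil_ge0 // andbT -E.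
by move: ge0; rewrite bilNr oppr_ge0.
Qed.

(** * Fibres of the forward product under rotation *)

Section Fiber.
Context C (ncC : nc C) D (ncD : nc D) (DC : forall x, moved D x -> moved C x).
Context (Dr : ~ moved D r).

Lemma fiber_rotate_fixed F : ~ moved C r ->
  (cluster L C F /\ forward_prod L F = D) <-> (cluster L' C F /\ forward_prod L' F = D).
Proof.
move=> Cr; have E := cluster_rotate_fixed F ncC Cr.
suff fwE : cluster L C F -> forward_prod L' F = forward_prod L F.
  split=> -[clF fF].
    by split; [exact/E | rewrite fwE].
  by split; [exact/E | rewrite -fwE //; exact/E].
move=> clF; rewrite /forward_prod; congr (refl_prod (rev _)).
have Fm t : t \in F -> moved C t by exact: cluster_moved clF.
have rF : r \notin F by apply/negP => /Fm.
have [eF Fr] := cluster_exceptional pL clF; have [_ _ CE _] := clF.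
apply: forward_roots_rotate => // F1 t F2 FE tE; apply: Cr.
rewrite -[r]opprK -tE; apply: movedN.
have eF' := eF; have Fr' := Fr; rewrite FE in eF' Fr'.
have := split_moved_u eF' Fr'; rewrite CE; apply: moved_subset.
  by move=> x; rewrite mem_rcons FE mem_cat !in_cons => /orP[->|->]; rewrite ?orbT.
by move=> x /Fm; rewrite -CE.
Qed.

Context (Cr : moved C r).

Let prod_moved L0 F x : ordered_positive L0 -> cluster L0 C F -> forward_prod L0 F = D ->
  x \in forward_roots L0 1%:M F -> moved D x.
Proof. by move=> pL0 clF <-; have [_] := forward_nc pL0 clF; apply. Qed.

Let prod_orth L0 F : ordered_positive L0 -> cluster L0 C F -> forward_prod L0 F = D ->
  (forall x, x \in forward_roots L0 1%:M F -> bil x r = 0) ->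
  forall x, moved D x -> bil x r = 0.
Proof. by move=> pL0 clF <- H; apply: bil_moved_l => x; rewrite mem_rev; exact: H. Qed.

Let opp_head_notin F : cluster L' C F ->
  ~ (forall x, x \in forward_roots L' 1%:M F -> bil x r = 0) -> - (C *m r) \notin F.
Proof.
move=> clF nA; apply/negP => qF; apply: nA => x /mem_forward_roots[xF xL'].
apply: opp_head_orth qF xF _ => //; apply: contraTneq xL' => ->.
by apply: (pos_opp pL'); exact: mul_head_in_rotate.
Qed.

(** A vertex switches exactly when all forward roots are left orthogonal to [r]: [switch_exists] one
    way, [switch_orth] the other. *)
Let switch_or F : cluster L C F -> r \notin F -> subseq F (window L') ->
  (forward_prod L' F = forward_prod L F *m reflmx r /\
    forall x, x \in forward_roots L 1%:M F -> bil x r = 0) \/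
  (forward_prod L' F = forward_prod L F /\
    ~ forall x, x \in forward_roots L 1%:M F -> bil x r = 0).
Proof.
move=> clF rF sF; have [eF Fr] := cluster_exceptional pL clF.
have [H|H] := pselect (forall x, x \in forward_roots L 1%:M F -> bil x r = 0).
  left; split=> //; have [F1 [t [F2 [FE tE]]]] := switch_exists ncC Cr clF rF H.
  by rewrite FE in eF Fr rF sF *; exact: switch_forward_prod.
right; split=> //; rewrite /forward_prod; congr (refl_prod (rev _)).
apply: forward_roots_rotate => // F1 t F2 FE tE; apply: H.
by rewrite FE in eF Fr rF *; exact: switch_orth.
Qed.

Let head_notin F : cluster L C F -> forward_prod L F = D -> r \notin F.
Proof.
move=> clF fF; apply/negP => rF; apply: Dr; apply: (prod_moved pL clF fF).
case: F rF clF {fF} => // x F rF clF; have [sF _ _ _] := clF.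
have xE : x = r.
  move: rF sF; rewrite in_cons => /predU1P[->//|rF] /=.
  case: eqP => // _ /mem_subseq/(_ r); rewrite in_cons rF orbT => /(_ erefl).
  by have := window_uniq pL; rewrite window_head /= => /andP[/negPf->].
by rewrite xE /= mul1mx rL mem_head.
Qed.

(** On the way back, [D R(r)] moves [r], so its forward roots are not all left orthogonal to [r];
    this keeps [- (C r)] out of [F]. If no vertex switched, [forward_prod_head] would make [r] a
    vertex. *)
Lemma fiber_rotate_orth F : (forall x, moved D x -> bil x r = 0) ->
  (cluster L C F /\ forward_prod L F = D) <->
  (cluster L' C F /\ forward_prod L' F = D *m reflmx r).
Proof.
move=> Do; have Dr1 := add_right_moved_root W_orth b_def ncD rr Do.
split=> -[clF fF].
  have rF := head_notin clF fF.
  have [clF' qF] := (proj1 (cluster_rotate F ncC Cr)) (conj clF rF).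
  split=> //; have [sF' _ _ _] := clF'.
  have [[-> _]|[_ []]] := switch_or clF rF sF'; first by rewrite fF.
  by move=> x xA; apply: Do; exact: prod_moved xA.
have nA : ~ forall x, x \in forward_roots L' 1%:M F -> bil x r = 0.
  move=> H; have : bil r r = 0.
    by rewrite -fF in Dr1; apply: bil_moved_l Dr1 => x; rewrite mem_rev; exact: H.
  by move/eqP; rewrite r1 oner_eq0.
have [clF' rF] := (proj2 (cluster_rotate F ncC Cr)) (conj clF (opp_head_notin clF nA)).
split=> //; have [sF _ _ _] := clF.
have [[E _]|[E _]] := switch_or clF' rF sF.
  move: fF; rewrite E => /(congr1 (mulmx^~ (reflmx r))).
  by rewrite -!mulmxA (rootKmx rr) !mulmx1.
case/negP: rF; apply: forward_prod_head clF' _; by rewrite -E fF.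
Qed.

(** A switch on the way back would put [r] into [M(D)]. *)
Lemma fiber_rotate_not_orth F : ~ (forall x, moved D x -> bil x r = 0) ->
  (cluster L C F /\ forward_prod L F = D) <-> (cluster L' C F /\ forward_prod L' F = D).
Proof.
move=> nDo; split=> -[clF fF].
  have rF := head_notin clF fF.
  have [clF' qF] := (proj1 (cluster_rotate F ncC Cr)) (conj clF rF).
  split=> //; have [sF' _ _ _] := clF'.
  have [[_ H]|[-> _]] := switch_or clF rF sF'; last by [].
  by case: nDo; exact: prod_orth pL clF fF H.
have nA : ~ forall x, x \in forward_roots L' 1%:M F -> bil x r = 0.
  by move=> H; apply: nDo; exact: prod_orth pL' clF fF H.
have [clF' rF] := (proj2 (cluster_rotate F ncC Cr)) (conj clF (opp_head_notin clF nA)).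
split=> //; have [sF _ _ _] := clF.
have [[E H]|[<- _]] := switch_or clF' rF sF; last by [].
case: Dr; rewrite -fF E; have [ncA _] := forward_nc pL clF'.
apply: (add_right_moved_root W_orth b_def ncA rr).
by apply: bil_moved_l => x; rewrite mem_rev; exact: H.
Qed.

End Fiber.

(** [r] is a vertex by [forward_prod_head]; heading the window, it is then the first vertex, and it
    is forward. *)
Lemma fiber_head C D F : nc C -> nc D -> moved C r -> moved D r ->
  (cluster L C F /\ forward_prod L F = D) <->
  exists2 F', F = r :: F' &
    cluster L (C *m reflmx r) F' /\ forward_prod L F' = D *m reflmx r.
Proof.
move=> ncC ncD Cr Dr; split=> [[clF fF]|[F' -> [clF' fF']]].
  have rF : r \in F by apply: forward_prod_head clF _; rewrite fF.
  case: F rF clF fF => // x F rF clF fF; have [sF _ _ _] := clF.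
  have xE : x = r.
    move: rF sF; rewrite in_cons => /predU1P[->//|rF] /=.
    case: eqP => // _ /mem_subseq/(_ r); rewrite in_cons rF orbT => /(_ erefl).
    by have := window_uniq pL; rewrite window_head /= => /andP[/negPf->].
  rewrite xE in clF fF *; exists F => //.
  have clF' := (proj1 (head_cluster F ncC Cr)) clF; split=> //.
  rewrite -fF /forward_prod (forward_roots_head ncC Cr clF').
  by rewrite rev_cons refl_prod_rcons -mulmxA (rootKmx rr) mulmx1.
split; first exact/(head_cluster F' ncC Cr).
rewrite /forward_prod (forward_roots_head ncC Cr clF') rev_cons refl_prod_rcons.
by rewrite -/(forward_prod L F') fF' -mulmxA (rootKmx rr) mulmx1.
Qed.

Lemma simplex_head C F : nc C -> moved C r -> simplex L C (r :: F) ->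
  simplex L (C *m reflmx r) F.
Proof.
move=> ncC Cr [sF]; rewrite /exceptional /= => /andP[/allP Fr0 eF] Fm cF.
have F1m t : t \in F -> moved (C *m reflmx r) t.
  move=> tF; apply/(moved_mul_reflmx b_def ncC rr Cr); split; last exact/eqP/Fr0.
  by apply: Fm; rewrite in_cons tF orbT.
split=> // [|t tF]; first exact: subseq_trans (subseq_cons _ _) sF.
rewrite mem_tr_mul_reflmx //; last exact: F1m.
  by apply: cF; rewrite in_cons tF orbT.
by apply: (window_root pL); apply: (mem_subseq sF); rewrite in_cons tF orbT.
Qed.

(** Mutation. By [opp_head_orth] the other vertices are left orthogonal to [r], and those in [F2]
    are moreover orthogonal to [q = - C r]. So [R(q)] can be pulled to the left end of the product,
    where [R(q) C = C R(r)] shows that deleting it leaves a factorisation of [C R(r)]. *)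
Lemma cluster_exchange C F1 F2 : nc C -> moved C r ->
  cluster L' C (F1 ++ - (C *m r) :: F2) -> cluster L C (r :: F1 ++ F2).
Proof.
move=> ncC Cr clF; have [eF Fr] := cluster_exceptional pL' clF.
set q := - (C *m r) in clF eF Fr; have CW := nc_group ncC.
have qr : unit_root q by apply: Fr; rewrite mem_cat mem_head orbT.
have Fm := cluster_moved pL' clF; have [sF _ CE cF] := clF.
have HF t : t \in F1 ++ F2 -> t \in F1 ++ q :: F2.
  by rewrite !mem_cat in_cons => /orP[->|->]; rewrite ?orbT.
have HFq t : t \in F1 ++ F2 -> t != q.
  move: (subseq_uniq sF (window_uniq pL')); rewrite cat_uniq /= => /and3P[_ + /andP[qF2 _]].
  rewrite negb_or mem_cat => /andP[qF1 _].
  by apply: contraTneq => ->; rewrite negb_or; apply/andP; split.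
have Fr0 t : t \in F1 ++ F2 -> bil t r = 0.
  by move=> tF; apply: opp_head_orth clF _ (HF t tF) (HFq t tF); rewrite ?mem_cat ?mem_head ?orbT.
have rF : r \notin F1 ++ F2 by apply/negP => /Fr0/eqP; rewrite r1 oner_eq0.
have NrF : - r \notin F1 ++ F2.
  by apply/negP => /Fr0/eqP; rewrite bilNl r1 oppr_eq0 oner_eq0.
have sF' : subseq (F1 ++ F2) (F1 ++ q :: F2) by rewrite cat_subseq // subseq_cons.
apply/(head_cluster _ ncC Cr); split.
- by rewrite subseq_head // -subseq_rotate //; exact: subseq_trans sF' sF.
- exact: exceptional_subseq sF' eF.
- have qP : refl_prod (rev F2) *m q = q.
    have F2q t : t \in F2 -> dot t q = 0.
      move=> tF2; have tF : t \in F1 ++ F2 by rewrite mem_cat tF2 orbT.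
      have tq : bil t q = 0.
        move: eF; rewrite /exceptional pairwise_cat /= => /and3P[_ _ /andP[/allP H _]].
        exact/eqP/H.
      have := bil_sym b_def t q; rewrite tq add0r bilNl.
      rewrite (nc_serre b_def ncC Cr (Fm t (HF t tF))) (Fr0 t tF) !oppr0 => /esym/eqP.
      by rewrite mulf_eq0 pnatr_eq0 /= => /eqP.
    have F2r t : t \in F2 -> unit_root t by move=> tF2; apply: Fr; rewrite mem_cat in_cons tF2 !orbT.
    elim: F2 F2q F2r {clF eF Fr Fm sF CE cF HF HFq Fr0 rF NrF sF'} => [|t F2 IH] Fq F2r.
      by rewrite refl_prod_nil mul1mx.
    rewrite rev_cons refl_prod_rcons -mulmxA (reflmx_root _ (F2r t (mem_head _ _))).
    rewrite (Fq t (mem_head _ _)) mulr0 scale0r subr0 IH // => x xF.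
      by apply: Fq; rewrite in_cons xF orbT.
    by apply: F2r; rewrite in_cons xF orbT.
  have PW : W (refl_prod (rev F2)).
    apply: (refl_prod_group W_orth) => x; rewrite mem_rev => xF2.
    by apply: Fr; rewrite mem_cat in_cons xF2 !orbT.
  have : reflmx q *m C = C *m reflmx r.
    rewrite /q reflmxN (reflmx_image W_orth _ CW) -!mulmxA.
    by rewrite (group_tr_mul W_orth CW) mulmx1.
  rewrite -{1}qP (reflmx_image W_orth _ PW) {1}CE => <-.
  rewrite !rev_cat rev_cons cat_rcons !refl_prod_cat refl_prod_cons -!mulmxA.
  congr (_ *m _); rewrite !mulmxA -(mulmxA _ _ (refl_prod (rev F2))).
  rewrite (group_tr_mul W_orth PW) mulmx1 (rootKmx qr) mul1mx //.
- move=> t tF; have t_r : t != r by apply: contraNneq rF => <-.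
  have t_Nr : t != - r by apply: contraNneq NrF => <-.
  have tm : moved (C *m reflmx r) t.
    by apply/(moved_mul_reflmx b_def ncC rr Cr); split; [apply/Fm/HF | exact: Fr0].
  rewrite mem_tr_mul_reflmx //; last exact/Fr/HF.
  have := cF t (HF t tF); rewrite mem_rotate //; case: (t \in L) => //= yL'.
  rewrite -mem_rotate //; first by apply: contraTneq yL' => ->; exact: head_notin_rotate.
  apply: contraNneq (HFq t tF) => yE.
  by rewrite /q -mulmxN -yE (group_Ktr W_orth).
Qed.

End Head.

(** * Induction on the rank *)

Context (root_moved : forall w, nc w -> w <> 1%:M -> exists2 t, unit_root t & moved w t).

Lemma pos_root_moved L w : ordered_positive L -> nc w -> w <> 1%:M ->
  exists2 t, t \in L & moved w t.
Proof.
move=> pL ncw w1; have [t tr wt] := root_moved ncw w1.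
by have /orP[tL|tL] := pos_cover pL tr; [exists t | exists (- t) => //; exact: movedN].
Qed.

Lemma codim_mul_reflmx w t : nc w -> unit_root t -> moved w t ->
  (codim (w *m reflmx t) < codim w)%N.
Proof.
move=> ncw tr wt; have E := moved_mul_reflmx b_def ncw tr wt.
apply: (rank_moved_ltn (r := t)) => //; first by move=> x /E[].
by move=> /E[_ /eqP]; rewrite (root_bil b_def tr) oner_eq0.
Qed.

Definition unique_cluster L C D :=
  exists2 F, cluster L C F /\ forward_prod L F = D &
    forall G, cluster L C G /\ forward_prod L G = D -> G = F.

Lemma unique_cluster_transfer L L' C D D' :
  (forall F, (cluster L C F /\ forward_prod L F = D) <->
             (cluster L' C F /\ forward_prod L' F = D')) ->
  unique_cluster L' C D' -> unique_cluster L C D.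
Proof. by move=> E [F /E FP FU]; exists F => // G /E; exact: FU. Qed.

Lemma cluster_bijection C L D : nc C -> ordered_positive L -> nc D ->
  (forall x, moved D x -> moved C x) -> unique_cluster L C D.
Proof.
have [d] := ubnP (codim C); elim: d C L D => // d IHd C L D dC ncC pL ncD DC.
have [C1|C1] := pselect (C = 1%:M).
  have D1 : D = 1%:M.
    by apply: moved_eq0 => x /DC; rewrite C1; exact: moved1.
  exists [::].
    by rewrite /forward_prod /= refl_prod_nil D1; split=> //; split; rewrite ?sub0seq ?refl_prod_nil.
  case=> // x F [clF _]; have := cluster_moved pL clF (mem_head _ _).
  rewrite C1 => /moved1 x0; have := root_neq0 (cluster_root pL clF (mem_head _ _)).
  by rewrite x0 eqxx.
have cut r M E : ordered_positive (r :: M) -> nc E -> (forall x, moved E x -> moved C x) ->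
    moved E r -> unique_cluster (r :: M) C E.
  move=> {}pL ncE EC Er; have rr := pos_root pL (mem_head _ _); have Cr := EC r Er.
  have Ei := moved_mul_reflmx b_def ncE rr Er; have Ci := moved_mul_reflmx b_def ncC rr Cr.
  have [||||F' FP FU] := IHd (C *m reflmx r) (r :: M) (E *m reflmx r) _ _ pL.
  - exact: leq_trans (codim_mul_reflmx ncC rr Cr) _.
  - exact: nc_mul_reflmx.
  - exact: nc_mul_reflmx.
  - by move=> x /Ei[/EC Cx xr]; apply/Ci.
  exists (r :: F'); first by apply/(fiber_head pL _ ncC ncE Cr Er); exists F'.
  by move=> G /(fiber_head pL _ ncC ncE Cr Er)[G' -> /FU->].
(* The root [x] stays in the moved space even when a rotation replaces [E] by [E R(r)], so its index
   drops at every step. *)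
have stepA (k : nat) : forall M E x, ordered_positive M -> nc E ->
    (forall y, moved E y -> moved C y) -> x \in M -> moved E x -> index x M = k ->
    unique_cluster M C E.
  elim: k => [|k IHk] M E x pM ncE EC xM Ex.
    case: M pM xM => // r M pM xM /=; case: eqP => // rx _.
    by apply: cut => //; rewrite rx.
  case: M pM xM => // r M pM xM; have [Er _|Er] := pselect (moved E r); first exact: cut.
  have rx : r != x by apply: contra_not_neq Er => ->.
  rewrite /= (negPf rx) => -[idx].
  have xM' : x \in M by move: xM; rewrite in_cons eq_sym (negPf rx).
  have xrM : x \in rcons M (- r) by rewrite mem_rcons in_cons xM' orbT.
  have idx' : index x (rcons M (- r)) = k by rewrite -cats1 index_cat xM'.
  have pM' := rotate_positive pM; have rr := pos_root pM (mem_head _ _).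
  have [Cr|Cr] := pselect (moved C r); last first.
    by apply: unique_cluster_transfer (IHk _ _ x pM' ncE EC xrM Ex idx') => F; exact: fiber_rotate_fixed.
  have [Eo|Eo] := pselect (forall x, moved E x -> bil x r = 0); last first.
    by apply: unique_cluster_transfer (IHk _ _ x pM' ncE EC xrM Ex idx') => F; exact: fiber_rotate_not_orth.
  apply: unique_cluster_transfer (fun F => fiber_rotate_orth pM ncC ncE Er Cr F Eo) _.
  apply: IHk (x) pM' (nc_add_right W_orth b_def ncE rr Eo) _ xrM _ idx'.
    move=> y /(add_right_moved W_orth b_def ncE rr Eo)[a [z [Ez ->]]].
    by apply: movedD; [exact: EC | exact: movedZ].
  exact: (add_right_sub W_orth b_def ncE rr Eo).
have [D1|D1] := pselect (D = 1%:M); last first.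
  by have [x xL Dx] := pos_root_moved pL ncD D1; apply: (stepA _ L D x).
(* For [D = 1], rotate until the head [r] lies in [M(C)]; that rotation turns [1] into [R(r)], whose
   root [- r] is in the new list. *)
have [x xL Cx] := pos_root_moved pL ncC C1.
have [k] := ubnP (index x L); elim: k L pL xL => // k IHk L pL xL idx.
case: L pL xL idx => // r M pL xL idx; have rr := pos_root pL (mem_head _ _).
have pL' := rotate_positive pL.
have Dr : ~ moved D r.
  by rewrite D1 => /moved1 r0; have := root_neq0 rr; rewrite r0 eqxx.
have [Cr|Cr] := pselect (moved C r).
  have Do y : moved D y -> bil y r = 0 by rewrite D1 => /moved1->; exact: bil0l.
  apply: unique_cluster_transfer (fun F => fiber_rotate_orth pL ncC ncD Dr Cr F Do) _.
  apply: stepA (- r) pL' (nc_add_right W_orth b_def ncD rr Do) _ _ _ erefl.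
  - move=> y /(add_right_moved W_orth b_def ncD rr Do)[a [z [Dz ->]]].
    by apply: movedD; [exact: DC | exact: movedZ].
  - exact: head_opp_in_rotate.
  - exact/movedN/(add_right_moved_root W_orth b_def ncD rr Do).
apply: unique_cluster_transfer (fun F => fiber_rotate_fixed pL ncC D F Cr) _.
have rx : r != x by apply: contra_not_neq Cr => ->.
have xM : x \in M by move: xL; rewrite in_cons eq_sym (negPf rx).
apply: IHk => //; first by rewrite mem_rcons in_cons xM orbT.
by move: idx; rewrite /= (negPf rx) ltnS -cats1 index_cat xM.
Qed.

(** Makes maximal simplices clusters. Rotate until a vertex of [F], or any root of [M(C)] if [F] is
    empty, heads the window, and remove it. On the way back, a cluster using the new vertex
    [- (C r)] is mutated by [cluster_exchange]; [F] does not contain that vertex. *)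
Lemma cluster_extend C L F : nc C -> ordered_positive L -> simplex L C F ->
  exists2 G, cluster L C G & {subset F <= G}.
Proof.
have [d] := ubnP (codim C); elim: d C L F => // d IHd C L F dC ncC pL siF.
have [C1|C1] := pselect (C = 1%:M).
  exists F => //; case: F siF => [|x F] [sF eF Fm cF].
    by split; rewrite ?sub0seq // refl_prod_nil.
  have := Fm x (mem_head _ _); rewrite C1 => /moved1 x0.
  have := root_neq0 (window_root pL (mem_subseq sF (mem_head _ _))).
  by rewrite x0 eqxx.
have cut r M G : ordered_positive (r :: M) -> moved C r -> simplex (r :: M) (C *m reflmx r) G ->
    exists2 H, cluster (r :: M) C (r :: H) & {subset G <= r :: H}.
  move=> pM Cr siG; have rr := pos_root pM (mem_head _ _).
  have [||H clH GH] := IHd (C *m reflmx r) (r :: M) G _ _ pM siG.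
  - exact: leq_trans (codim_mul_reflmx ncC rr Cr) _.
  - exact: nc_mul_reflmx.
  exists H; first exact/(head_cluster pM _ ncC Cr).
  by move=> x /GH xH; rewrite in_cons xH orbT.
have [x [xL Cx xF]] : exists x, [/\ x \in window L, moved C x & F = [::] \/ x \in F].
  case: siF => sF _ Fm _; case: F sF Fm => [|x F] sF Fm.
    have [x xL Cx] := pos_root_moved pL ncC C1; exists x; split=> //; last by left.
    by rewrite mem_cat xL.
  exists x; split; [|exact: Fm (mem_head _ _)|by right; exact: mem_head].
  by apply: (mem_subseq sF); exact: mem_head.
have [k] := ubnP (index x (window L)); elim: k L F pL siF xL xF => // k IHk L F pL siF xL xF idx.
case: L pL siF xL idx => [//|r M] pL siF xL idx.
have pL' := rotate_positive pL; rewrite window_head in xL idx.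
have idx' : x != r -> (index x (window (rcons M (- r))) < k)%N /\ x \in window (rcons M (- r)).
  move=> x_r; move: idx xL; rewrite /= in_cons (negPf x_r) eq_sym (negPf x_r) ltnS /= => idx xK.
  by rewrite window_rotate -cats1 index_cat xK mem_cat xK.
have [Cr|Cr] := pselect (moved C r); last first.
  have x_r : x != r by apply: contra_not_neq Cr => <-.
  have [ix xL'] := idx' x_r.
  have [G clG FG] := IHk _ F pL' ((proj1 (simplex_rotate_fixed M F ncC Cr)) siF) xL' xF ix.
  by exists G => //; apply/(cluster_rotate_fixed pL G ncC Cr).
have [rF|rF] := boolP (r \in F).
  case: F rF siF {xF} => // y F rF siF; have [sF _ _ _] := siF.
  have yE : y = r.
    move: rF sF; rewrite in_cons => /predU1P[->//|rF] /=.
    case: eqP => // _ /mem_subseq/(_ r); rewrite in_cons rF orbT => /(_ erefl).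
    by have := window_uniq pL; rewrite window_head /= => /andP[/negPf->].
  rewrite yE in siF *; have [H clH FH] := cut _ _ _ pL Cr (simplex_head pL ncC Cr siF).
  by exists (r :: H) => // z; rewrite in_cons => /predU1P[->|/FH//]; exact: mem_head.
have [xr|x_r] := eqVneq x r.
  case: xF rF => [F0 _|]; last by rewrite xr => ->.
  have [|H clH _] := cut r M [::] pL Cr; first by split; rewrite ?sub0seq.
  by exists (r :: H) => //; rewrite F0.
have [ix xL'] := idx' x_r.
have [siF' qF] := (proj1 (simplex_rotate pL F ncC Cr)) (conj siF rF).
have [G clG FG] := IHk _ F pL' siF' xL' xF ix.
have [qG|qG] := boolP (- (C *m r) \in G); last first.
  by exists G => //; have [] := (proj2 (cluster_rotate pL G ncC Cr)) (conj clG qG).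
case/splitPr: qG clG FG => G1 G2 clG FG.
exists (r :: G1 ++ G2); first exact: cluster_exchange clG.
move=> z zF; have := FG z zF; rewrite in_cons !mem_cat in_cons => /or3P[->|/eqP zq|->].
- by rewrite orbT.
- by rewrite -zq zF in qF.
- by rewrite !orbT.
Qed.

Lemma rotate_cat_positive L M : ordered_positive (L ++ M) ->
  ordered_positive (M ++ map -%R L).
Proof.
elim: L M => [|x L IH] M; first by rewrite cats0.
by move=> /rotate_positive; rewrite rcons_cat => /IH; rewrite cat_rcons.
Qed.

(** * The lexicographically first facet of X(w) *)

Section FirstFacet.
Context L (pL : ordered_positive L) (f : 'cV[R]_n -> nat).
Context (f_mono : forall x y, x \in L -> y \in L ->
  (index x L < index y L)%N -> (f x < f y)%N).

(** [f] stands for the position in the vertex order of [EX(c)]. In the last alternative [G] is an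
    initial segment of [F], so it is [F] or not maximal. *)
Definition first_sequence w F :=
  [/\ subseq F L, exceptional F, w = refl_prod (rev F),
      forall t, t \in F <-> [/\ t \in L, moved w t & - (w^T *m t) \in L]
    & forall G, subseq G L -> exceptional G -> (forall t, t \in G -> moved w t) ->
      ((map f F : seqlexi nat) < map f G)%O \/ exists s, F = G ++ s].

Lemma first_root w : nc w -> w <> 1%:M ->
  exists L0 r L1, [/\ L = L0 ++ r :: L1, moved w r & forall y, y \in L0 -> ~ moved w y].
Proof.
move=> ncw w1; have [t tL wt] := pos_root_moved pL ncw w1.
have : has (fun x => `[< moved w x >]) L by apply/hasP; exists t => //; exact/asboolP.
elim: (L) => // x L' IH /=; case: asboolP => [wx _|wx /= /IH[L0 [r [L1 [-> wr L0w]]]]].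
  by exists [::], x, L'.
by exists (x :: L0), r, L1; split=> // y; rewrite in_cons => /predU1P[->|/L0w].
Qed.

(** Greedy: the first root [r] of [M(w)], then the sequence for [w R(r)]. Any other projective [t]
    has [b (t, r) <= 0] by the order and [b (t, r) = b (r, - w^-1 t) >= 0], so it lies in
    [M(w R(r))]; on that space being projective for [w] and for [w R(r)] is the same. *)
Lemma first_sequence_exists w : nc w -> exists F, first_sequence w F.
Proof.
have [d] := ubnP (codim w); elim: d w => // d IHd w dw ncw.
have [w1|w1] := pselect (w = 1%:M).
  have no t : t \in L -> ~ moved w t.
    move=> tL; rewrite w1 => /moved1 t0.
    by have := root_neq0 (pos_root pL tL); rewrite t0 eqxx.
  exists [::]; split=> [||||[|g G] sG _ Gw]; rewrite ?sub0seq ?refl_prod_nil //.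
  - by move=> t; split=> // -[/no].
  - by right; exists [::].
  - by case: (no g); [apply: (mem_subseq sG) | apply: Gw]; exact: mem_head.
have [L0 [r [L1 [LE wr L0w]]]] := first_root ncw w1; have wW := nc_group ncw.
have rL : r \in L by rewrite LE mem_cat mem_head orbT.
have rr := pos_root pL rL; have r1 := root_bil b_def rr.
have uL : uniq (L0 ++ r :: L1) by rewrite -LE; exact: pos_uniq pL.
(* The roots before [r] are not in [M(w)]; rotating them away puts [r] first without changing signs
   on [M(w)]. *)
have pL1 : ordered_positive (r :: L1 ++ map -%R L0).
  by rewrite -cat_cons; apply: rotate_cat_positive; rewrite -LE.
have memL y : moved w y -> (y \in r :: L1 ++ map -%R L0) = (y \in L).
  move=> wy; rewrite LE -cat_cons !mem_cat orbC; congr (_ || _).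
  have /negPf-> : y \notin L0 by apply/negP => /L0w.
  by apply/negbTE/mapP => -[z /L0w zw yE]; apply: zw; rewrite -[z]opprK -yE; exact: movedN.
have r_ge0 y : y \in L -> moved w y -> 0 <= bil r y.
  by move=> yL wy; apply: (head_bil_ge0 pL1); rewrite memL.
have r_le0 y : y \in L -> moved w y -> y != r -> bil y r <= 0.
  move=> yL wy yr; have yL1 : y \in r :: L1 ++ map -%R L0 by rewrite memL.
  by have [] := head_bil pL1 yL1 yr.
have r_lt y : y \in L -> moved w y -> y != r -> (index r L < index y L)%N.
  move=> yL wy yr; rewrite LE !index_cat /= eqxx (eq_sym r) (negPf yr).
  have /negPf-> : y \notin L0 by apply/negP => /L0w.
  have /negPf-> : r \notin L0 by apply/negP => /L0w.
  by rewrite addn0 -addSnnS leq_addr.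
have E := moved_mul_reflmx b_def ncw rr wr; have nc1 := nc_mul_reflmx W_orth b_def ncw rr wr.
have projE t : t \in L -> moved (w *m reflmx r) t ->
    (- ((w *m reflmx r)^T *m t) \in L) = (- (w^T *m t) \in L).
  move=> tL tm1; have [wt tr0] := proj1 (E t) tm1.
  have C1W := nc_group nc1; set z := - (_ *m t).
  have zm : moved (w *m reflmx r) z by apply/movedN/(moved_tr W_orth C1W tm1).
  have [wz zr0] := proj1 (E _) zm.
  have zr : unit_root z.
    by apply/root_opp/root_image; [exact: (group_tr W_orth C1W) | exact: (pos_root pL)].
  have zE : reflmx r *m z = - (w^T *m t).
    by rewrite /z mulmxN trmx_mul tr_reflmx -mulmxA (rootK _ rr).
  have := mem_reflmx_head pL1 zr zr0; rewrite zE !memL //.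
  exact/movedN/(moved_tr W_orth).
have rP : - (w^T *m r) \in L by apply: bil_projective.
have orth t : t \in L -> moved w t -> t != r -> - (w^T *m t) \in L -> bil t r = 0.
  move=> tL wt t_r t'L; apply/eqP; rewrite eq_le r_le0 //=.
  rewrite (nc_serre_tr W_orth b_def ncw wt wr) -bilNr r_ge0 //.
  exact/movedN/(moved_tr W_orth).
have [|F [sF eF wF mF lF]] := IHd (w *m reflmx r) _ nc1.
  exact: leq_trans (codim_mul_reflmx ncw rr wr) _.
have FL t : t \in F -> t \in L /\ moved (w *m reflmx r) t by move=> /mF[].
have Fr t : t \in F -> bil t r = 0 by move=> /FL[_ /E[]].
have rF : r \notin F by apply/negP => /Fr/eqP; rewrite r1 oner_eq0.
have tail G : subseq G L -> (forall t, t \in G -> moved w t) -> r \notin G -> subseq G L1.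
  move=> sG Gw rG; have := sG; rewrite LE => /(subseq_uniqP uL)->.
  rewrite filter_cat /= (negPf rG).
  have -> : [seq x <- L0 | x \in G] = [::].
    by rewrite -(filter_pred0 L0); apply: eq_in_filter => y /L0w yw; apply/negP => /Gw.
  exact: filter_subseq.
exists (r :: F); split.
- rewrite LE -(cat0s (r :: F)) cat_subseq ?sub0seq //= eqxx.
  by apply: tail => // t /FL[_ /E[]].
- by rewrite /exceptional /= -/(exceptional F) eF andbT; apply/allP => t /Fr/eqP.
- by rewrite rev_cons refl_prod_rcons -wF -mulmxA (rootKmx rr) mulmx1.
- move=> t; rewrite in_cons; split.
    case/predU1P=> [->|tF]; first by split.
    by have [tL tm t'L] := proj1 (mF t) tF; have [wt _] := proj1 (E t) tm; rewrite -projE.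
  case=> tL wt t'L; have [//|t_r] := eqVneq t r; apply/mF.
  have tm : moved (w *m reflmx r) t by apply/E; split=> //; exact: orth.
  by rewrite projE.
case=> [|g G] sG eG Gw; first by right; exists (r :: F).
have gL : g \in L by apply: (mem_subseq sG); exact: mem_head.
have [gr|g_r] := eqVneq g r; last first.
  by left; rewrite /= ltxi_cons !leEnat; have /(f_mono rL gL) := r_lt g gL (Gw g (mem_head _ _)) g_r; lia.
move: eG; rewrite /exceptional /= => /andP[/allP Gr eG].
have [|//|t tG|lt_FG|[s FE]] := lF G; first exact: subseq_trans (subseq_cons _ _) sG.
- apply/E; split; first by apply: Gw; rewrite in_cons tG orbT.
  by rewrite -gr; exact/eqP/Gr.
- by left; rewrite /= gr ltxi_cons lexx.
- by right; exists s; rewrite gr FE.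
Qed.


End FirstFacet.
End Rotation.

(** * Reflection length *)

Section ReflectionLength.
Context {R : realType} {n : nat} (W : set 'M[R]_n).
Context (W_orth : orthogonal_group W) (b : 'M[R]_n).
Context (b_def : forall x, dot (b *m x) x = dot x x).
Implicit Types (u v x y t r : 'cV[R]_n) (g w C D : 'M[R]_n).
Implicit Types (F G ts us : seq 'cV[R]_n).

Local Notation unit_root := (unit_root W).
Local Notation bil := (bil b).
Local Notation nc := (nc W b).
Local Notation exceptional := (exceptional b).

Lemma exceptional_codim ts : (forall t, t \in ts -> unit_root t) -> exceptional ts ->
  codim (refl_prod (rev ts)) = size ts.
Proof.
move=> tsr ets; apply/eqP; rewrite eqn_leq -[X in (_ <= X)%N]size_rev rank_refl_prod /=.
elim/last_ind: ts tsr ets => // ts t IH tsr ets.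
have tsr' x : x \in ts -> unit_root x.
  by move=> xts; apply: tsr; rewrite mem_rcons in_cons xts orbT.
move: (ets); rewrite exceptional_rcons => /andP[ets' /allP tts].
have [nct _] := exceptional_nc W_orth b_def tsr' ets'.
have tr : unit_root t by apply: tsr; rewrite mem_rcons mem_head.
have wt y : moved (refl_prod (rev ts)) y -> bil t y = 0.
  by apply: bil_moved_r => x; rewrite mem_rev => /tts/eqP.
rewrite size_rcons rev_rcons refl_prod_cons; apply: leq_ltn_trans (IH tsr' ets') _.
apply: (rank_moved_ltn (r := t)).
- move=> x mx; apply/(add_left_moved W_orth b_def nct tr wt).
  by exists 0, x; rewrite scale0r addr0.
- exact: (add_left_moved_root W_orth b_def nct tr wt).
- exact: (add_left_not_moved b_def tr wt).
Qed.

Lemma refl_factorsP w k : refl_factors W w k <->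
  exists ts, [/\ size ts = k, forall t, t \in ts -> unit_root t & w = refl_prod ts].
Proof.
split=> [[s [<- sW ->]]|[ts [<- tsr ->]]]; last first.
  exists (map (@reflmx R n) ts); split; rewrite ?size_map ?big_map //.
  by move=> _ /mapP[t /tsr tr ->]; exact: root_reflection.
elim: s sW => [|g s IH] sW; first by exists [::]; rewrite big_nil refl_prod_nil.
have [|ts [szts tsr tsE]] := IH.
  by move=> x xs; apply: sW; rewrite in_cons xs orbT.
have [t tr gE] := reflection_root (sW g (mem_head _ _)).
exists (t :: ts); split=> [|x|]; first by rewrite /= szts.
  by rewrite in_cons => /predU1P[->|/tsr].
by rewrite big_cons refl_prod_cons tsE gE.
Qed.

Lemma refl_factors_codim w k : refl_factors W w k -> (codim w <= k)%N.
Proof. by move=> /refl_factorsP[ts [<- _ ->]]; exact: rank_refl_prod. Qed.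

Lemma reflenP w k : refl_factors W w k -> refl_factors W w (reflen W w).
Proof.
move=> wk; rewrite /reflen; set P := [set _ | _]%classic.
(* Some factorisation gives a shortest one, so [xget] does not fall back on its default. *)
have [j Pj] : exists j, P j.
  elim/ltn_ind: k wk => k IH wk.
  have [[j jk wj]|nj] := pselect (exists2 j, (j < k)%N & refl_factors W w j).
    exact: IH jk wj.
  exists k; split=> // j wj; rewrite leqNgt; apply/negP => jk; apply: nj.
  by exists j.
by have [] := xgetPex 0%N (ex_intro _ j Pj).
Qed.

Lemma reflen_leq w k : refl_factors W w k -> (reflen W w <= k)%N.
Proof.
move=> wk; rewrite /reflen; set P := [set _ | _]%classic.
have [j Pj] : exists j, P j.
  elim/ltn_ind: k wk => k IH wk.
  have [[j jk wj]|nj] := pselect (exists2 j, (j < k)%N & refl_factors W w j).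
    exact: IH jk wj.
  exists k; split=> // j wj; rewrite leqNgt; apply/negP => jk; apply: nj.
  by exists j.
by have [_] := xgetPex 0%N (ex_intro _ j Pj); apply.
Qed.

Lemma reflen_codim w k : refl_factors W w k -> (k <= codim w)%N -> reflen W w = codim w.
Proof.
move=> wk kw; apply/eqP; rewrite eqn_leq (leq_trans (reflen_leq wk) kw).
exact: refl_factors_codim (reflenP wk).
Qed.

Context (root_moved : forall w, nc w -> w <> 1%:M -> exists2 t, unit_root t & moved w t).

(** Removing a root of [M(w)] lowers the dimension and keeps the element noncrossing; this gives
    Carter's formula, length equals [codim], for noncrossing elements. *)
Lemma nc_refl_prod w : nc w ->
  exists ts, [/\ size ts = codim w, forall t, t \in ts -> unit_root t & w = refl_prod ts].
Proof.
have [d] := ubnP (codim w); elim: d w => // d IHd w dw ncw.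
have [w1|w1] := pselect (w = 1%:M).
  by exists [::]; rewrite refl_prod_nil w1 /codim subrr mxrank0.
have [t tr wt] := root_moved ncw w1.
have lt := codim_mul_reflmx b_def ncw tr wt.
have [||ts [sz tsr tsE]] := IHd (w *m reflmx t).
- exact: leq_trans lt dw.
- exact: nc_mul_reflmx.
have wE : w = refl_prod (rcons ts t).
  by rewrite refl_prod_rcons -tsE -mulmxA (rootKmx tr) mulmx1.
exists (rcons ts t); split=> //.
  apply/eqP; rewrite eqn_leq {2}wE rank_refl_prod andbT size_rcons sz.
  exact: lt.
by move=> x; rewrite mem_rcons in_cons => /predU1P[->|/tsr].
Qed.

Lemma reflen_nc w : nc w -> reflen W w = codim w.
Proof.
move=> /nc_refl_prod[ts [sz tsr tsE]].
by apply: (@reflen_codim _ (size ts)); rewrite ?sz //; apply/refl_factorsP; exists ts.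
Qed.

Context c (ncc : nc c) (c_full : forall x, moved c x).
Context (W_gen : forall g, W g -> exists k, refl_factors W g k).

Lemma codim_full : codim c = n.
Proof.
apply/eqP; rewrite /codim -mxrank_tr -/(row_full _) -sub1mx.
by apply/rV_subP => u _; rewrite -[u]trmxK; apply/moved_submx.
Qed.

Lemma exceptional_mul ts : (forall t, t \in ts -> unit_root t) -> exceptional ts ->
  [/\ nc (refl_prod ts *m c), (codim (refl_prod ts *m c) + size ts = n)%N &
    forall y, (forall x, x \in ts -> bil x y = 0) -> moved (refl_prod ts *m c) y].
Proof.
elim: ts => [|t ts IH] tsr; first by rewrite refl_prod_nil mul1mx addn0 codim_full.
rewrite /exceptional /= => /andP[/allP tts ets].
have tr := tsr t (mem_head _ _).
have [|ncg szg mg] := IH _ ets.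
  by move=> x xts; apply: tsr; rewrite in_cons xts orbT.
have mt : moved (refl_prod ts *m c) t by apply: mg => x /tts/eqP.
have E := moved_reflmx_mul W_orth b_def ncg tr mt.
rewrite refl_prod_cons -mulmxA; split; first exact: nc_reflmx_mul.
  apply: etrans szg; rewrite /= addnS -addSn; congr (_ + _)%N; apply/eqP; rewrite eqn_leq.
  apply/andP; split; last first.
    have := rank_refl_mul t (reflmx t *m (refl_prod ts *m c)).
    by rewrite mulmxA (rootKmx tr) mul1mx.
  apply: (rank_moved_ltn (r := t)) => //; first by move=> x /E[].
  by move=> /E[_]; rewrite (root_bil b_def tr) => /eqP; rewrite oner_eq0.
move=> y ty; apply/E; split; last exact/ty/mem_head.
by apply: mg => x xts; apply: ty; rewrite in_cons xts orbT.
Qed.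

(** A shortest factorisation of [R(t_1) ... R(t_k) c] completes [rev ts] to a factorisation of [c]
    into [n] reflections, which is exceptional when reversed. *)
Lemma reflen_exceptional ts : (forall t, t \in ts -> unit_root t) ->
  (reflen W (refl_prod ts *m c) + size ts = n)%N <-> exceptional ts.
Proof.
move=> tsr; split=> [E|ets]; last first.
  by have [ncg szg _] := exceptional_mul tsr ets; rewrite reflen_nc.
have gW : W (refl_prod ts *m c).
  by apply: (groupM W_orth _ (nc_group ncc)); exact: refl_prod_group.
have [k /reflenP/refl_factorsP[us [szus usr usE]]] := W_gen gW.
have cE : c = refl_prod (rev ts ++ us).
  rewrite refl_prod_cat -usE mulmxA -tr_refl_prod.
  by rewrite (group_tr_mul W_orth) ?mul1mx //; exact: (refl_prod_group W_orth).
have rr t : t \in rev ts ++ us -> unit_root t.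
  by rewrite mem_cat mem_rev => /orP[/tsr|/usr].
have := refl_prod_exceptional W_orth b_def ncc rr cE.
rewrite size_cat size_rev codim_full szus addnC => /(_ E).
rewrite rev_cat revK; apply: exceptional_subseq; exact: suffix_subseq.
Qed.

(** Shortest factorisations of [w] and [w^-1 c] join to one of [c] of length [n]; its reverse is
    exceptional, and so is the part that belongs to [w]. *)
Lemma NCP_nc w : NCP W c w <-> nc w.
Proof.
split=> [[wW]|ncw].
  rewrite /refl_le (reflen_nc ncc) codim_full (group_inv W_orth wW) => E.
  have [k /reflenP/refl_factorsP[ts [szts tsr tsE]]] := W_gen wW.
  have [|k' /reflenP/refl_factorsP[us [szus usr usE]]] := W_gen (_ : W (w^T *m c)).
    by apply: (groupM W_orth _ (nc_group ncc)); exact: group_tr.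
  have cE : c = refl_prod (ts ++ us).
    by rewrite refl_prod_cat -usE -tsE mulmxA (group_mul_tr W_orth wW) mul1mx.
  have rr t : t \in ts ++ us -> unit_root t by rewrite mem_cat => /orP[/tsr|/usr].
  have := refl_prod_exceptional W_orth b_def ncc rr cE.
  rewrite size_cat codim_full szts szus => /(_ E); rewrite rev_cat => ex.
  have /(exceptional_nc W_orth b_def)[|ncts _] := exceptional_subseq (suffix_subseq _ _) ex.
    by move=> t; rewrite mem_rev; exact: tsr.
  by rewrite tsE -[ts]revK.
split; first exact: nc_group ncw.
have [ts [szts tsr tsE]] := nc_refl_prod ncw.
have ex := refl_prod_exceptional W_orth b_def ncw tsr tsE szts.
have tsr' t : t \in rev ts -> unit_root t by rewrite mem_rev; exact: tsr.
have := proj2 (reflen_exceptional tsr') ex; rewrite size_rev szts -tr_refl_prod -tsE.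
by rewrite /refl_le (reflen_nc ncw) (reflen_nc ncc) codim_full (group_inv W_orth (nc_group ncw)) addnC.
Qed.

End ReflectionLength.

(** * Bipartite Coxeter elements *)

Section OrthonormalProduct.
Context {R : realType} {n : nat} (W : set 'M[R]_n).
Context (W_orth : orthogonal_group W).
Implicit Types (u v t a : 'cV[R]_n) (ts : seq 'cV[R]_n).
Local Notation unit_root := (unit_root W).

Lemma refl_prod_fix ts v : (forall a, a \in ts -> dot a v = 0) -> refl_prod ts *m v = v.
Proof.
elim: ts => [|a ts IH] av; first by rewrite refl_prod_nil mul1mx.
rewrite refl_prod_cons -mulmxA IH => [|x xts]; last by apply: av; rewrite in_cons xts orbT.
by rewrite reflmxE av ?mem_head // mulr0 mul0r scale0r subr0.
Qed.

Lemma orthonormal_refl_prod ts v : (forall a, a \in ts -> unit_root a) ->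
  pairwise (fun a a' => dot a a' == 0) ts ->
  refl_prod ts *m v = v - \sum_(a <- ts) (2 * dot a v) *: a.
Proof.
elim: ts => [|a ts IH] tsr /=; first by rewrite big_nil refl_prod_nil mul1mx subr0.
move=> /andP[/allP ats ets]; rewrite refl_prod_cons -mulmxA IH // => [|x xts]; last first.
  by apply: tsr; rewrite in_cons xts orbT.
rewrite (reflmx_root _ (tsr a (mem_head _ _))) big_cons opprD addrA addrAC.
congr (_ - (2 * _) *: _); rewrite dotDr dotNr dot_sumr big_seq big1 ?oppr0 ?addr0 //.
by move=> x /ats/eqP ax; rewrite dotZr ax mulr0.
Qed.

End OrthonormalProduct.

(** * Simple roots, coefficients and positive roots *)

Section SimpleRoots.
Context {R : realType} {n : nat} (W : set 'M[R]_n) (alpha : n.-tuple 'cV[R]_n).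
Context (W_refl : finite_reflection_group W) (W_ess : essential W).
Context (alpha_simple : simple_roots W alpha).
Implicit Types (u v x y t : 'cV[R]_n) (g w : 'M[R]_n) (i j : 'I_n).

Local Notation unit_root := (unit_root W).
Local Notation al := (tnth alpha).

Lemma W_orth : orthogonal_group W. Proof. by case: W_refl. Qed.

Lemma simple_root i : unit_root (al i).
Proof. by have [/(_ i)] := alpha_simple. Qed.

Lemma chamber_point : exists x, (forall i, 0 < dot (al i) x) /\
  forall y, (forall i, 0 < dot (al i) y) -> forall t, unit_root t -> 0 < dot t x * dot t y.
Proof.
have [_ [x xreg E]] := alpha_simple; exists x.
have P y : (forall i, 0 < dot (al i) y) <->
    (forall t, t != 0 -> W (reflmx t) -> 0 < dot t x * dot t y).
  by have := congr1 (fun A : set _ => A y) E; rewrite /= => ->.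
split=> [|y /P yC t tr]; last by apply: yC; [exact: root_neq0 tr | exact: root_group].
by apply/P => t t0 tW; rewrite lt_def mulf_neq0 ?xreg // -expr2 sqr_ge0.
Qed.

Lemma W_fix v : (forall t, unit_root t -> dot t v = 0) -> v = 0.
Proof.
move=> tv; apply: W_ess => g gW; have [_ _ /(_ g gW)[s sW ->]] := W_refl.
elim: s sW => [|k s IH] sW; first by rewrite big_nil mul1mx.
rewrite big_cons -mulmxA IH => [|k' k's]; last by apply: sW; rewrite in_cons k's orbT.
have [t tr ->] := reflection_root (sW k (mem_head _ _)).
by rewrite (reflmx_root _ tr) tv // mulr0 scale0r subr0.
Qed.

(** If [v] were orthogonal to all simple roots but not to a root [t], moving the base point along
    [v] would stay in the chamber and reach the hyperplane of [t]. *)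
Lemma simple_inj v : (forall i, dot (al i) v = 0) -> v = 0.
Proof.
move=> alv; apply: W_fix => t tr; have [x [xC sgn]] := chamber_point.
have [//|tv0] := eqVneq (dot t v) 0.
have := sgn (x - (dot t x / dot t v) *: v) _ t tr; rewrite !dotDE.
rewrite divfK // subrr mulr0 ltxx => H; suff: false by [].
by apply: H => i; rewrite !dotDE alv mulr0 subr0.
Qed.

Definition simple_mx : 'M[R]_n := \matrix_(i, j) al i j 0.

Lemma simple_mxE v i : (simple_mx *m v) i 0 = dot (al i) v.
Proof. by rewrite mxE; apply: eq_bigr => j _; rewrite mxE. Qed.

Lemma simple_mx_unit : simple_mx \in unitmx.
Proof.
rewrite -unitmx_tr -row_free_unit; apply: inj_row_free => v vA.
apply: trmx_inj; rewrite trmx0; apply: simple_inj => i.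
by rewrite -simple_mxE -[simple_mx]trmxK -trmx_mul vA !mxE.
Qed.

(** The dual basis of the simple roots, so that [coef i t] is the coefficient of [t] on [al i]. *)
Definition omega i : 'cV[R]_n := col i (invmx simple_mx).
Definition coef i t := dot (omega i) t.

Lemma simple_omega i j : dot (al i) (omega j) = (i == j)%:R.
Proof.
rewrite -simple_mxE /omega colE mulmxA mulmxV ?simple_mx_unit // mul1mx.
by rewrite mxE eqxx andbT.
Qed.

Lemma coef_simple i j : coef i (al j) = (i == j)%:R.
Proof. by rewrite /coef dotC simple_omega eq_sym. Qed.

Lemma simple_ext u v : (forall i, dot (al i) u = dot (al i) v) -> u = v.
Proof.
move=> uv; apply/eqP; rewrite -subr_eq0; apply/eqP/simple_inj => i.
by rewrite dotDr dotNr uv subrr.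
Qed.

Lemma omega_sum v : v = \sum_i dot (al i) v *: omega i.
Proof.
apply: simple_ext => i; rewrite dot_sumr (bigD1 i) //= dotZr simple_omega eqxx mulr1.
rewrite big1 ?addr0 // => j ji; rewrite dotZr simple_omega eq_sym (negPf ji) mulr0 //.
Qed.

Lemma coef_sum t : t = \sum_i coef i t *: al i.
Proof.
apply: dot_inj => v; rewrite [v in LHS]omega_sum dot_sumr dotC dot_sumr.
by apply: eq_bigr => i _; rewrite !dotZr /coef dotC [dot v _]dotC mulrC [dot (omega i) t]dotC.
Qed.

Lemma coef_ext u v : (forall i, coef i u = coef i v) -> u = v.
Proof. by move=> uv; rewrite [u]coef_sum [v]coef_sum; apply: eq_bigr => i _; rewrite uv. Qed.

Lemma coefD i u v : coef i (u + v) = coef i u + coef i v. Proof. exact: dotDr. Qed.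
Lemma coefZ i a v : coef i (a *: v) = a * coef i v. Proof. exact: dotZr. Qed.
Lemma coefN i v : coef i (- v) = - coef i v. Proof. exact: dotNr. Qed.

Definition positive t := forall i, 0 <= coef i t.

(** Suppose a coefficient has the wrong sign with respect to the value of [t] at the base point. Far
    out along the corresponding [omega j] the chamber has points where that coefficient dominates,
    so [t] would change sign inside the chamber. *)
Lemma root_sign t : unit_root t -> positive t \/ positive (- t).
Proof.
move=> tr; have [x [xC sgn]] := chamber_point.
have pos (e : R) : 0 < e * dot t x -> forall i, 0 <= e * coef i t.
  move=> ex j; rewrite leNgt; apply/negP => cj.
  pose S := \sum_(i | i != j) e * coef i t.
  (* Chosen so that the [j]-th term is [- (|S| + 1)], which outweighs the sum [S] of the others. *)
  pose K := (`|S| + 1) / - (e * coef j t).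
  have K0 : 0 < K by rewrite divr_gt0 ?oppr_gt0 // ltr_wpDl.
  pose y := K *: omega j + \sum_(i | i != j) omega i.
  have yE i : dot (al i) y = if i == j then K else 1.
    rewrite /y dotDr dotZr simple_omega dot_sumr.
    case: eqVneq => [->|ij]; rewrite ?mulr1 ?mulr0 ?add0r.
      by rewrite big1 ?addr0 // => k kj; rewrite simple_omega eq_sym (negPf kj).
    rewrite (bigD1 i) //= simple_omega eqxx big1 ?addr0 // => k /andP[_ ki].
    by rewrite simple_omega eq_sym (negPf ki).
  have yC i : 0 < dot (al i) y by rewrite yE; case: ifP.
  have := sgn y yC t tr.
  have -> : dot t y = K * coef j t + \sum_(i | i != j) coef i t.
    rewrite /y dotDr dotZr dot_sumr /coef [dot t _]dotC; congr (_ + _).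
    by apply: eq_bigr => i _; rewrite dotC.
  have ey : e * (K * coef j t + \sum_(i | i != j) coef i t) < 0.
    have cj' : - (e * coef j t) != 0 by rewrite oppr_eq0 lt_eqF.
    have eK : e * (K * coef j t) = - (`|S| + 1).
      by rewrite mulrCA -[_ * coef j t]opprK mulrN divfK.
    by rewrite mulrDr eK mulr_sumr -/S; have := ler_norm S; lra.
  have : 0 < e * e by rewrite lt_def mulf_eq0 negb_or -expr2 sqr_ge0 andbT; case: eqVneq ex => [->|]; rewrite ?mul0r ?ltxx.
  by nra.
have [t0|t0|t0] := ltgtP (dot t x) 0.
- right => i; have := pos (-1) _ i; rewrite coefN !mulN1r oppr_gt0; exact.
- by left => i; have := pos 1 _ i; rewrite !mul1r; apply.
- by have := sgn x xC t tr; rewrite t0 mul0r ltxx.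
Qed.

Lemma positive_simple i : positive (al i).
Proof. by move=> j; rewrite coef_simple ler0n. Qed.

Lemma positive_opp t : unit_root t -> positive t -> ~ positive (- t).
Proof.
move=> /root_neq0/eqP t0 tp tn; apply: t0; apply: coef_ext => i.
apply/eqP; rewrite eq_le [coef i 0]dot0r tp andbT -oppr_ge0 -coefN; exact: tn.
Qed.

Lemma positive_coef_gt0 t : unit_root t -> positive t -> exists i, 0 < coef i t.
Proof.
move=> tr tp; have [//|nex] := pselect (exists i, 0 < coef i t).
case: (positive_opp tr tp) => i; rewrite coefN oppr_ge0 leNgt.
by apply/negP => ti; apply: nex; exists i.
Qed.

Lemma coef_reflmx i j t : coef j (reflmx (al i) *m t) =
  coef j t - (2 * dot (al i) t) * (i == j)%:R.
Proof. by rewrite (reflmx_root _ (simple_root i)) coefD coefN coefZ coef_simple eq_sym. Qed.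

Lemma positive_coefP t j : unit_root t -> 0 < coef j t -> positive t.
Proof.
move=> tr tj; have [//|/(_ j)] := root_sign tr.
by rewrite coefN; lra.
Qed.

(** Only the coefficient on [al i] changes, and a positive unit root with no other positive
    coefficient is [al i] itself. *)
Lemma positive_reflmx i t : unit_root t -> positive t -> t != al i ->
  positive (reflmx (al i) *m t).
Proof.
move=> tr tp ti; have [[j ji tj]|nex] := pselect (exists2 j, i != j & 0 < coef j t).
  apply: (@positive_coefP _ j); first exact: (root_image W_orth (root_group (simple_root i)) tr).
  by rewrite coef_reflmx (negPf ji) mulr0 subr0.
case/eqP: ti; have tE : t = coef i t *: al i.
  rewrite [t in LHS]coef_sum (bigD1 i) //= big1 ?addr0 // => j ji.
  suff -> : coef j t = 0 by rewrite scale0r.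
  apply/eqP; rewrite eq_le tp andbT leNgt; apply/negP => tj; apply: nex.
  by exists j; rewrite // eq_sym.
have := root_unit tr; rewrite {1 2}tE dotZl dotZr (root_unit (simple_root i)) mulr1.
move=> c2; have c0 := tp i; rewrite tE.
suff -> : coef i t = 1 by rewrite scale1r.
by nra.
Qed.

Lemma positive_dot x t : (forall i, 0 < dot (al i) x) -> unit_root t -> positive t ->
  0 < dot t x.
Proof.
move=> xC tr tp; have [j tj] := positive_coef_gt0 tr tp.
rewrite {1}[t]coef_sum dotC dot_sumr (bigD1 j) //= ltr_pwDl //.
  by rewrite dotZr mulr_gt0 // dotC.
by apply: sumr_ge0 => i _; rewrite dotZr mulr_ge0 // ltW // dotC.
Qed.

(** * Products of commuting simple reflections *)

Section Block.
Context (g : 'M[R]_n) (P : pred 'I_n) (gW : W g).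
Context (gE : forall v, g *m v = v - \sum_(i | P i) (2 * dot (al i) v) *: al i).
Context (P_orth : forall i j, P i -> P j -> dot (al i) (al j) = (i == j)%:R).

Lemma block_dot i v : P i -> dot (al i) (g *m v) = - dot (al i) v.
Proof.
move=> Pi; rewrite gE dotDr dotNr dot_sumr (bigD1 i) //= dotZr P_orth // eqxx mulr1.
rewrite big1 ?addr0 => [|j /andP[Pj ji]]; first by lra.
by rewrite dotZr P_orth // eq_sym (negPf ji) mulr0.
Qed.

Lemma blockK v : g *m (g *m v) = v.
Proof.
rewrite {1}gE (eq_bigr (fun i => - ((2 * dot (al i) v) *: al i))) => [|i Pi].
  by rewrite sumrN opprK gE subrK.
by rewrite block_dot // mulrN scaleNr.
Qed.

Lemma block_tr : g^T = g.
Proof.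
apply: mx_ext => v; rewrite -[v in LHS]blockK; exact: (group_trK W_orth).
Qed.

Lemma block_simple i : P i -> g *m al i = - al i.
Proof.
move=> Pi; rewrite gE (bigD1 i) //= P_orth // eqxx big1 => [|j /andP[Pj ji]].
  by rewrite addr0 mulr1 scaler_nat mulr2n opprD addrA subrr sub0r.
by rewrite P_orth // (negPf ji) mulr0 scale0r.
Qed.

Let coef_block_sum j v : coef j (\sum_(i | P i) (2 * dot (al i) v) *: al i) =
  \sum_(i | P i) (2 * dot (al i) v) * (j == i)%:R.
Proof. by rewrite /coef dot_sumr; apply: eq_bigr => i _; rewrite dotZr -/(coef j (al i)) coef_simple. Qed.

Lemma block_coef_out j v : ~~ P j -> coef j (g *m v) = coef j v.
Proof.
move=> Pj; rewrite gE coefD coefN coef_block_sum big1 ?subr0 // => i Pi.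
by case: eqVneq Pi => [<-|]; rewrite ?(negPf Pj) // mulr0.
Qed.

Lemma block_coef_in j v : P j -> coef j (g *m v) = coef j v - 2 * dot (al j) v.
Proof.
move=> Pj; rewrite gE coefD coefN coef_block_sum (bigD1 j) //= eqxx mulr1.
rewrite big1 ?addr0 // => i /andP[_ ij]; by rewrite eq_sym (negPf ij) mulr0.
Qed.

(** On roots supported in an orthonormal block, [R(al i)] negates the coefficient on [al i], which
    [positive_reflmx] forbids unless [t = al i]. *)
Lemma block_span t : unit_root t -> positive t -> (forall j, ~~ P j -> coef j t = 0) ->
  exists2 i, P i & t = al i.
Proof.
move=> tr tp tP; have [i ti] := positive_coef_gt0 tr tp.
have Pi : P i by apply: contraTT ti => /tP->; rewrite ltxx.
exists i => //; apply/eqP; apply/negPn/negP => /(positive_reflmx tr tp)/(_ i).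
rewrite coef_reflmx eqxx mulr1.
have -> : dot (al i) t = coef i t.
  rewrite {1}[t]coef_sum dot_sumr (bigD1 i) //= dotZr P_orth // eqxx mulr1.
  rewrite big1 ?addr0 // => j ji; rewrite dotZr; have [Pj|/tP->] := boolP (P j).
    by rewrite P_orth // eq_sym (negPf ji) mulr0.
  by rewrite mul0r.
by lra.
Qed.

Lemma block_coef_gt0 t : unit_root t -> positive t -> (forall i, P i -> t != al i) ->
  exists2 j, ~~ P j & 0 < coef j t.
Proof.
move=> tr tp tal; have [//|nex] := pselect (exists2 j, ~~ P j & 0 < coef j t).
have [|i Pi tE] := block_span tr tp; last by have := tal i Pi; rewrite tE eqxx.
move=> j Pj; apply/eqP; rewrite eq_le tp andbT leNgt; apply/negP => tj.
by apply: nex; exists j.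
Qed.

Lemma block_positive t : unit_root t -> positive t -> (forall i, P i -> t != al i) ->
  positive (g *m t).
Proof.
move=> tr tp /(block_coef_gt0 tr tp)[j Pj tj].
apply: (positive_coefP (j := j)); first exact: (root_image W_orth gW tr).
by rewrite block_coef_out.
Qed.

End Block.

(** * The bipartite Coxeter element and its Euler form *)

Section Bipartite.
Context (s : nat) (alpha_bip : bipartite_order alpha s).

Local Notation c := (coxeter alpha).

Let sn : (s <= n)%N. Proof. by case: alpha_bip. Qed.

Lemma sprod_take k : (k <= n)%N -> sprod alpha k = refl_prod (take k alpha).
Proof.
move=> kn; rewrite /sprod /refl_prod -(map_nth_iota0 0) ?size_tuple // big_map.
rewrite big_add1 /= -{2}[k]subn0 -/(index_iota 0 k).
apply: eq_big_nat => j /andP[_ jk]; rewrite /sroot /= modn_small //.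
exact: leq_trans jk kn.
Qed.

Definition cplus := refl_prod (take s alpha).
Definition cminus := refl_prod (drop s alpha).

Lemma sprod_cplus : sprod alpha s = cplus. Proof. by rewrite sprod_take. Qed.

Lemma coxeter_refl_prod : c = refl_prod alpha.
Proof. by rewrite /coxeter sprod_take // take_oversize // size_tuple. Qed.

Lemma coxeterE : c = cplus *m cminus.
Proof. by rewrite coxeter_refl_prod -refl_prod_cat cat_take_drop. Qed.

Let mem_root t : t \in (alpha : seq _) -> unit_root t.
Proof. by case/tnthP => i ->; exact: simple_root. Qed.

Lemma coxeter_group : W c.
Proof. by rewrite coxeter_refl_prod; apply: (refl_prod_group W_orth) => t /mem_root. Qed.

Lemma cplus_group : W cplus.
Proof. by apply: (refl_prod_group W_orth) => t /mem_take/mem_root. Qed.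

Lemma cminus_group : W cminus.
Proof. by apply: (refl_prod_group W_orth) => t /mem_drop/mem_root. Qed.

Let sum_take (V : nmodType) (F : 'cV[R]_n -> V) :
  \sum_(a <- take s alpha) F a = \sum_(i < n | (i < s)%N) F (al i).
Proof.
rewrite -(map_nth_iota0 0) ?size_tuple // big_map -{1}[s]subn0 -/(index_iota 0 s).
rewrite (big_nat_widen _ _ n) // big_mkord; apply: eq_bigr => i _.
by rewrite (tnth_nth 0).
Qed.

Let sum_drop (V : nmodType) (F : 'cV[R]_n -> V) :
  \sum_(a <- drop s alpha) F a = \sum_(i < n | (s <= i)%N) F (al i).
Proof.
rewrite -[drop s alpha](@take_oversize _ (n - s)) ?size_drop ?size_tuple //.
rewrite -(map_nth_iota 0) ?size_tuple // big_map -/(index_iota s n).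
rewrite big_geq_mkord; apply: eq_big => i; first by rewrite andTb.
by rewrite (tnth_nth 0).
Qed.

Let orth_first (i j : 'I_n) : (i < s)%N -> (j < s)%N -> dot (al i) (al j) = (i == j)%:R.
Proof. by case: alpha_bip => _ + _; apply. Qed.

Let orth_last (i j : 'I_n) : ~~ (i < s)%N -> ~~ (j < s)%N -> dot (al i) (al j) = (i == j)%:R.
Proof. by rewrite -!leqNgt; case: alpha_bip => _ _; apply. Qed.

Let nthE k (kn : (k < n)%N) : nth 0 alpha k = al (Ordinal kn).
Proof. by rewrite (tnth_nth 0). Qed.

Lemma cplusE v : cplus *m v = v - \sum_(i < n | (i < s)%N) (2 * dot (al i) v) *: al i.
Proof.
rewrite -(sum_take (fun a => (2 * dot a v) *: a)); apply: (orthonormal_refl_prod (W := W)).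
  by move=> t /mem_take/mem_root.
apply/(pairwiseP 0) => i j; rewrite !inE size_take_min size_tuple (minn_idPl sn) => i_s j_s ij.
rewrite !nth_take // !nthE; [exact: leq_trans i_s sn|exact: leq_trans j_s sn|] => i_n j_n.
by rewrite orth_first //= -val_eqE /= ltn_eqF.
Qed.

Lemma cminusE v : cminus *m v = v - \sum_(i < n | ~~ (i < s)%N) (2 * dot (al i) v) *: al i.
Proof.
under eq_bigl do rewrite -leqNgt.
rewrite -(sum_drop (fun a => (2 * dot a v) *: a)); apply: (orthonormal_refl_prod (W := W)).
  by move=> t /mem_drop/mem_root.
apply/(pairwiseP 0) => i j; rewrite !inE size_drop size_tuple => i_s j_s ij.
rewrite !nth_drop; have i_n : (s + i < n)%N by lia.
have j_n : (s + j < n)%N by lia.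
rewrite !nthE orth_last //= -?leqNgt ?leq_addr // -val_eqE /= eqn_add2l.
by rewrite ltn_eqF.
Qed.

Lemma cplusK v : cplus *m (cplus *m v) = v.
Proof. exact: blockK cplusE orth_first v. Qed.
Lemma cplus_tr : cplus^T = cplus.
Proof. exact: block_tr cplus_group cplusE orth_first. Qed.
Lemma cminus_tr : cminus^T = cminus.
Proof. exact: block_tr cminus_group cminusE orth_last. Qed.
Lemma cplus_simple (i : 'I_n) : (i < s)%N -> cplus *m al i = - al i.
Proof. exact: block_simple cplusE orth_first i. Qed.
Lemma cminus_simple (i : 'I_n) : ~~ (i < s)%N -> cminus *m al i = - al i.
Proof. exact: block_simple cminusE orth_last i. Qed.
Lemma cplus_coef (j : 'I_n) v : ~~ (j < s)%N -> coef j (cplus *m v) = coef j v.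
Proof. exact: block_coef_out cplusE j v. Qed.
Lemma cminus_coef (j : 'I_n) v : (j < s)%N -> coef j (cminus *m v) = coef j v.
Proof. by move=> js; apply: (block_coef_out cminusE); rewrite js. Qed.

Lemma coxeter_tr : c^T = cminus *m cplus.
Proof. by rewrite coxeterE trmx_mul cplus_tr cminus_tr. Qed.

Lemma cplus_coxeter : cplus *m c = cminus.
Proof. by apply: mx_ext => v; rewrite coxeterE -!mulmxA cplusK. Qed.

Lemma cplus_conj v : cplus *m (c *m v) = c^T *m (cplus *m v).
Proof. by rewrite coxeter_tr -!mulmxA cplusK mulmxA cplus_coxeter. Qed.

(** These are [rho_1, ..., rho_n] ([sprod_simple]), the positive roots that [c^-1] makes negative;
    by [bil_gam] they play the role of the indecomposable projectives. *)
Definition gam (i : 'I_n) := if (i < s)%N then al i else cplus *m al i.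

Lemma gam_root i : unit_root (gam i).
Proof.
rewrite /gam; case: ifP => _; first exact: simple_root.
exact: (root_image W_orth cplus_group (simple_root i)).
Qed.

Lemma gam_positive i : positive (gam i).
Proof.
rewrite /gam; case: ifPn => is_; first exact: positive_simple.
apply: (block_positive cplus_group cplusE orth_first) (simple_root i) (positive_simple i) _.
move=> j js; apply: contraNneq is_ => E.
have := coef_simple i i; rewrite E coef_simple eqxx; case: eqVneq js => [->|] //.
by move=> _ _ /eqP; rewrite eq_sym oner_eq0.
Qed.

Lemma coef_gam (i j : 'I_n) : ~~ (j < s)%N -> coef j (gam i) = (j == i)%:R.
Proof.
by move=> js; rewrite /gam; case: ifP => _; rewrite ?cplus_coef // coef_simple.
Qed.

Lemma coef_gam_first (i j : 'I_n) : (i < s)%N -> coef j (gam i) = (j == i)%:R.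
Proof. by move=> i_s; rewrite /gam i_s coef_simple. Qed.

Lemma coxeter_inv_gam i : c^T *m gam i =
  if (i < s)%N then - (cminus *m al i) else - al i.
Proof.
rewrite /gam coxeter_tr -mulmxA; case: ifPn => is_.
  by rewrite cplus_simple // mulmxN.
by rewrite cplusK cminus_simple.
Qed.

(** [c^-1] is [c_-] after [c_+], and the only positive roots that each factor makes negative are the
    simple roots of its own block. *)
Lemma coxeter_inversion t : unit_root t -> positive t -> ~ positive (c^T *m t) ->
  exists i, t = gam i.
Proof.
move=> tr tp ct; have [[i is_ ->]|nS1] := pselect (exists2 i : 'I_n, (i < s)%N & t = al i).
  by exists i; rewrite /gam is_.
have t1 (i : 'I_n) : (i < s)%N -> t != al i.
  by move=> i_s; apply/eqP => tE; apply: nS1; exists i.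
have cpt := block_positive cplus_group cplusE orth_first tr tp t1.
have cptr := root_image W_orth cplus_group tr.
have [[i is_ tE]|nS2] := pselect (exists2 i : 'I_n, ~~ (i < s)%N & cplus *m t = al i).
  by exists i; rewrite /gam (negPf is_) -tE cplusK.
case: ct; rewrite coxeter_tr -mulmxA.
apply: (block_positive cminus_group cminusE orth_last) cptr cpt _ => i i_s.
by apply/eqP => tE; apply: nS2; exists i.
Qed.

Lemma gam_inversion i : positive (- (c^T *m gam i)).
Proof.
rewrite coxeter_inv_gam; case: ifPn => is_; rewrite opprK; last exact: positive_simple.
apply: (block_positive cminus_group cminusE orth_last) (simple_root i) (positive_simple i) _.
move=> j js; apply: contraNneq js => E.
have := coef_simple i i; rewrite E coef_simple eqxx; case: eqVneq is_ => [->|] //.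
by move=> _ _ /eqP; rewrite eq_sym oner_eq0.
Qed.

Lemma gam_sum_eq0 (a : 'I_n -> R) : \sum_i a i *: gam i = 0 -> forall i, a i = 0.
Proof.
move=> E; have E' j : \sum_i a i * coef j (gam i) = 0.
  have E2 : coef j (\sum_i a i *: gam i) = 0 by rewrite E; exact: dot0r.
  by rewrite -[RHS]E2 [in RHS]/coef dot_sumr; apply: eq_bigr => i _; rewrite dotZr.
have a2 (j : 'I_n) : ~~ (j < s)%N -> a j = 0.
  move=> js; rewrite -[RHS](E' j) (bigD1 j) //= coef_gam // eqxx mulr1.
  by rewrite big1 ?addr0 // => i ij; rewrite coef_gam // eq_sym (negPf ij) mulr0.
move=> j; have [js|/a2//] := boolP (j < s)%N.
rewrite -[RHS](E' j) (bigD1 j) //= coef_gam_first // eqxx mulr1.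
rewrite big1 ?addr0 // => i ij; have [i_s|/a2->] := boolP (i < s)%N; last by rewrite mul0r.
by rewrite coef_gam_first // eq_sym (negPf ij) mulr0.
Qed.

(** [omega i] is fixed by every simple reflection except the one in [al i], which subtracts
    [2 al i]; the reflections to the left of that one carry [al i] to [gam i]. *)
Lemma coxeter_omega i : c *m omega i = omega i - 2 *: gam i.
Proof.
have fix_ (g : 'M[R]_n) (P : pred 'I_n) :
    (forall v, g *m v = v - \sum_(i | P i) (2 * dot (al i) v) *: al i) ->
    g *m omega i = omega i - (if P i then 2 *: al i else 0).
  move=> gE; rewrite gE; congr (_ - _); case: ifPn => Pi.
    rewrite (bigD1 i) //= simple_omega eqxx mulr1 big1 ?addr0 // => j /andP[_ ji].
    by rewrite simple_omega (negPf ji) mulr0 scale0r.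
  rewrite big1 // => j Pj; rewrite simple_omega.
  by case: eqVneq Pj => [->|]; rewrite ?(negPf Pi) // mulr0 scale0r.
rewrite coxeterE -mulmxA (fix_ _ _ cminusE) mulmxBr (fix_ _ _ cplusE) /gam.
by case: ifP => is_; rewrite /= ?mulmx0 ?subr0 // -scalemxAr.
Qed.

(** [1 - c] sends the basis [omega] to the vectors [2 gam i], which are linearly independent. *)
Lemma coxeter_fixed v : c *m v = v -> v = 0.
Proof.
move=> cv; have a0 : forall i, dot (al i) v = 0.
  apply: gam_sum_eq0; have : v - c *m v = 0 by rewrite cv subrr.
  rewrite {1 2}[v]omega_sum mulmx_sumr -sumrB => E.
  have /eqP : 2%:R *: (\sum_i dot (al i) v *: gam i) = 0.
    rewrite -[RHS]E scaler_sumr; apply: eq_bigr => i _.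
    by rewrite -scalemxAr coxeter_omega -scalerBr opprB addrCA subrr addr0 scalerA scalerA mulrC.
  by rewrite scaler_eq0 pnatr_eq0 /= => /eqP.
by rewrite [v]omega_sum big1 // => i _; rewrite a0 scale0r.
Qed.

Lemma coxeter_unit : 1%:M - c \in unitmx.
Proof.
rewrite -unitmx_tr -row_free_unit; apply: inj_row_free => v vA.
apply: trmx_inj; rewrite trmx0; apply: coxeter_fixed; apply/eqP.
rewrite eq_sym -subr_eq0 -{1}[v^T]mul1mx -mulmxBl -[1%:M - c]trmxK -trmx_mul vA trmx0 //.
Qed.

(** The factor 2 makes the form restrict to [dot] on the diagonal: [|u - c u|^2 = 2 u . (u - c u)]
    for orthogonal [c]. *)
Definition euler_mx := 2 *: invmx (1%:M - c).

Lemma euler_mxE v : euler_mx *m (v - c *m v) = 2 *: v.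
Proof.
have -> : v - c *m v = (1%:M - c) *m v by rewrite mulmxBl mul1mx.
by rewrite /euler_mx -scalemxAl mulmxA mulVmx ?coxeter_unit // mul1mx.
Qed.

Lemma coxeter_moved v : moved c v.
Proof.
exists (invmx (1%:M - c) *m v); rewrite -[X in _ = X - _]mul1mx -mulmxBl mulmxA.
by rewrite mulmxV ?coxeter_unit // mul1mx.
Qed.

Lemma euler_def v : dot (euler_mx *m v) v = dot v v.
Proof.
have [u ->] := coxeter_moved v; rewrite euler_mxE !dotDE.
by rewrite (group_dot W_orth _ _ coxeter_group) [dot (c *m u) u]dotC; lra.
Qed.

Lemma coxeter_nc : nc W euler_mx c.
Proof.
split=> [|u y _]; first exact: coxeter_group.
by rewrite /bil euler_mxE dotZl.
Qed.

(** Since [2 gam i = omega i - c (omega i)], this is the defining identity of the form; it reduces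
    signs of the form to signs of coefficients. *)
Lemma bil_gam i v : bil euler_mx (gam i) v = coef i v.
Proof.
rewrite /bil /coef; congr (dot _ v); apply: (scalerI (a := 2)); first by rewrite pnatr_eq0.
by rewrite scalemxAr -[RHS]euler_mxE coxeter_omega opprB addrCA subrr addr0.
Qed.

(** * Orbits of the Coxeter element on roots *)

Section Order.
Context (h : nat) (h_order : mx_order c h).

Definition cit q v := iter q (mulmx c) v.

Lemma citS q v : cit q.+1 v = c *m cit q v. Proof. by []. Qed.

Lemma citD q q' v : cit (q + q') v = cit q (cit q' v). Proof. exact: iterD. Qed.

Lemma cit_mulmx q v : cit q v = iter q (mulmx c) 1%:M *m v.
Proof. by elim: q => [|q IH]; [rewrite mul1mx | rewrite citS IH mulmxA]. Qed.

Lemma cit_h v : cit h v = v.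
Proof. by rewrite cit_mulmx; have [_ -> _] := h_order; rewrite mul1mx. Qed.

Lemma h_gt0 : (0 < h)%N. Proof. by case: h_order. Qed.

Lemma cit_root q v : unit_root v -> unit_root (cit q v).
Proof.
move=> vr; elim: q => //= q IH; exact: (root_image W_orth coxeter_group IH).
Qed.

(** The sum over the [c]-orbit of [t] is fixed by [c], hence zero, so the orbit leaves the positive
    roots. Going backwards from [t], the last root before it does so is made negative by [c^-1], so
    it is some [gam i]. *)
Lemma positive_cit_gam t : unit_root t -> positive t ->
  exists q i, (q < h)%N /\ t = cit q (gam i).
Proof.
move=> tr tp; have hE := h_gt0.
have [j jh nj] : exists2 j : nat, (j < h)%N & ~ positive (cit j t).
  have [//|nex] := pselect (exists2 j : nat, (j < h)%N & ~ positive (cit j t)).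
  have pj (j : nat) : (j < h)%N -> positive (cit j t).
    by move=> jh; apply: contrapT => nj; apply: nex; exists j.
  have : \sum_(0 <= j < h) cit j t = 0.
    apply: coxeter_fixed; rewrite mulmx_sumr -[in RHS](prednK hE) big_nat_recl //.
    rewrite -[in LHS](prednK hE) big_nat_recr //= -citS (prednK hE) cit_h addrC.
    by congr (_ + _).
  have [i ti] := positive_coef_gt0 tr tp.
  move=> /(congr1 (coef i)); rewrite [coef i 0]dot0r big_ltn // coefD /= => E.
  have : 0 <= coef i (\sum_(1 <= j < h) cit j t).
    rewrite /coef dot_sumr big_nat; by apply: sumr_ge0 => j /andP[_ jh]; exact: (pj j jh i).
  by lra.
(* [cit (h - k) t] is [c^-k t]; the least such [k] is not [0], because [c^h t = t] is positive. *)
pose P k := ~~ `[< positive (cit (h - k) t) >].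
have exP : exists k, P k.
  by exists (h - j)%N; rewrite /P subKn 1?ltnW //; apply/asboolPn.
case: (ex_minnP exP) => k /asboolPn nk kmin.
have kh : (k <= h)%N.
  apply: leq_trans (kmin (h - j)%N _) (leq_subr _ _).
  by rewrite /P subKn 1?ltnW //; apply/asboolPn.
case: k nk kmin kh => [|k] nk kmin kh; first by case: nk; rewrite subn0 cit_h.
have pk : positive (cit (h - k) t).
  apply: contrapT => npk; have := kmin k; rewrite /P ltnn => H.
  suff: false by []. by apply: H; apply/asboolPn.
have E : cit (h - k) t = c *m cit (h - k.+1) t by rewrite -citS -subSn.
have [|i iE] := coxeter_inversion (cit_root (h - k) tr) pk.
  by rewrite E (group_trK W_orth _ coxeter_group).
by exists k, i; split=> //; rewrite -iE -citD subnKC ?cit_h // ltnW.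
Qed.

(** * Generation by simple reflections; stabilisers of chamber points *)

Definition simple_word (l : seq 'I_n) : 'M[R]_n := refl_prod (map al l).

Lemma simple_word_cat l1 l2 : simple_word (l1 ++ l2) = simple_word l1 *m simple_word l2.
Proof. by rewrite /simple_word map_cat refl_prod_cat. Qed.

Lemma simple_word_group l : W (simple_word l).
Proof.
apply: (refl_prod_group W_orth) => _ /mapP[i _ ->]; exact: simple_root.
Qed.

Let gen g := exists l, g = simple_word l.

Let genM g g' : gen g -> gen g' -> gen (g *m g').
Proof. by move=> [l ->] [l' ->]; exists (l ++ l'); rewrite simple_word_cat. Qed.

Let gen_tr g : gen g -> gen g^T.
Proof. by move=> [l ->]; exists (rev l); rewrite /simple_word tr_refl_prod map_rev. Qed.

Let gen_simple i : gen (reflmx (al i)).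
Proof. by exists [:: i]; rewrite /simple_word refl_prod1. Qed.

Let gen_sub ts : {subset ts <= (alpha : seq _)} -> gen (refl_prod ts).
Proof.
elim: ts => [|t ts IH] sub; first by exists [::].
rewrite refl_prod_cons; apply: genM; last by apply: IH => x xts; apply: sub; rewrite in_cons xts orbT.
by have /tnthP[i ->] := sub t (mem_head _ _); exact: gen_simple.
Qed.

Let gen_image g t : W g -> gen g -> gen (reflmx t) -> gen (reflmx (g *m t)).
Proof.
by move=> gW gg gt; rewrite (reflmx_image W_orth _ gW); do !apply: genM => //; exact: gen_tr.
Qed.

(** A positive root is [c^q (gam i)], the image of a simple root under a product of simple
    reflections. *)
Let gen_root t : unit_root t -> gen (reflmx t).
Proof.
move=> tr; wlog tp : t tr / positive t => [H|].
  by have [|tn] := root_sign tr; [exact: H | rewrite -reflmxN; apply: H (root_opp tr) tn].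
have [q [i [_ ->]]] := positive_cit_gam tr tp; elim: q => [|q IH] /=.
  rewrite /gam; case: ifP => _; first exact: gen_simple.
  apply: gen_image (gen_simple i); first exact: cplus_group.
  by apply: gen_sub => x /mem_take.
apply: gen_image IH; first exact: coxeter_group.
by rewrite coxeter_refl_prod; exact: gen_sub.
Qed.

Lemma group_simple_word g : W g -> exists l, g = simple_word l.
Proof.
have [_ _ gen_W] := W_refl; move=> /gen_W[ks ksW ->].
elim: ks ksW => [|k ks IH] ksW; first by exists [::]; rewrite big_nil /simple_word refl_prod_nil.
rewrite big_cons; apply: genM; last by apply: IH => x xks; apply: ksW; rewrite in_cons xks orbT.
have [t tr ->] := reflection_root (ksW k (mem_head _ _)); exact: gen_root.
Qed.

Let word_split l t : unit_root t -> positive t -> ~ positive (simple_word l *m t) ->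
  exists l1 j l2, l = l1 ++ j :: l2 /\ simple_word l2 *m t = al j.
Proof.
move=> tr tp; elim: l => [|j l IH]; first by rewrite /simple_word refl_prod_nil mul1mx.
have [pl|/IH[l1 [j' [l2 [-> E]]]]] := pselect (positive (simple_word l *m t)); last first.
  by move=> _; exists (j :: l1), j', l2.
rewrite /simple_word /= refl_prod_cons -mulmxA -/(simple_word l) => npl.
exists [::], j, l; split=> //; apply/eqP/negPn/negP => lj; apply: npl.
apply: positive_reflmx => //; exact: (root_image W_orth (simple_word_group l) tr).
Qed.

(** Deletion argument. For the last letter [k] of a word for [g], positivity of [g (al k)] means
    that the preceding letters make [al k] negative; the letter at which this happens cancels
    against [k], which shortens the word by two. *)
Lemma positive_stable g : W g ->
  (forall t, unit_root t -> positive t -> positive (g *m t)) -> g = 1%:M.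
Proof.
move=> /group_simple_word[l ->]; have [m] := ubnP (size l).
elim: m l => // m IHm l lm gp; case/lastP: l lm gp => [|l k] lm gp.
  by rewrite /simple_word refl_prod_nil.
have kr := simple_root k; have kp := positive_simple k.
have wE : simple_word (rcons l k) = simple_word l *m reflmx (al k).
  by rewrite -cats1 simple_word_cat [simple_word [:: k]]refl_prod1.
have [|l1 [j [l2 [lE jE]]]] := word_split kr kp (l := l).
  move=> lk; have := gp _ kr kp; rewrite wE -mulmxA (root_self kr) mulmxN.
  exact: positive_opp (root_image W_orth (simple_word_group l) kr) lk.
have E : simple_word (rcons l k) = simple_word (l1 ++ l2).
  rewrite wE lE !simple_word_cat /simple_word /= refl_prod_cons -/(simple_word l2).
  rewrite -jE (reflmx_image W_orth _ (simple_word_group l2)) -!mulmxA.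
  rewrite (mulmxA (simple_word l2)^T) (group_tr_mul W_orth (simple_word_group l2)).
  by rewrite mul1mx (rootKmx kr) mulmx1.
rewrite E; apply: IHm => [|t tr tp]; last by rewrite -E; exact: gp.
by move: lm; rewrite lE size_rcons !size_cat /=; lia.
Qed.

Lemma chamber_stable g y : W g -> (forall i, 0 < dot (al i) y) -> g *m y = y -> g = 1%:M.
Proof.
move=> gW yC gy; apply: positive_stable => // t tr tp.
have gtr := root_image W_orth gW tr; have [//|gtn] := root_sign gtr.
have := positive_dot yC (root_opp gtr) gtn; have := positive_dot yC tr tp.
rewrite dotNl; have -> : dot (g *m t) y = dot t y by rewrite -{1}gy (group_dot W_orth).
by lra.
Qed.

(** Finitely many proper subspaces do not fill the fixed space: [x] is perturbed by [e u], with [e]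
    too small to meet a hyperplane already avoided. *)
Let regular_point g (ts : seq 'cV[R]_n) :
  (forall t, t \in ts -> exists2 u, g *m u = u & dot t u != 0) ->
  exists2 x, g *m x = x & forall t, t \in ts -> dot t x != 0.
Proof.
elim: ts => [|t ts IH] tsu; first by exists 0 => //; rewrite mulmx0.
have [|x gx tx] := IH; first by move=> y yts; apply: tsu; rewrite in_cons yts orbT.
have [u gu tu] := tsu t (mem_head _ _).
have [tx0|tx0] := eqVneq (dot t x) 0; last first.
  by exists x => // y; rewrite in_cons => /predU1P[->|/tx].
have [e e0 eP] : exists2 e, 0 < e & forall y, y \in ts -> e * `|dot y u| < `|dot y x|.
  elim: (ts) tx => [|y ys IHy] yx; first by exists 1.
  have [|e e0 eP] := IHy; first by move=> z zys; apply: yx; rewrite in_cons zys orbT.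
  have yx0 : 0 < `|dot y x| by rewrite normr_gt0 yx // mem_head.
  pose e' := `|dot y x| / (`|dot y u| + 1).
  have d0 : 0 < `|dot y u| + 1 by rewrite ltr_wpDl.
  have e'0 : 0 < e' by rewrite divr_gt0.
  exists (Order.min e e'); first by rewrite lt_min e0.
  move=> z; rewrite in_cons => /predU1P[->|zys]; last first.
    by apply: le_lt_trans (eP z zys); rewrite ler_wpM2r // ge_min lexx.
  apply: le_lt_trans (_ : e' * `|dot y u| < _).
    by rewrite ler_wpM2r // ge_min lexx orbT.
  by have := divfK (lt0r_neq0 d0) `|dot y x|; rewrite -/e' mulrDr mulr1 => <-; lra.
exists (x + e *: u); first by rewrite mulmxDr -scalemxAr gx gu.
move=> y; rewrite in_cons dotDr dotZr => /predU1P[->|yts].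
  by rewrite tx0 add0r mulf_neq0 // gt_eqF.
apply/eqP => E; have := eP y yts; rewrite (_ : dot y x = - (e * dot y u)); last by lra.
by rewrite normrN normrM (gtr0_norm e0) ltxx.
Qed.

(** If [M(g)] contains no root, every root has a fixed vector of [g] not orthogonal to it, so [g]
    fixes a point on no reflecting hyperplane. A conjugate of [g] then fixes a point of the chamber,
    and [chamber_stable] makes it trivial. *)
Lemma root_in_moved g : W g -> g <> 1%:M -> exists2 t, unit_root t & moved g t.
Proof.
move=> gW g1; have [//|nex] := pselect (exists2 t, unit_root t & moved g t).
case: g1; pose ts := [seq cit q (gam i) | q <- iota 0 h, i <- enum 'I_n].
have tsr t : t \in ts -> unit_root t.
  by case/allpairsP => -[q i] [_ _ ->]; exact/cit_root/gam_root.
have [|x gx tx] := @regular_point g ts.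
  move=> t /tsr tr; have [//|nu] := pselect (exists2 u, g *m u = u & dot t u != 0).
  case: nex; exists t => //; apply/(in_movedP W_orth _ gW) => u gu.
  by apply/eqP/negPn/negP => ut; apply: nu; exists u; rewrite // dotC.
have {}tx t : unit_root t -> dot t x != 0.
  move=> tr; wlog tp : t tr / positive t => [H|].
    have [tp|tn] := root_sign tr; first exact: H.
    by rewrite -oppr_eq0 -dotNl; apply: H tn; exact: root_opp.
  have [q [i [qh ->]]] := positive_cit_gam tr tp.
  by apply: tx; apply/allpairsP; exists (q, i); rewrite mem_iota mem_enum.
have [x0 [x0C _]] := chamber_point.
have [/finite_seqP[ws wsE] _ _] := W_refl.
(* The translate of [x] with the largest product with the chamber point [x0]: a simple root negative
   on it would give a reflection increasing that product. *)
have [k kW kmax] : exists2 k, W k & forall k', W k' -> dot x0 (k' *m x) <= dot x0 (k *m x).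
  have : 1%:M \in ws by have := group1 W_orth; rewrite wsE.
  rewrite wsE; case: (ws) => // w0 ws' _.
  have [k kin kmax] : exists2 k, k \in w0 :: ws' &
      forall k', k' \in w0 :: ws' -> dot x0 (k' *m x) <= dot x0 (k *m x).
    elim: ws' w0 => [|w1 ws' IH] w0.
      by exists w0; rewrite ?mem_head // => k'; rewrite mem_seq1 => /eqP->.
    have [k kin kmax] := IH w1.
    have [le|lt] := leP (dot x0 (w0 *m x)) (dot x0 (k *m x)).
      exists k; first by rewrite in_cons kin orbT.
      by move=> k'; rewrite in_cons => /predU1P[->|/kmax].
    exists w0; first exact: mem_head.
    move=> k'; rewrite in_cons => /predU1P[->//|/kmax le]; exact: le_trans le (ltW lt).
  by exists k.
have yC i : 0 < dot (al i) (k *m x).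
  rewrite lt_def; have ir := simple_root i; apply/andP; split.
    by rewrite dotC dot_adj dotC; apply: tx; exact: (root_image W_orth (group_tr W_orth kW) ir).
  have := kmax (reflmx (al i) *m k) (groupM W_orth (root_group ir) kW).
  rewrite -mulmxA (reflmx_root _ ir) !dotDE [dot x0 _]dotC; have := x0C i.
  by rewrite [dot x0 (al i)]dotC; nra.
have kgW : W (k *m g *m k^T).
  by do !apply: (groupM W_orth) => //; exact: (group_tr W_orth).
have : k *m g *m k^T = 1%:M.
  apply: chamber_stable kgW yC _.
  by rewrite -!mulmxA (group_trK W_orth _ kW) gx.
move=> E; have := congr1 (fun m => k^T *m m *m k) E.
by rewrite mulmx1 (group_tr_mul W_orth kW) !mulmxA (group_tr_mul W_orth kW) mul1mx -mulmxA (group_tr_mul W_orth kW) mulmx1.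
Qed.

Lemma simple_obtuse i j : i != j -> dot (al i) (al j) <= 0.
Proof.
move=> ij; have aij : al j != al i.
  apply/eqP => E; have := coef_simple i j; rewrite E coef_simple eqxx (negPf ij).
  by move/eqP; rewrite oner_eq0.
have := positive_reflmx (simple_root j) (positive_simple j) aij i.
by rewrite coef_reflmx coef_simple eqxx (negPf ij) mulr0n mulr1n mulr1; lra.
Qed.

(** * Strict positivity of the Perron vector *)

Section Irreducible.
Context (W_irr : irreducible_group W).

(** The weighted adjacency matrix of the Coxeter graph, with entries [2 cos (pi / m_ij)] off the
    diagonal. *)
Definition adj_simple i j : R := if i == j then 0 else - (2 * dot (al i) (al j)).

(** At an index with [p i = 0] the eigenvector equation is a vanishing sum of nonnegative terms, so
    [al i] is orthogonal to every [al j] with [p j > 0]. The span of the [al i] with [p i = 0] is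
    then invariant and proper, hence zero. *)
Lemma perron_positive : exists lam (p : 'I_n -> R),
  (forall i, 0 < p i) /\ forall i, \sum_j adj_simple i j * p j = lam * p i.
Proof.
have [n_gt0 irr] := W_irr.
have adj_sym i j : adj_simple i j = adj_simple j i by rewrite /adj_simple eq_sym dotC.
have adj_ge0 i j : 0 <= adj_simple i j.
  by rewrite /adj_simple; case: eqVneq => // /simple_obtuse; lra.
have [lam [p [p_ge0 [i0 pi0] pE]]] := perron n_gt0 adj_sym adj_ge0.
exists lam, p; split=> // k; rewrite lt_def p_ge0 andbT; apply/negP => /eqP pk.
pose X := [seq al i | i <- enum 'I_n & p i == 0].
have orth i j : p i = 0 -> p j != 0 -> dot (al j) (al i) = 0.
  move=> pi pj; have := pE i; rewrite pi mulr0 => /eqP.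
  rewrite psumr_eq0 => [/allP/(_ j (mem_index_enum _))|l _]; last by rewrite mulr_ge0.
  have ij : i != j by apply: contraNneq pj => <-; rewrite pi.
  rewrite /= mulf_eq0 (negPf pj) orbF /adj_simple (negPf ij).
  by rewrite oppr_eq0 mulf_eq0 pnatr_eq0 /= dotC => /eqP.
have Xorth j v : p j != 0 -> v \in <<X>>%VS -> dot (al j) v = 0.
  move=> pj /(@coord_span _ _ _ (in_tuple X))->; rewrite dot_sumr big1 // => l _.
  have /mapP[i] : (in_tuple X)`_l \in X by rewrite mem_nth.
  by rewrite mem_filter => /andP[/eqP pi _] ->; rewrite dotZr orth ?mulr0.
have Xmem i : p i = 0 -> al i \in <<X>>%VS.
  by move=> pi; rewrite memv_span // map_f // mem_filter pi eqxx mem_enum.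
have [|X0|XT] := irr <<X>>%VS.
- move=> g v /group_simple_word[l ->]; elim: l v => [|j l IH] v vX.
    by rewrite /simple_word refl_prod_nil mul1mx.
  rewrite /simple_word /= refl_prod_cons -mulmxA (reflmx_root _ (simple_root j)).
  have {}IH := IH v vX; have [pj|pj] := eqVneq (p j) 0.
    by rewrite memvB // memvZ // Xmem.
  by rewrite Xorth // mulr0 scale0r subr0.
- have := Xmem k pk; rewrite X0 memv0 => /eqP ak; have := root_neq0 (simple_root k).
  by rewrite ak eqxx.
- have := Xorth i0 (al i0); rewrite XT memvf (root_unit (simple_root i0)) gt_eqF //.
  by move=> /(_ isT isT)/eqP; rewrite oner_eq0.
Qed.

End Irreducible.

(** * The Perron plane and the Coxeter number *)

Section PerronPlane.
Context (n_gt0 : (0 < n)%N).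
Context (lam : R) (p : 'I_n -> R) (p_gt0 : forall i, 0 < p i).
Context (pE : forall i, \sum_j adj_simple i j * p j = lam * p i).


Definition cx t := \sum_(i < n | (i < s)%N) p i * coef i t.
Definition cy t := \sum_(i < n | ~~ (i < s)%N) p i * coef i t.

Let vx := \sum_(i < n | (i < s)%N) p i *: omega i.
Let vy := \sum_(i < n | ~~ (i < s)%N) p i *: omega i.

Lemma cxE t : cx t = dot vx t.
Proof. by rewrite dotC dot_sumr; apply: eq_bigr => i _; rewrite dotZr dotC. Qed.

Lemma cyE t : cy t = dot vy t.
Proof. by rewrite dotC dot_sumr; apply: eq_bigr => i _; rewrite dotZr dotC. Qed.

(** [adj_simple] vanishes inside a block, so the eigenvector equation at [j] involves only the other
    block. *)
Let dot_first (j : 'I_n) : ~~ (j < s)%N -> 2 * \sum_(i < n | (i < s)%N) p i * dot (al i) (al j) = - (lam * p j).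
Proof.
move=> js; rewrite -pE [in RHS](bigID (fun i : 'I_n => (i < s)%N)) /= [X in _ + X]big1 => [|i i_s]; last first.
  rewrite /adj_simple; case: (eqVneq j i) => [_|ji] /=; first by rewrite mul0r.
  by rewrite orth_last // (negPf ji) mulr0 oppr0 mul0r.
rewrite addr0 mulr_sumr -sumrN; apply: eq_bigr => i i_s; rewrite /adj_simple.
case: (eqVneq j i) js => [->|_ _]; first by rewrite i_s.
by rewrite [dot (al j) _]dotC; lra.
Qed.

Let dot_last (j : 'I_n) : (j < s)%N -> 2 * \sum_(i < n | ~~ (i < s)%N) p i * dot (al i) (al j) = - (lam * p j).
Proof.
move=> js; rewrite -pE [in RHS](bigID (fun i : 'I_n => (i < s)%N)) /= [X in X + _]big1 => [|i i_s]; last first.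
  rewrite /adj_simple; case: (eqVneq j i) => [_|ji] /=; first by rewrite mul0r.
  by rewrite orth_first // (negPf ji) mulr0 oppr0 mul0r.
rewrite add0r mulr_sumr -sumrN; apply: eq_bigr => i i_s; rewrite /adj_simple.
case: (eqVneq j i) i_s => [<-|_ _]; first by rewrite js.
by rewrite [dot (al j) _]dotC; lra.
Qed.

Lemma cx_cplus t : cx (cplus *m t) = lam * cy t - cx t.
Proof.
have E : 2 * \sum_(i < n | (i < s)%N) p i * dot (al i) t = 2 * cx t - lam * cy t.
  rewrite {1}[t]coef_sum.
  under eq_bigr do rewrite dot_sumr mulr_sumr.
  rewrite exchange_big /= mulr_sumr (bigID (fun i : 'I_n => (i < s)%N)) /=.
  rewrite /cx /cy !mulr_sumr -sumrN; congr (_ + _); apply: eq_bigr => j js.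
    rewrite (bigD1 j) //= dotZr orth_first // eqxx big1 ?addr0 => [|i /andP[i_s ij]].
      by rewrite mulr1.
    by rewrite dotZr orth_first // (negPf ij) !mulr0.
  have <- : 2 * \sum_(i < n | (i < s)%N) p i * dot (al i) (al j) * coef j t = - (lam * (p j * coef j t)).
    by rewrite -mulr_suml mulrA dot_first //; lra.
  by congr (2 * _); apply: eq_bigr => i _; rewrite dotZr; lra.
rewrite /cx; under eq_bigr => i i_s do rewrite (block_coef_in cplusE) // mulrBr mulrCA.
rewrite sumrB -mulr_sumr E /cx; lra.
Qed.

Lemma cy_cplus t : cy (cplus *m t) = cy t.
Proof. by apply: eq_bigr => i i_s; rewrite cplus_coef. Qed.

Lemma cy_cminus t : cy (cminus *m t) = lam * cx t - cy t.
Proof.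
have E : 2 * \sum_(i < n | ~~ (i < s)%N) p i * dot (al i) t = 2 * cy t - lam * cx t.
  rewrite {1}[t]coef_sum.
  under eq_bigr do rewrite dot_sumr mulr_sumr.
  rewrite exchange_big /= mulr_sumr (bigID (fun i : 'I_n => (i < s)%N)) /= addrC.
  rewrite /cx /cy !mulr_sumr -sumrN; congr (_ + _); apply: eq_bigr => j js.
    rewrite (bigD1 j) //= dotZr orth_last // eqxx big1 ?addr0 => [|i /andP[i_s ij]].
      by rewrite mulr1.
    by rewrite dotZr orth_last // (negPf ij) !mulr0.
  have <- : 2 * \sum_(i < n | ~~ (i < s)%N) p i * dot (al i) (al j) * coef j t = - (lam * (p j * coef j t)).
    by rewrite -mulr_suml mulrA dot_last //; lra.
  by congr (2 * _); apply: eq_bigr => i _; rewrite dotZr; lra.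
rewrite /cy; under eq_bigr => i i_s do rewrite (block_coef_in cminusE) // mulrBr mulrCA.
rewrite sumrB -mulr_sumr E /cy; lra.
Qed.

Lemma cx_cminus t : cx (cminus *m t) = cx t.
Proof. by apply: eq_bigr => i i_s; rewrite cminus_coef. Qed.

(* [cheb k] is U_(k-1)(lam / 2), which is sin(k pi / h) / sin(pi / h) for the Perron
   eigenvalue lam = 2 cos(pi / h). *)
Fixpoint cheb k : R :=
  if k is k1.+1 then if k1 is k2.+1 then lam * cheb k1 - cheb k2 else 1 else 0.

Arguments cheb : simpl never.

Lemma cheb0 : cheb 0 = 0. Proof. by []. Qed.
Lemma cheb1 : cheb 1 = 1. Proof. by []. Qed.
Lemma chebSS k : cheb k.+2 = lam * cheb k.+1 - cheb k. Proof. by []. Qed.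

(* Each [gam i] has the direction of its block in the Perron plane, where [c] is a
   rotation by two steps. *)
Definition kap q i := (2 * q + (s <= i))%N.

Lemma cit_coord q i : cx (cit q (gam i)) = p i * cheb (kap q i).+1 /\
  cy (cit q (gam i)) = p i * cheb (kap q i).
Proof.
elim: q => [|q [IHx IHy]].
  have xal (b0 : bool) : (if b0 then cx (al i) else cy (al i)) = if b0 == (i < s)%N then p i else 0.
    case: b0; rewrite /cx /cy.
      case: ifPn => [/eqP/esym is_|is_].
        rewrite (bigD1 i) //= coef_simple eqxx mulr1 big1 ?addr0 // => j /andP[_ ji].
        by rewrite coef_simple (negPf ji) mulr0.
      rewrite big1 // => j js; rewrite coef_simple; case: eqVneq js => [-> js|]; last by rewrite mulr0.
      by rewrite js in is_.
    case: ifPn => [/eqP/esym is_|is_].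
      rewrite (bigD1 i) ?is_ //= coef_simple eqxx mulr1 big1 ?addr0 // => j /andP[_ ji].
      by rewrite coef_simple (negPf ji) mulr0.
    rewrite big1 // => j js; rewrite coef_simple; case: eqVneq js => [-> js|]; last by rewrite mulr0.
    by rewrite (negPf js) in is_.
  have xi : cx (al i) = if (i < s)%N then p i else 0 := xal true.
  have yi : cy (al i) = if (i < s)%N then 0 else p i.
    by rewrite (xal false); case: (i < s)%N.
  rewrite /cit /= /kap /gam muln0 add0n [(s <= i)%N]leqNgt; case: (i < s)%N xi yi => xi yi.
    by rewrite xi yi cheb0 cheb1 mulr1 mulr0.
  by rewrite cx_cplus cy_cplus xi yi chebSS cheb0 cheb1; split; lra.
have -> : kap q.+1 i = (kap q i).+2 by rewrite /kap; lia.
rewrite citS coxeterE -mulmxA cx_cplus cy_cplus cy_cminus cx_cminus IHx IHy.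
by rewrite !chebSS; split; lra.
Qed.

Lemma positive_coord t : unit_root t -> positive t ->
  [/\ 0 <= cx t, 0 <= cy t & 0 < cx t + cy t].
Proof.
move=> tr tp.
have term i : 0 <= p i * coef i t by rewrite mulr_ge0 ?tp // ltW.
split; [by apply: sumr_ge0 | by apply: sumr_ge0 |].
have [i ti] := positive_coef_gt0 tr tp; have pi : 0 < p i * coef i t by rewrite mulr_gt0.
have [is_|is_] := boolP (i < s)%N.
  rewrite ltr_pwDl //; last by apply: sumr_ge0.
  by rewrite /cx (bigD1 i) //= ltr_pwDl //; apply: sumr_ge0.
rewrite ltr_wpDl //; first by apply: sumr_ge0.
by rewrite /cy (bigD1 i) //= ltr_pwDl //; apply: sumr_ge0.
Qed.

Lemma cxN t : cx (- t) = - cx t. Proof. by rewrite !cxE dotNr. Qed.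
Lemma cyN t : cy (- t) = - cy t. Proof. by rewrite !cyE dotNr. Qed.

Lemma coord_positive t : unit_root t -> 0 < cx t + cy t -> positive t.
Proof.
move=> tr t0; have [//|tn] := root_sign tr.
by have [_ _] := positive_coord (root_opp tr) tn; rewrite cxN cyN; lra.
Qed.

(** Invariant of the recursion, equivalently [cheb (k+1)^2 - cheb k cheb (k+2) = 1]; it fixes the
    neighbours of a zero up to sign. *)
Let cheb_norm k : cheb k.+1 ^+ 2 - lam * cheb k * cheb k.+1 + cheb k ^+ 2 = 1.
Proof.
elim: k => [|k IH]; first by rewrite cheb0 cheb1; lra.
by rewrite -[RHS]IH chebSS; lra.
Qed.

(** If one block is empty, the other is orthonormal and [lam = 0]; otherwise levels of both parities
    occur. *)
Let kap_exists (b0 : bool) : lam = 0 \/ exists i, (s <= i)%N = b0.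
Proof.
have [?|nex] := pselect (exists i, (s <= i)%N = b0); [by right | left].
have sE i : (s <= i)%N = ~~ b0.
  have [/eqP E|] := boolP ((s <= i)%N == b0); first by case: nex; exists i.
  by case: (s <= i)%N; case: (b0).
pose i0 := Ordinal n_gt0; have := pE i0; rewrite big1 => [/esym/eqP|j _].
  by rewrite mulf_eq0 => /orP[/eqP //|]; rewrite gt_eqF.
rewrite /adj_simple; case: (eqVneq i0 j) => [_|ij] /=; first by rewrite mul0r.
have -> : dot (al i0) (al j) = 0; last by rewrite mulr0 oppr0 mul0r.
have [h1|h1] := boolP (s <= i0)%N.
  by rewrite orth_last -?leqNgt ?(negPf ij) // sE -(sE i0).
by rewrite orth_first ?(negPf ij) // ltnNge // sE -(sE i0).
Qed.

(** Consecutive values are, up to a positive factor, the two coordinates of a root, which cannot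
    have opposite signs. *)
Let cheb_mul_ge0 k : 0 <= cheb k * cheb k.+1.
Proof.
have [lam0|[i iE]] := kap_exists (odd k).
  suff -> : cheb k * cheb k.+1 = 0 by [].
  elim: k => [|k IH]; first by rewrite cheb0 mul0r.
  by rewrite chebSS lam0 mul0r sub0r mulrN mulrC IH oppr0.
have kE : kap k./2 i = k by rewrite /kap iE mul2n addnC odd_double_half.
have [] := cit_coord k./2 i; rewrite kE.
have tr := cit_root k./2 (gam_root i); set t := cit _ _ in tr * => xE yE.
have pi := p_gt0 i; have pp : 0 < p i * p i by rewrite mulr_gt0.
rewrite -(pmulr_rge0 _ pp).
have -> : p i * p i * (cheb k * cheb k.+1) = cx t * cy t by rewrite xE yE; lra.
have [tp|tn] := root_sign tr.
  by have [? ? _] := positive_coord tr tp; rewrite mulr_ge0.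
have [] := positive_coord (root_opp tr) tn; rewrite cxN cyN => ? ? _.
by rewrite -mulrNN mulr_ge0.
Qed.

Let cheb_h2 : cheb (2 * h) = 0 /\ cheb (2 * h).+1 = 1.
Proof.
pose i := Ordinal n_gt0; have [xh yh] := cit_coord h i; have [x0 y0] := cit_coord 0 i.
have pi : p i != 0 by rewrite gt_eqF.
have := xh; rewrite cit_h x0 => /(mulfI pi); have := yh; rewrite cit_h y0 => /(mulfI pi).
rewrite /kap muln0 add0n; case: (s <= i)%N; rewrite ?addn0 // addn1.
rewrite !chebSS cheb1 cheb0 => <- E; split=> //; lra.
Qed.

(** Before its first zero [m] the sequence stays positive, as neighbours cannot have opposite signs.
    At [m] the invariant gives [cheb (m - 1) = 1], hence [cheb (m + 1) = - 1]. *)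
Let cheb_zero : exists m, [/\ (1 < m)%N, cheb m = 0, cheb m.+1 = -1 &
  forall k, (0 < k < m)%N -> 0 < cheb k].
Proof.
have ex_m : exists m, (0 < m)%N && (cheb m == 0).
  by exists (2 * h)%N; have [-> _] := cheb_h2; rewrite muln_gt0 h_gt0 eqxx.
case: (ex_minnP ex_m) => m /andP[m0 /eqP mz] mmin; exists m.
have pos k : (0 < k < m)%N -> 0 < cheb k.
  elim: k => // k IH /andP[_ km]; have [->|k0] := posnP k; first by rewrite cheb1 ltr01.
  have {}IH : 0 < cheb k by apply: IH; rewrite k0 ltnW.
  have := cheb_mul_ge0 k; rewrite (pmulr_rge0 _ IH) le_eqVlt => /predU1P[/esym/eqP E|//].
  by have := mmin k.+1; rewrite E => /(_ isT); rewrite leqNgt km.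
have m1 : (1 < m)%N.
  by case: (m) m0 mz => [|[|]] // _; rewrite cheb1 => /eqP; rewrite oner_eq0.
split=> //; case: (m) m1 mz pos => [|[|k]] // _ mz pos.
have := pos k.+1 (ltnSn _); rewrite chebSS mz => kp.
have := cheb_norm k.+1; rewrite mz => E.
have : (cheb k.+1 - 1) * (cheb k.+1 + 1) = 0 by lra.
by move/eqP; rewrite mulf_eq0 => /orP[] /eqP; lra.
Qed.

Let cheb_add m k : cheb m = 0 -> cheb m.+1 = -1 -> cheb (m + k) = - cheb k.
Proof.
move=> m0 m1; suff: cheb (m + k) = - cheb k /\ cheb (m + k).+1 = - cheb k.+1 by case.
elim: k => [|k [IH1 IH2]]; first by rewrite addn0 m0 m1 cheb0 cheb1 oppr0.
by rewrite addnS; split=> //; rewrite !chebSS IH1 IH2; lra.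
Qed.

(** [h] is the first zero [m]. [c^m] preserves the coordinates of all roots, so it fixes [vx + vy],
    which lies in the chamber because [p] is positive; thus [c^m = 1] and [h <= m]. Conversely [2 m]
    divides [2 h], as the sequence changes sign after [m] steps and is back after [2 h]. *)
Lemma h_cheb : [/\ (1 < h)%N, cheb h = 0, cheb h.+1 = -1 &
  forall k, (0 < k < h)%N -> 0 < cheb k].
Proof.
have [m [m1 mz mz1 mpos]] := cheb_zero; suff -> : h = m by [].
have madd k := cheb_add k mz mz1.
have mper k : cheb (2 * m + k) = cheb k.
  by rewrite mul2n -addnn -addnA !madd opprK.
apply/eqP; rewrite eqn_leq; apply/andP; split.
  have [_ _ hmin] := h_order; rewrite leqNgt; apply/negP => hm.
  apply: (hmin m); first by rewrite hm (ltn_trans _ m1).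
  have xC i : dot (al i) (vx + vy) = p i.
    rewrite dotC !dotDE -cxE -cyE /cx /cy.
    under eq_bigr do rewrite coef_simple; under [X in _ + X]eq_bigr do rewrite coef_simple.
    rewrite -(bigID (fun i : 'I_n => (i < s)%N) predT (fun j => p j * (j == i)%:R)) /=.
    rewrite (bigD1 i) //= eqxx mulr1 big1 ?addr0 // => j ji.
    by rewrite (negPf ji) mulr0.
  pose g := iter m (mulmx c) 1%:M.
  have gW : W g.
    rewrite /g; elim: (m) => [|k IH] /=; first exact: (group1 W_orth).
    exact: (groupM W_orth coxeter_group IH).
  apply: (@chamber_stable _ (vx + vy) gW) => [i|]; first by rewrite xC.
  have gx : g^T *m (vx + vy) = vx + vy.
    apply: simple_ext => i; rewrite dotC dot_adj trmxK -[g *m _]cit_mulmx [RHS]dotC.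
    have [q [j [_ ->]]] := positive_cit_gam (simple_root i) (positive_simple i).
    rewrite -citD !dotDE -!cxE -!cyE.
    have [-> ->] := cit_coord (m + q) j; have [-> ->] := cit_coord q j.
    have -> : kap (m + q) j = (2 * m + kap q j)%N by rewrite /kap mulnDr addnA.
    by rewrite -addnS !mper.
  by rewrite -{1}gx; exact: (group_Ktr W_orth).
have [hz hz1] := cheb_h2.
have per a k : cheb (2 * m * a + k) = cheb k.
  elim: a => [|a IH]; first by rewrite muln0.
  by rewrite mulnS -addnA mper.
(* The remainder [r] has [cheb r = 0] and [cheb (r + 1) = 1], which below [2 m] happens only at
   [0]. *)
have E := divn_eq (2 * h) (2 * m); have m2 : (0 < 2 * m)%N by lia.
have r2m : ((2 * h) %% (2 * m) < 2 * m)%N by rewrite ltn_pmod.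
move: E r2m; rewrite [(_ %/ _ * _)%N]mulnC; set q := (_ %/ _)%N; set r := (_ %% _)%N => E rm.
have rz : cheb r = 0 by rewrite -[RHS]hz E per.
have rz1 : cheb r.+1 = 1 by rewrite -[RHS]hz1 E -addnS per.
have r0 : r = 0%N.
  have [//|r0] := posnP r; have [rm1|rm1] := ltnP r m.
    by have := mpos r; rewrite r0 rm1 rz ltxx => /(_ isT).
  have [rE|rE] := eqVneq r m; first by move: rz1; rewrite rE mz1 => /eqP; rewrite eqNr oner_eq0.
  have E1 : cheb (r - m)%N = 0 by apply: oppr_inj; rewrite -madd subnKC // rz oppr0.
  have : 0 < cheb (r - m)%N by apply: mpos; lia.
  by rewrite E1 ltxx.
have h0 := h_gt0; move: E; rewrite r0 addn0; case: q => [|q]; first by lia.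
by rewrite mulnS; lia.
Qed.

Lemma cheb_hadd k : cheb (h + k) = - cheb k.
Proof. by have [_ hz hz1 _] := h_cheb; exact: cheb_add. Qed.

Lemma cit_positive q i : (kap q i < h)%N -> positive (cit q (gam i)).
Proof.
move=> kh; apply: coord_positive; first exact: cit_root (gam_root i).
have [_ hz _ pos] := h_cheb.
have [-> ->] := cit_coord q i; rewrite -mulrDr mulr_gt0 //.
have [->|k0] := posnP (kap q i); first by rewrite cheb0 cheb1 addr0 ltr01.
rewrite ltr_wpDl ?pos ?k0 //; have [kE|kh'] := eqVneq (kap q i).+1 h; first by rewrite kE hz.
by rewrite ltW // pos //= ltn_neqAle kh' kh.
Qed.

Lemma cit_opp_positive q i : (h <= kap q i)%N -> (q < h)%N -> positive (- cit q (gam i)).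
Proof.
move=> hk qh; have [_ hz _ pos] := h_cheb.
apply: coord_positive; first exact: root_opp (cit_root _ (gam_root i)).
rewrite cxN cyN; have [-> ->] := cit_coord q i; rewrite -opprD -mulrDr -mulrN mulr_gt0 //.
have kE : kap q i = (h + (kap q i - h))%N by rewrite subnKC.
have : (kap q i - h < h)%N by rewrite /kap; case: (s <= i)%N; lia.
move=> klt; rewrite kE -addnS !cheb_hadd -opprD opprK.
move: (kap q i - h)%N klt => k kh.
have [->|k0] := posnP k; first by rewrite cheb0 cheb1 addr0 ltr01.
rewrite ltr_wpDl ?pos ?k0 //; have [kE'|kh'] := eqVneq k.+1 h; first by rewrite kE' hz.
by rewrite ltW // pos //= ltn_neqAle kh' kh.
Qed.

Lemma positive_cit q i : (q < h)%N -> positive (cit q (gam i)) <-> (kap q i < h)%N.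
Proof.
move=> qh; split=> [tp|]; last exact: cit_positive.
rewrite ltnNge; apply/negP => hk; have := cit_opp_positive hk qh.
exact: positive_opp (cit_root _ (gam_root i)) tp.
Qed.

(** * The sequence of the roots rho_i *)

Definition ord_mod k : 'I_n := Ordinal (ltn_pmod k n_gt0).
(** Zero-based: this is [rho_(k+1)], and [k %/ n] counts the applications of [c]. *)
Definition rho_cit k := cit (k %/ n) (gam (ord_mod k)).

Let mem_nth_take (m k : nat) t : t \in drop m (take k alpha) ->
  exists j : 'I_n, [/\ (m <= j)%N, (j < k)%N & t = al j].
Proof.
case/(nthP 0) => j; rewrite size_drop size_take_min size_tuple => jlt <-.
rewrite nth_drop nth_take; last by lia.
have jn : (m + j < n)%N by lia.
by exists (Ordinal jn); rewrite -nthE; split=> //=; lia.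
Qed.

Lemma sprod_simple i : sprod alpha i *m al i = gam i.
Proof.
rewrite sprod_take ?(ltnW (ltn_ord i)) // /gam; case: ltnP => is_.
  rewrite refl_prod_fix // => a; rewrite -[take i alpha]drop0 => /mem_nth_take[j [_ ji ->]].
  by rewrite orth_first ?(ltn_trans ji) // -val_eqE /= ltn_eqF.
rewrite -(cat_take_drop s (take i alpha)) take_takel // refl_prod_cat -mulmxA.
rewrite [refl_prod (drop _ _) *m _]refl_prod_fix // => a /mem_nth_take[j [sj ji ->]].
by rewrite orth_last -?leqNgt // -val_eqE /= ltn_eqF.
Qed.

Let sprod_addn k : sprod alpha (n + k) = c *m sprod alpha k.
Proof.
have sE m : sprod alpha m = refl_prod (map (sroot alpha) (iota 1 m)).
  by rewrite /refl_prod big_map /sprod /index_iota subn1.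
rewrite /coxeter !sE iotaD map_cat refl_prod_cat addnC; congr (_ *m refl_prod _).
rewrite iotaDl -map_comp; apply/eq_in_map => j; rewrite mem_iota => /andP[j0 _] /=.
by rewrite /sroot -(prednK j0) addnS /= modnDl.
Qed.

Lemma rho_nat_cit k : rho_nat alpha k.+1 = rho_cit k.
Proof.
rewrite /rho_nat /rho_cit /= /sroot /= -(sprod_simple (ord_mod k)) -nthE /=.
rewrite {1}(divn_eq k n); elim: (k %/ n)%N => [|q IH] //.
by rewrite mulSn -addnA sprod_addn -mulmxA IH.
Qed.

Let coord_first_eq0 t i : positive t -> cx t = 0 -> (i < s)%N -> coef i t = 0.
Proof.
move=> tp /eqP; rewrite psumr_eq0 => [/allP/(_ i (mem_index_enum _))/implyP H i_s|j _].
  by have := H i_s; rewrite mulf_eq0 gt_eqF // => /eqP.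
by rewrite mulr_ge0 ?tp // ltW.
Qed.

Let coord_last_eq0 t i : positive t -> cy t = 0 -> ~~ (i < s)%N -> coef i t = 0.
Proof.
move=> tp /eqP; rewrite psumr_eq0 => [/allP/(_ i (mem_index_enum _))/implyP H i_s|j _].
  by have := H i_s; rewrite mulf_eq0 gt_eqF // => /eqP.
by rewrite mulr_ge0 ?tp // ltW.
Qed.

(** At level [h - 1] the coordinate [cx] vanishes, so the root is supported on the second block and
    is simple by [block_span]. *)
Lemma cit_level_pred q i : (kap q i).+1 = h ->
  exists2 j : 'I_n, ~~ (j < s)%N & cit q (gam i) = al j.
Proof.
move=> kh; have tr := cit_root q (gam_root i); have [_ hz _ _] := h_cheb.
have tp : positive (cit q (gam i)) by apply: cit_positive; rewrite -kh.
apply: (@block_span (fun j : 'I_n => ~~ (j < s)%N) orth_last _ tr tp) => j; rewrite negbK; apply: coord_first_eq0 => //.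
by have [-> _] := cit_coord q i; rewrite kh hz mulr0.
Qed.

Lemma cit_level q i : kap q i = h -> exists2 j : 'I_n, (j < s)%N & cit q (gam i) = - al j.
Proof.
move=> kh; have tr := root_opp (cit_root q (gam_root i)); have [h1 hz _ _] := h_cheb.
have tp : positive (- cit q (gam i)).
  by apply: cit_opp_positive; [rewrite kh | move: kh h1; rewrite /kap; lia].
have [j js|j js jE] := @block_span (fun j : 'I_n => (j < s)%N) orth_first _ tr tp; last first.
  by exists j; rewrite // -jE opprK.
apply: coord_last_eq0 => //; rewrite cyN; have [_ ->] := cit_coord q i.
by rewrite kh hz mulr0 oppr0.
Qed.

Lemma cit_inj q u v : cit q u = cit q v -> u = v.
Proof.
elim: q => //= q IH E; apply: IH; rewrite -(group_trK W_orth (cit q u) coxeter_group) E.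
exact: (group_trK W_orth _ coxeter_group).
Qed.

Lemma gam_inj : injective gam.
Proof.
move=> i j E; have one_neq0 (b0 : bool) : (b0%:R : R) = 1 -> b0.
  by case: b0 => // /eqP; rewrite eq_sym oner_eq0.
have [js|js] := boolP (j < s)%N; last first.
  by apply/esym/eqP/one_neq0; rewrite -(coef_gam i js) E coef_gam // eqxx.
have [i_s|i_s] := boolP (i < s)%N; last first.
  by apply/eqP/one_neq0; rewrite -(coef_gam j i_s) -E coef_gam // eqxx.
by apply/eqP/one_neq0; rewrite -(coef_gam_first i js) -E coef_gam_first // eqxx.
Qed.

Let card_leq (P Q : {pred 'I_n}) q (e : R) :
  (forall i, i \in P -> exists2 j, j \in Q & cit q (gam i) = e *: al j) -> (#|P| <= #|Q|)%N.
Proof.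
move=> PQ; pose f i := odflt i [pick j | (j \in Q) && (cit q (gam i) == e *: al j)].
have fP i : i \in P -> f i \in Q /\ cit q (gam i) = e *: al (f i).
  move=> /PQ[j jQ jE]; rewrite /f; case: pickP => [j' /andP[j'Q /eqP] //|/(_ j)].
  by rewrite jQ jE eqxx.
rewrite -(card_in_image (f := f) (A := P)) => [|i i' iP i'P E].
  by apply: subset_leq_card; apply/fintype.subsetP => y /fintype.imageP[i iP ->]; have [] := fP i iP.
apply: gam_inj; apply: (@cit_inj q).
by have [_ ->] := fP i iP; have [_ ->] := fP i' i'P; rewrite E.
Qed.

(** For odd [h], [c^((h-1)/2)] injects the [gam i] of the first block into the simple roots of the
    second, and those of the second into the negatives of the first. *)
Lemma odd_half : odd h -> n = (2 * s)%N.
Proof.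
move=> oh; have hE : h = (2 * h./2).+1 by rewrite mul2n -{1}[h]odd_double_half oh.
have cs : #|[pred i : 'I_n | (i < s)%N]| = s.
  by rewrite -sum1_card -(big_ord_widen _ (fun=> 1%N)) // sum1_card card_ord.
have := cardC [pred i : 'I_n | (i < s)%N]; rewrite cs card_ord.
set m := #|_| => nE.
have H1 : (s <= m)%N.
  rewrite -{1}cs; apply: (card_leq (q := h./2) (e := 1)) => i; rewrite inE => i_s.
  have [|j js ->] := @cit_level_pred h./2 i; last by exists j; rewrite ?scale1r.
  by rewrite /kap leqNgt i_s addn0 -hE.
suff H2 : (m <= s)%N by lia.
rewrite -cs; apply: (card_leq (q := h./2) (e := -1)) => i; rewrite !inE => i_s.
have [|j js ->] := @cit_level h./2 i; last by exists j; rewrite ?scaleN1r.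
by rewrite /kap leqNgt (negPf i_s) addn1 -hE.
Qed.

Local Notation half := (n * h)./2.

Let half_even : ~~ odd h -> half = (h./2 * n)%N.
Proof.
move=> eh; rewrite -{1}[h]odd_double_half (negPf eh) add0n -doubleMr doubleK.
by rewrite mulnC.
Qed.

Let half_odd : odd h -> half = (h./2 * n + s)%N.
Proof.
move=> oh; rewrite -{1}[h]odd_double_half oh {1}odd_half //.
by rewrite mul2n -doubleMl doubleK add1n mulnS -doubleMr doubleMl -mul2n -odd_half // mulnC addnC.
Qed.

(** For even [h] the level reaches [h] after [h / 2] full turns; for odd [h] it does so halfway
    through a turn, between the two blocks, and [n = 2 s] makes that position [n h / 2]. *)
Lemma level_half k : (kap (k %/ n) (ord_mod k) < h)%N = (k < half)%N.
Proof.
rewrite /kap /=; have kE := divn_eq k n; have rn := ltn_pmod k n_gt0.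
have hE := odd_double_half h; case: (boolP (odd h)) hE => oh hE.
  rewrite half_odd // [in RHS]kE; move: (k %/ n)%N (k %% n)%N rn => q r rn.
  move: (h./2) hE => a <-; rewrite -muln2.
  have sn' := sn; have [qa|qa|->] := ltngtP q a.
  - have : (q.+1 * n <= a * n)%N by rewrite leq_mul2r qa orbT.
    by rewrite mulSn; case: (s <= r)%N; lia.
  - have : (a.+1 * n <= q * n)%N by rewrite leq_mul2r qa orbT.
    by rewrite mulSn; case: (s <= r)%N; lia.
  - by rewrite ltn_add2l ltnNge; case: leqP; lia.
rewrite half_even // -ltn_divLR //; move: (h./2) hE => a <-; rewrite -muln2; case: (s <= _)%N; lia.
Qed.

Lemma level_tail k : (k < s)%N -> kap ((half + k) %/ n) (ord_mod (half + k)) = h.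
Proof.
move=> ks; rewrite /kap /=; have hE := odd_double_half h; have sn' := sn.
case: (boolP (odd h)) hE => oh hE.
  have n2 := odd_half oh; rewrite half_odd // -addnA divnMDl // modnMDl.
  by rewrite divn_small ?modn_small; lia.
by rewrite half_even // divnMDl // modnMDl divn_small ?modn_small; lia.
Qed.

Lemma half_leq : (half + n <= n * h)%N.
Proof.
have [h1 _ _ _] := h_cheb; have : (n * 2 <= n * h)%N by rewrite leq_mul2l h1 orbT.
by have := odd_double_half (n * h); lia.
Qed.

Lemma cit_half k : (k < half)%N -> positive (rho_cit k).
Proof. by rewrite -level_half => /cit_positive. Qed.

Lemma cit_half_opp k : (half <= k)%N -> (k < n * h)%N -> positive (- rho_cit k).
Proof.
move=> hk kh; apply: cit_opp_positive; first by rewrite leqNgt level_half -leqNgt.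
by rewrite ltn_divLR // mulnC.
Qed.

Lemma rho_cit_root k : unit_root (rho_cit k).
Proof. exact: cit_root (gam_root _). Qed.

Let rho_nonneg k (z : int) : (k < n * h)%N -> z - 1 = k%:Z -> rho alpha h z = rho_cit k.
Proof.
by move=> kh zE; rewrite /rho zE modz_small ?lez_nat ?ltz_nat //= rho_nat_cit.
Qed.

Let rho_neg k (z : int) : (k < n * h)%N -> z - 1 = k%:Z - (n * h)%:Z ->
  rho alpha h z = rho_cit k.
Proof.
move=> kh zE; rewrite /rho zE -modzDr subrK modz_small ?lez_nat ?ltz_nat //=.
exact: rho_nat_cit.
Qed.

Lemma pos_rootsE : pos_roots alpha h = [seq rho_cit k | k <- iota 0 half].
Proof.
rewrite /pos_roots (iotaDl 1 0) -map_comp; apply/eq_in_map => k.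
rewrite mem_iota /= => kh; apply: rho_nonneg; last by lia.
by have := half_leq; lia.
Qed.

Lemma AX_verticesE :
  AX_vertices alpha h = pos_roots alpha h ++ [seq rho_cit k | k <- iota half n].
Proof.
rewrite pos_rootsE -map_cat -{2}[half]add0n -iotaD /AX_vertices (iotaDl 1 0) -map_comp.
apply/eq_in_map => k; rewrite mem_iota /= => kh; apply: rho_nonneg; last by lia.
by have := half_leq; lia.
Qed.

Lemma EX_verticesE : EX_vertices alpha s h =
  [seq rho_cit k | k <- iota (n * h - n + s) (n - s)] ++ pos_roots alpha h ++
  [seq rho_cit k | k <- iota half s].
Proof.
have := half_leq; have sn' := sn; move=> hl.
rewrite pos_rootsE -map_cat -{2}[half]add0n -iotaD /EX_vertices (iotaDl 1 0) -map_comp.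
have -> : (half + n = (n - s) + (half + s))%N by lia.
rewrite [iota 0 _]iotaD map_cat; congr (_ ++ _).
  rewrite -[(n * h - n + s)%N in RHS]addn0 iotaDl -map_comp.
  apply/eq_in_map => k; rewrite mem_iota /= => kh; apply: rho_neg; last by lia.
  by lia.
rewrite add0n -{1}[(n - s)%N]addn0 iotaDl -map_comp.
apply/eq_in_map => k; rewrite mem_iota /= => kh; apply: rho_nonneg; last by lia.
by lia.
Qed.

Lemma pos_rootsP t : t \in pos_roots alpha h <-> unit_root t /\ positive t.
Proof.
rewrite pos_rootsE; split=> [/mapP[k]|[tr tp]].
  rewrite mem_iota /= => kh ->; split; [exact: rho_cit_root | exact: cit_half].
have [q [i [qh tE]]] := positive_cit_gam tr tp; rewrite tE in tp *.
have E : rho_cit (q * n + i) = cit q (gam i).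
  rewrite /rho_cit divnMDl // divn_small // addn0; congr (cit q (gam _)); apply: val_inj.
  by rewrite /= modnMDl modn_small.
apply/mapP; exists (q * n + i)%N; last by rewrite E.
rewrite mem_iota -level_half divnMDl // divn_small // addn0; apply/(positive_cit _ qh).
by move: E; rewrite /rho_cit divnMDl // divn_small // addn0 => ->.
Qed.

Let serre u v : bil euler_mx (c *m u) v = - bil euler_mx v u.
Proof. exact: (nc_serre euler_def coxeter_nc (coxeter_moved u) (coxeter_moved v)). Qed.

Let bil_cit q u v : bil euler_mx (cit q u) (cit q v) = bil euler_mx u v.
Proof. by elim: q => // q <-; rewrite !citS !serre opprK. Qed.

(** Powers of [c] preserve the form, so the earlier root may be taken to be some [gam r]; [bil_gam]
    then gives the first sign. For the second, Serre duality takes one [c] off the later root;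
    within a single turn, a coefficient of one [gam] on a different simple root vanishes instead. *)
Lemma bil_rho_cit k k' : (k < k')%N -> (k' < half)%N ->
  0 <= bil euler_mx (rho_cit k) (rho_cit k') /\ bil euler_mx (rho_cit k') (rho_cit k) <= 0.
Proof.
move=> kk kh; rewrite -level_half in kh; move: kh; rewrite /rho_cit.
have qq : (k %/ n <= k' %/ n)%N by rewrite leq_div2r // ltnW.
have rr : (k %/ n = k' %/ n)%N -> (k %% n < k' %% n)%N.
  by move=> E; move: kk; rewrite {1}(divn_eq k n) {1}(divn_eq k' n) E ltn_add2l.
have {rr} : (k %/ n = k' %/ n)%N -> (ord_mod k < ord_mod k')%N by [].
rewrite -(subnKC qq); move: (k %/ n)%N (k' %/ n - k %/ n)%N => q d; move: (ord_mod k) (ord_mod k') => r r' rr kh.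
rewrite citD !bil_cit bil_gam; split.
  by apply: cit_positive; move: kh; rewrite /kap; lia.
case: d rr kh => [|d] rr kh; last first.
  rewrite citS serre bil_gam oppr_le0.
  by apply: cit_positive; move: kh; rewrite /kap; lia.
have {}rr : (r < r')%N by apply: rr; rewrite addn0.
rewrite bil_gam; have [rs|rs] := boolP (r' < s)%N; last first.
  by rewrite coef_gam // -val_eqE /= gtn_eqF.
by rewrite coef_gam_first ?(ltn_trans rr) // -val_eqE /= gtn_eqF.
Qed.

Lemma pos_roots_ordered : ordered_positive W euler_mx (pos_roots alpha h).
Proof.
have pw : pairwise (fun x y => (0 <= bil euler_mx x y) && (bil euler_mx y x <= 0))
    (pos_roots alpha h).
  rewrite pos_rootsE pairwise_map; apply/(pairwiseP 0%N) => i j; rewrite !inE size_iota.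
  move=> ih jh ij; rewrite !nth_iota // !add0n.
  by apply/andP; apply: bil_rho_cit.
split=> //.
- rewrite uniq_pairwise; apply: (@sub_in_pairwise _ (mem (pos_roots alpha h))) pw.
    move=> x y /pos_rootsP[xr _] _ /andP[_ yx]; apply: contraTneq yx => <-.
    by rewrite (root_bil euler_def xr) -ltNge ltr01.
  exact/allP.
- by move=> t /pos_rootsP[].
- move=> t tr; have [tp|tn] := root_sign tr; apply/orP; [left|right]; apply/pos_rootsP => //.
  by split=> //; exact: root_opp.
- by move=> t /pos_rootsP[tr tp]; apply/negP => /pos_rootsP[_]; exact: positive_opp tp.
Qed.

(** [c_+] conjugates [c] into [c^-1], whose Euler form is the transpose of that of [c]. *)
Lemma bil_cplus x y : bil euler_mx (cplus *m x) (cplus *m y) = bil euler_mx y x.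
Proof.
have [v ->] := coxeter_moved x; have := bil_sym euler_def (v - c *m v) y.
have -> : cplus *m (v - c *m v) = - (c^T *m (cplus *m v) - c *m (c^T *m (cplus *m v))).
  by rewrite (group_Ktr W_orth _ coxeter_group) mulmxBr cplus_conj opprB.
rewrite /bil mulmxN !euler_mxE -cplus_conj !dotDE (group_dot W_orth _ _ cplus_group).
by lra.
Qed.

Lemma rho_cit_gam i : rho_cit i = gam i.
Proof.
rewrite /rho_cit divn_small // /cit /=; congr gam; apply: val_inj => /=.
by rewrite modn_small.
Qed.

Lemma rho_cit_head i : (s <= i)%N -> rho_cit (n * h - n + i) = - al i.
Proof.
move=> si; have E : (n * h - n = h.-1 * n)%N.
  by rewrite -[h in LHS](prednK h_gt0) mulnS addKn mulnC.
have -> : rho_cit (n * h - n + i) = cit h.-1 (gam i).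
  rewrite /rho_cit E divnMDl // divn_small // addn0; congr (cit _ (gam _)).
  by apply: val_inj; rewrite /= modnMDl modn_small.
rewrite -[cit _ _](group_trK W_orth _ coxeter_group) -citS (prednK h_gt0) cit_h.
by rewrite coxeter_inv_gam ltnNge si.
Qed.

Lemma rho_cit_tail k : (k < s)%N -> exists2 i : 'I_n, (i < s)%N & rho_cit (half + k) = - al i.
Proof. by move/level_tail/cit_level. Qed.

Let rho_cit_tail_inj k k' : (k < s)%N -> (k' < s)%N ->
  rho_cit (half + k) = rho_cit (half + k') -> k = k'.
Proof.
move=> ks ks'; have := level_tail ks; have := level_tail ks'; rewrite /rho_cit.
have := divn_eq (half + k) n; have := divn_eq (half + k') n.
rewrite /kap /=; set q := (_ %/ _)%N; set q' := (_ %/ _)%N => E' E H' H.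
have qq : q = q' by move: H H'; case: (s <= _)%N; case: (s <= _)%N; lia.
rewrite /rho_cit -/q -/q' qq => /cit_inj/gam_inj/(congr1 val) /= rr.
by move: E E'; rewrite qq rr; lia.
Qed.

(** * The vertex orders of EX(c) and AX(c) compared *)

Local Notation EXs := (EX_vertices alpha s h).
Local Notation L := (pos_roots alpha h).
Local Notation EXtail := [seq rho_cit k | k <- iota half s].

Local Notation EXhead := [seq rho_cit k | k <- iota (n * h - n + s) (n - s)].

Lemma al_inj : injective (fun i => al i).
Proof.
move=> i j E; have := coef_simple i j; rewrite -E coef_simple eqxx; case: eqVneq => // _ /eqP.
by rewrite oner_eq0.
Qed.

Lemma mem_EXhead t : t \in EXhead <-> exists2 i : 'I_n, (s <= i)%N & t = - al i.
Proof.
split=> [/mapP[k]|[i si ->]].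
  rewrite mem_iota => /andP[k1 k2] ->; have kn : (k - (n * h - n) < n)%N by lia.
  exists (Ordinal kn); first by rewrite /=; lia.
  by rewrite -rho_cit_head /=; [congr rho_cit | ]; lia.
apply/mapP; exists (n * h - n + i)%N; last by rewrite rho_cit_head.
by rewrite mem_iota; have := ltn_ord i; lia.
Qed.

Lemma EXhead_uniq : uniq EXhead.
Proof.
rewrite -[(n * h - n + s)%N]addn0 iotaDl -map_comp map_inj_in_uniq ?iota_uniq //.
move=> k k'; rewrite !mem_iota /= => ks ks'.
have kn : (s + k < n)%N by lia. have kn' : (s + k' < n)%N by lia.
rewrite -!addnA (rho_cit_head (i := Ordinal kn)) ?leq_addr //.
rewrite (rho_cit_head (i := Ordinal kn')) ?leq_addr // => /oppr_inj/al_inj/(congr1 val) /=.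
by lia.
Qed.

Lemma EXtail_uniq : uniq EXtail.
Proof.
rewrite -[half in iota half]addn0 iotaDl -map_comp map_inj_in_uniq ?iota_uniq //.
by move=> k k'; rewrite !mem_iota /= => ks ks'; exact: rho_cit_tail_inj.
Qed.

(** By counting: the tail has [s] distinct entries among the [s] negatives of the first block. *)
Lemma mem_EXtail t : t \in EXtail <-> exists2 i : 'I_n, (i < s)%N & t = - al i.
Proof.
pose A := [seq - al i | i <- enum 'I_n & (i < s)%N].
have AE x : x \in A <-> exists2 i : 'I_n, (i < s)%N & x = - al i.
  split=> [/mapP[i]|[i i_s ->]]; last first.
    by apply/mapP; exists i; rewrite // mem_filter i_s mem_enum.
  by rewrite mem_filter => /andP[i_s _] ->; exists i.
have sub : {subset EXtail <= A}.
  move=> x /mapP[k]; rewrite mem_iota => /andP[hk ks] ->.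
  by rewrite -(subnKC hk); apply/AE/rho_cit_tail; lia.
have sz : (size A <= size EXtail)%N.
  rewrite !size_map size_iota size_filter -sum1_count big_enum_cond /=.
  by rewrite -(big_ord_widen _ (fun=> 1%N)) // sum1_card card_ord.
have [_ E] := uniq_min_size EXtail_uniq sub sz.
by rewrite E; exact: AE.
Qed.

Let half_geq : (n <= half)%N.
Proof.
have [h1 _ _ _] := h_cheb; have : (n * 2 <= n * h)%N by rewrite leq_mul2l h1 orbT.
by have := odd_double_half (n * h); lia.
Qed.

Lemma size_pos_roots : size L = half. Proof. by rewrite size_map size_iota. Qed.

Let L_uniq : uniq L. Proof. by case: pos_roots_ordered. Qed.

Lemma index_rho_cit k : (k < half)%N -> index (rho_cit k) L = k.
Proof.
move=> kh; have := index_uniq 0 (i := k) _ L_uniq.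
by rewrite size_pos_roots => /(_ kh); rewrite {1}pos_rootsE (nth_map 0%N) ?size_iota // nth_iota.
Qed.

Lemma index_gam i : index (gam i) L = i.
Proof. by rewrite -rho_cit_gam index_rho_cit // (leq_trans _ half_geq). Qed.

Let gam_pos i : gam i \in L.
Proof. by apply/pos_rootsP; split; [exact: gam_root | exact: gam_positive]. Qed.

Let gam_simple i : (i < s)%N -> gam i = al i. Proof. by rewrite /gam => ->. Qed.

Let opp_al_pos i : - al i \notin L.
Proof.
apply/negP => /pos_rootsP[_]; exact: (positive_opp (simple_root i) (positive_simple i)).
Qed.

Lemma index_pos_lt t : t \in L -> (index t L < s)%N -> exists2 i : 'I_n, (i < s)%N & t = al i.
Proof.
move=> tL ts; have kn : (index t L < n)%N by exact: leq_trans sn.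
exists (Ordinal kn) => //; rewrite -gam_simple //.
by rewrite -[LHS](nth_index 0 tL) -[in RHS](nth_index 0 (gam_pos _)) index_gam.
Qed.

Lemma EX_uniq : uniq EXs.
Proof.
rewrite EX_verticesE !cat_uniq EXhead_uniq EXtail_uniq L_uniq has_cat /= andbT negb_or.
apply/andP; split; [apply/andP; split|]; apply/hasPn => t.
- move=> tL; apply/negP => /mem_EXhead[i _ tE]; have := opp_al_pos i.
  by rewrite -tE tL.
- move=> /mem_EXtail[i i_s ->]; apply/negP => /mem_EXhead[j js /oppr_inj/al_inj ij].
  by move: js; rewrite leqNgt -ij i_s.
- by move=> /mem_EXtail[i _ ->]; exact: opp_al_pos.
Qed.

Lemma cplus_pos t : t \in L -> (s <= index t L)%N -> cplus *m t \in L.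
Proof.
move=> tL ts; have [tr tp] := (pos_rootsP t).1 tL; apply/pos_rootsP; split.
  exact: (root_image W_orth cplus_group tr).
apply: (block_positive cplus_group cplusE orth_first tr tp) => i i_s.
by apply: contraTneq ts => ->; rewrite -gam_simple // index_gam -ltnNge.
Qed.

Lemma cplus_pos_index t : t \in L -> (s <= index t L)%N -> (s <= index (cplus *m t)%R L)%N.
Proof.
move=> tL ts; rewrite leqNgt; apply/negP => /(index_pos_lt (cplus_pos tL ts))[i i_s E].
by have := opp_al_pos i; rewrite -cplus_simple // -E cplusK tL.
Qed.

Lemma cplus_opp_gam i : cplus *m (- gam i) = if (i < s)%N then al i else - al i.
Proof.
rewrite mulmxN /gam; case: ifPn => i_s; last by rewrite cplusK.
by rewrite cplus_simple // opprK.
Qed.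

(** [c_+] sends the head [- al i] to [- gam i], the first [s] positive roots to their negatives
    [- gam i], the tail to the first [s] positive roots, and permutes the other positive roots. The
    images are thus [L] and all [- gam i], the negative roots that [c^-1] makes positive. *)
Lemma mem_EX_cplus y : cplus *m y \in EXs <->
  unit_root y /\ ((y \in L) || (c^T *m y \in L)).
Proof.
rewrite EX_verticesE !mem_cat.
have gW i : unit_root (- gam i) by exact: root_opp (gam_root i).
have gP i : c^T *m (- gam i) \in L.
  apply/pos_rootsP; split; first exact: (root_image W_orth (group_tr W_orth coxeter_group) (gW i)).
  by rewrite mulmxN; exact: gam_inversion.
split=> [/or3P[]|[yr]].
- move=> /mem_EXhead[i si yE]; have -> : y = - gam i; last by rewrite gP orbT.
  by rewrite -[y]cplusK yE -[RHS]cplusK cplus_opp_gam ltnNge si.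
- move=> yL; have := cplus_pos yL; rewrite cplusK; have [ys|ys] := leqP s (index (cplus *m y) L).
    by move=> /(_ isT) H; split; [case/pos_rootsP: H | rewrite H].
  have [i i_s yE] := index_pos_lt yL ys; move=> _.
  have -> : y = - gam i; last by rewrite gP orbT.
  by rewrite -[y]cplusK yE -[RHS]cplusK cplus_opp_gam i_s.
- move=> /mem_EXtail[i i_s yE]; have -> : y = gam i; last by rewrite gam_pos; split=> //; exact: gam_root.
  by apply: oppr_inj; rewrite -[- gam i]cplusK cplus_opp_gam i_s -[- y]cplusK mulmxN yE opprK.
have [yL _|yL] := boolP (y \in L).
  have [ys|ys] := leqP s (index y L); first by rewrite cplus_pos ?orbT.
  have [i i_s ->] := index_pos_lt yL ys; apply/or3P; apply: Or33.
  by apply/mem_EXtail; exists i => //; rewrite cplus_simple.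
move=> /= cyL; have [yp|yn] := root_sign yr; first by case/negP: yL; apply/pos_rootsP.
have [|i yE] := coxeter_inversion (root_opp yr) yn.
  by rewrite mulmxN; case/pos_rootsP: cyL; exact: positive_opp.
rewrite -[y]opprK yE cplus_opp_gam; case: ifPn => i_s; apply/or3P.
  by apply: Or32; rewrite -gam_simple.
by apply: Or31; apply/mem_EXhead; exists i => //; rewrite leqNgt.
Qed.

Lemma EX_root t : t \in EXs -> unit_root t.
Proof.
rewrite EX_verticesE !mem_cat => /or3P[/mem_EXhead[i _ ->]|/pos_rootsP[] //|/mem_EXtail[i _ ->]];
exact: root_opp (simple_root i).
Qed.

Lemma index_EX t : t \in L -> index t EXs = (n - s + index t L)%N.
Proof.
move=> tL; rewrite EX_verticesE !index_cat tL size_map size_iota ifN //.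
apply/negP => /mem_EXhead[i _ tE]; have := opp_al_pos i.
by rewrite -tE tL.
Qed.

Lemma index_window_opp t : t \in L -> index (- t)%R (window L) = (half + index t L)%N.
Proof.
move=> tL; rewrite index_cat ifN; last by case: pos_roots_ordered => _ _ _ /(_ t tL).
by rewrite size_pos_roots index_map //; exact: oppr_inj.
Qed.

Lemma index_window t : t \in L -> index t (window L) = index t L.
Proof. by move=> tL; rewrite index_cat tL. Qed.

(** The zones of the vertex order of [EX(c)], with the positions of the images under [c_+]: the head
    and the first [s] positive roots land among the negatives, and the tail lands at the front. *)
Variant EX_spec t : Prop :=
  | EXHead i of (s <= i)%N & t = - al i & (index t EXs < n - s)%N &
      index (cplus *m t)%R (window L) = (half + i)%N
  | EXFirst i of (i < s)%N & t = al i & index t EXs = (n - s + i)%N &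
      index (cplus *m t)%R (window L) = (half + i)%N
  | EXMiddle of t \in L & cplus *m t \in L & (n - s + s <= index t EXs < n - s + half)%N &
      (s <= index (cplus *m t)%R (window L) < half)%N
  | EXLast i of (i < s)%N & t = - al i & (n - s + half <= index t EXs)%N &
      index (cplus *m t)%R (window L) = i.

Lemma EX_specP t : t \in EXs -> EX_spec t.
Proof.
move=> tE; have [tL|tL] := boolP (t \in L).
  have [ts|ts] := leqP s (index t L).
    have cL := cplus_pos tL ts; have cs := cplus_pos_index tL ts.
    apply: EXMiddle => //.
      by rewrite index_EX // leq_add2l ts ltn_add2l -size_pos_roots index_mem.
    by rewrite index_window // cs -size_pos_roots index_mem.
  have [i i_s E] := index_pos_lt tL ts; apply: (EXFirst i_s E).
    by rewrite index_EX // E -gam_simple // index_gam.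
  by rewrite E cplus_simple // -gam_simple // index_window_opp // index_gam.
move: tE; rewrite EX_verticesE !mem_cat (negPf tL) /= => /orP[tH|tT].
  have [i si E] := (mem_EXhead t).1 tH; apply: (EXHead si E).
    by rewrite EX_verticesE index_cat tH -[X in (_ < X)%N](size_iota (n * h - n + s)) -(size_map rho_cit) index_mem.
  have -> : cplus *m t = - gam i by rewrite -[RHS]cplusK cplus_opp_gam ltnNge si E.
  by rewrite index_window_opp // index_gam.
have [i i_s E] := (mem_EXtail t).1 tT; apply: (EXLast i_s E).
  rewrite EX_verticesE !index_cat (negPf tL) ifN; last first.
    apply/negP => /mem_EXhead[j js]; rewrite E => /oppr_inj/al_inj ij.
    by move: js; rewrite leqNgt -ij i_s.
  by rewrite size_map size_iota size_pos_roots leq_add2l leq_addr.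
by rewrite E mulmxN cplus_simple // opprK -gam_simple // index_window // index_gam.
Qed.

(* [cplus] exchanges the ends of the order, and within the positive roots the signs of
   the Euler form before and after applying it are opposite. *)
Lemma EX_cplus_order x y : x \in EXs -> y \in EXs -> (index x EXs < index y EXs)%N ->
  (index (cplus *m x)%R (window L) < index (cplus *m y)%R (window L))%N ->
  bil euler_mx x y = 0 /\ bil euler_mx y x = 0.
Proof.
have bil_al (i j : 'I_n) : (s <= i)%N = (s <= j)%N -> i != j -> bil euler_mx (al i) (al j) = 0.
  move=> sij ij; have [js|js] := leqP s j; last first.
    have is_ : (i < s)%N by rewrite ltnNge sij -ltnNge.
    by rewrite -(gam_simple is_) bil_gam coef_simple (negPf ij).
  have E (k : 'I_n) : (s <= k)%N -> al k = cplus *m gam k by move=> sk; rewrite /gam ltnNge sk cplusK.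
  rewrite (E i) ?sij // (E j) // bil_cplus bil_gam coef_gam -?leqNgt // eq_sym.
  by rewrite (negPf ij).
move=> xE yE lt1 lt2.
have bil_al2 (i j : 'I_n) e : (s <= i)%N = (s <= j)%N -> i != j -> x = e *: al i -> y = e *: al j ->
    bil euler_mx x y = 0 /\ bil euler_mx y x = 0.
  move=> sij ij -> ->; rewrite !bilE bil_al // bil_al ?(eq_sym j) //.
  by rewrite !mulr0.
have ni := half_geq; have sn0 := sn.
(* Elements of two different zones never keep their relative order, so only pairs within one zone
   survive. *)
case: (EX_specP xE) => [i si xi ix cx_|i si xi ix cx_|xL cxL ix cx_|i si xi ix cx_];
case: (EX_specP yE) => [j sj yj jy cy_|j sj yj jy cy_|yL cyL jy cy_|j sj yj jy cy_];
try (exfalso; first [clear -lt1 lt2 ix jy cx_ cy_ ni sn0 si sj | clear -lt1 lt2 ix jy cx_ cy_ ni sn0 si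
  | clear -lt1 lt2 ix jy cx_ cy_ ni sn0 sj]; lia).
- have ij : i != j by apply/eqP => ij; move: lt2; rewrite cx_ cy_ ij ltnn.
  by apply: (@bil_al2 i j (-1)); rewrite ?scaleN1r // si sj.
- have ij : i != j by apply/eqP => ij; move: lt2; rewrite cx_ cy_ ij ltnn.
  by apply: (@bil_al2 i j 1); rewrite ?scale1r // ![(s <= _)%N]leqNgt si sj.
- move: lt1 lt2; rewrite (index_EX xL) (index_EX yL) ltn_add2l.
  rewrite (index_window cxL) (index_window cyL) => lt1 lt2.
  have [b1 b2] := pos_index pos_roots_ordered xL yL lt1.
  have := pos_index pos_roots_ordered cxL cyL lt2; rewrite !bil_cplus => -[b3 b4].
  by split; apply/eqP; rewrite eq_le ?b1 ?b2 ?b3 ?b4.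
- have ij : i != j by apply/eqP => ij; move: lt2; rewrite cx_ cy_ ij ltnn.
  by apply: (@bil_al2 i j (-1)); rewrite ?scaleN1r // ![(s <= _)%N]leqNgt si sj.
Qed.

Lemma AX_vertices_cat : exists2 T, AX_vertices alpha h = L ++ T &
  forall t, t \in T -> t \notin L.
Proof.
exists [seq rho_cit k | k <- iota half n]; first exact: AX_verticesE.
move=> t /mapP[k]; rewrite mem_iota => /andP[hk kn] ->; apply/negP => /pos_rootsP[tr tp].
apply: positive_opp tr tp _; apply: cit_half_opp => //.
exact: leq_trans kn half_leq.
Qed.

End PerronPlane.

End Order.

End Bipartite.

End SimpleRoots.

(** * Facets and forward vertices *)

Section FilterFset.
Context {T : choiceType}.
Implicit Types (V s : seq T) (F G : {fset T}) (x y : T).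

Lemma size_filter_fset V F : uniq V -> {subset F <= V} ->
  size [seq x <- V | x \in F] = #|` F|.
Proof.
move=> uV sub; apply/perm_size/uniq_perm.
- exact: filter_uniq.
- exact: fset_uniq.
by move=> x; rewrite mem_filter andb_idr // => /sub.
Qed.

Lemma filter_fset_subseq V s : uniq V -> subseq s V ->
  [seq x <- V | x \in [fset y | y in s]%fset] = s.
Proof.
move=> uV /(subseq_uniqP uV) E; rewrite [RHS]E; apply: eq_filter => x.
by rewrite inE.
Qed.

Lemma filter_fset_inj V F G : {subset F <= V} -> {subset G <= V} ->
  [seq x <- V | x \in F] = [seq x <- V | x \in G] -> F = G.
Proof.
move=> FV GV E; apply/fsetP => x; have := congr1 (fun s => x \in s) E.
rewrite !mem_filter; have [xV|xV] := boolP (x \in V); first by rewrite !andbT.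
have -> : (x \in F) = false by apply: contraNF xV => /FV.
by move=> _; apply/esym; apply: contraNF xV => /GV.
Qed.

Lemma pairwise_filterP (r : rel T) (P : pred T) V : uniq V ->
  reflect (forall x y, x \in V -> y \in V -> P x -> P y -> (index x V < index y V)%N -> r x y)
    (pairwise r ([seq z <- V | P z])).
Proof.
move=> uV; apply: (iffP idP) => [pw x y xV yV Px Py xy|H].
  have su := filter_subseq P V; move: (pw).
  have xf : x \in [seq z <- V | P z] by rewrite mem_filter Px.
  have yf : y \in [seq z <- V | P z] by rewrite mem_filter Py.
  case/splitPr: xf yf su => A B; rewrite pairwise_cat /= => yf su /and3P[_ _ /andP[/allP xB _]].
  move: yf; rewrite mem_cat in_cons => /or3P[yA|/eqP E|/xB //].
    by have := subseq_index uV su yA; rewrite ltnNge ltnW.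
  by rewrite E ltnn in xy.
have := subseq_pairwise (filter_subseq P V) (pairwise_index uV).
apply: (@sub_in_pairwise _ (mem ([seq z <- V | P z]))); last exact/allP.
by move=> x y; rewrite !mem_filter => /andP[Px xV] /andP[Py yV]; exact: H.
Qed.

End FilterFset.

(** * The complexes in terms of clusters *)

Section Facets.
Context {R : realType} {n : nat} (W : set 'M[R]_n).
Context (W_orth : orthogonal_group W) (b : 'M[R]_n).
Context (b_def : forall x, dot (b *m x) x = dot x x).
Context (root_moved : forall w, nc W b w -> w <> 1%:M ->
  exists2 t, unit_root W t & moved w t).
Context (W_gen : forall g, W g -> exists k, refl_factors W g k).
Context (alpha : n.-tuple 'cV[R]_n) (s h : nat).
Implicit Types (u v x y t : 'cV[R]_n) (g w C D : 'M[R]_n) (F G : {fset 'cV[R]_n}).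

Local Notation unit_root := (unit_root W).
Local Notation bil := (bil b).
Local Notation nc := (nc W b).
Local Notation exceptional := (exceptional b).
Local Notation cluster := (cluster b).
Local Notation simplex := (simplex b).
Local Notation c := (coxeter alpha).
Local Notation cp := (sprod alpha s).
Local Notation L := (pos_roots alpha h).
Local Notation V := (EX_vertices alpha s h).

Context (ncc : nc c) (c_full : forall x, moved c x).
Context (pL : ordered_positive W b L).
Context (cpK : forall v, cp *m (cp *m v) = v).
Context (bil_cp : forall x y, bil (cp *m x) (cp *m y) = bil y x).
Context (V_uniq : uniq V) (V_root : forall t, t \in V -> unit_root t).
Context (V_cp : forall y, cp *m y \in V <->
  unit_root y /\ ((y \in L) || (c^T *m y \in L))).
Context (V_order : forall x y, x \in V -> y \in V -> (index x V < index y V)%N ->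
  (index (cp *m x)%R (window L) < index (cp *m y)%R (window L))%N ->
  bil x y = 0 /\ bil y x = 0).
Context (L_sub : subseq L V).

(** The order of the window, which agrees with that of the vertices of [AX(c)] on the positive
    roots. *)
Local Notation "''lst' F" := [seq x <- window L | x \in F] (at level 8).

Let L_uniq : uniq L. Proof. by case: pL. Qed.

Let wL_uniq : uniq (window L) := window_uniq pL.

Lemma EX_exceptional F : EX W alpha s h F <->
  {subset F <= V} /\ exceptional (increasing V F).
Proof.
have E : {subset F <= V} -> size (increasing V F) = #|` F| by exact: size_filter_fset.
have rE t : t \in increasing V F -> unit_root t.
  by rewrite mem_filter => /andP[_ /V_root].
have X := reflen_exceptional W_orth b_def root_moved ncc c_full W_gen rE.
split=> -[sub H]; split=> //; first by apply/X; rewrite E.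
by rewrite -E //; apply/X.
Qed.

(** [c_+] transposes the form, so a pair whose order it reverses keeps its condition; for a pair
    whose order it keeps, the form vanishes both ways by [V_order]. *)
Lemma exceptional_cplus F : {subset F <= V} ->
  exceptional (increasing V F) <->
  exceptional 'lst [fset cp *m v | v in F]%fset.
Proof.
move=> FV.
have cp_win x : x \in V -> cp *m x \in window L.
  move=> xV; have /V_cp[xr _] : cp *m (cp *m x) \in V by rewrite cpK.
  rewrite mem_cat; case: pL => _ _ /(_ _ xr)/orP[->//|xL] _ _.
  by rewrite -[cp *m x]opprK map_f ?orbT.
have cp_inj x y : cp *m x = cp *m y -> x = y by move=> E; rewrite -[x]cpK E cpK.
split=> /(pairwise_filterP _ _ _) H; apply/pairwise_filterP => //.
- move=> x' y' _ _ /imfsetP[x /= xF ->] /imfsetP[y /= yF ->] lt2.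
  rewrite bil_cp; have xV := FV x xF; have yV := FV y yF.
  case: (ltngtP (index x V) (index y V)) => [lt1|lt1|E].
  - by have [-> _] := V_order xV yV lt1 lt2.
  - exact: (H V_uniq) lt1.
  - have xy : x = y by rewrite -(nth_index 0 xV) E nth_index.
    by rewrite xy ltnn in lt2.
- move=> x y xV yV xF yF lt1; rewrite -bil_cp.
  case: (ltngtP (index (cp *m x)%R (window L)) (index (cp *m y)%R (window L))) => [lt2|lt2|E].
  - by have [_] := V_order xV yV lt1 lt2; rewrite -bil_cp => ->.
  - by apply: (H wL_uniq) lt2; rewrite ?cp_win //; apply/imfsetP; [exists y | exists x].
  - have /cp_inj xy : cp *m x = cp *m y.
      by rewrite -(nth_index 0 (cp_win _ xV)) E nth_index // cp_win.
    by rewrite xy ltnn in lt1.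
Qed.

Lemma AXP F : AX W alpha s h F <-> {subset F <= window L} /\ simplex L c 'lst F.
Proof.
split=> [[G /EX_exceptional[GV Gex] <-]|[Fw [_ Fex _ Fc]]].
  have yP y : y \in [fset cp *m v | v in G]%fset ->
      unit_root y /\ ((y \in L) || (c^T *m y \in L)).
    by move=> /imfsetP[v /= vG ->]; apply/V_cp; rewrite cpK; exact: GV.
  split=> [y /yP[yr _]|]; first last.
    split; [exact: filter_subseq | exact/exceptional_cplus | by [] |].
    by move=> t; rewrite mem_filter => /andP[/yP[]].
  rewrite /window mem_cat; case: pL => _ _ /(_ y yr)/orP[->//|yL] _ _.
  by rewrite -[y]opprK map_f ?orbT.
pose G := [fset cp *m y | y in F]%fset.
have FG : [fset cp *m v | v in G]%fset = F.
  apply/fsetP => y; apply/imfsetP/idP => [[v /= /imfsetP[z /= zF ->] ->]|yF].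
    by rewrite cpK.
  by exists (cp *m y); rewrite ?cpK //; apply/imfsetP; exists y.
have GV : {subset G <= V}.
  move=> _ /imfsetP[y /= yF ->]; apply/V_cp; split; last first.
    by apply: Fc; rewrite mem_filter yF Fw.
  have := Fw y yF; rewrite mem_cat => /orP[/(pos_root pL)//|/mapP[z zL ->]].
  exact: root_opp (pos_root pL zL).
exists G => //; apply/EX_exceptional; split=> //.
by apply/exceptional_cplus => //; rewrite FG.
Qed.

(** A maximal simplex equals the cluster that extends it; a cluster is maximal because it has [n]
    elements, the most an exceptional sequence can have. *)
Lemma facetsP F : facets (AX W alpha s h) F <->
  {subset F <= window L} /\ cluster L c 'lst F.
Proof.
split=> [[/AXP[Fw Fs] Fmax]|[Fw Fc]].
  split=> //; have [G Gc FG] := cluster_extend W_orth b_def root_moved ncc pL Fs.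
  pose G' := [fset x | x in G]%fset; have [Gsub _ _ _] := Gc.
  have GE : 'lst G' = G by exact: filter_fset_subseq.
  have GF : G' = F.
    apply: Fmax; first apply/AXP; rewrite ?GE.
      split; first by move=> x; rewrite inE => /(mem_subseq Gsub).
      by have [] := (clusterE W_orth b_def c G pL).1 Gc.
    by apply/fsubsetP => x xF; rewrite inE; apply: FG; rewrite mem_filter xF Fw.
  by rewrite -GF GE.
split=> [|G /AXP[Gw [_ Gex _ _]] FG].
  by apply/AXP; split=> //; have [] := (clusterE W_orth b_def c _ pL).1 Fc.
have szF : size 'lst F = n.
  rewrite -(exceptional_codim W_orth b_def (ts := 'lst F)).
  - by case: Fc => _ _ <- _; exact: codim_full.
  - by move=> t; exact: cluster_root pL Fc.
  - by case: Fc.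
have szG : (size 'lst G <= n)%N.
  rewrite -(exceptional_codim W_orth b_def (ts := 'lst G)) //.
    apply: (leq_trans (n := codim c)); last by rewrite (codim_full c_full).
    exact: codim_leq.
  by move=> t; rewrite mem_filter => /andP[_]; exact: (window_root pL).
apply/eqP; rewrite eq_sym eqEfcard FG /=.
by rewrite -(size_filter_fset wL_uniq Gw) -(size_filter_fset wL_uniq Fw) szF.
Qed.


Let f (t : 'cV[R]_n) := index t V.

Let f_mono x y : x \in L -> y \in L -> (index x L < index y L)%N -> (f x < f y)%N.
Proof.
move=> xL yL; rewrite /f; have := L_sub; move: (pairwise_index V_uniq) => pw /subseq_pairwise.
move=> /(_ _ pw)/(pairwiseP 0) H lt; have := H (index x L) (index y L).
by rewrite !inE !index_mem !nth_index // => /(_ xL yL lt).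
Qed.

Let increasing_pos F : {subset F <= L} -> increasing V F = [seq x <- L | x \in F].
Proof.
move=> FL; rewrite [in RHS](subseq_uniqP V_uniq L_sub) -filter_predI.
by apply: eq_filter => x /=; rewrite andb_idr // => /FL.
Qed.

Lemma XP w F : W w -> X W alpha s h w F <->
  [/\ {subset F <= L}, exceptional [seq x <- L | x \in F] & forall t, t \in F -> moved w t].
Proof.
move=> wW; split=> [[/EX_exceptional[FV Fex] Fw]|[FL Fex Fw]].
  have FL : {subset F <= L} by move=> x /Fw[].
  by split=> //; [rewrite -increasing_pos | move=> t /Fw[_ /(in_movedP W_orth)]; exact].
split=> [|v vF]; last by split; [exact: FL | apply/(in_movedP W_orth _ wW); exact: Fw].
apply/EX_exceptional; split; last by rewrite increasing_pos.
by move=> x /FL; exact: (mem_subseq L_sub).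
Qed.

(** The sequence from [first_sequence_exists] has [codim w] elements, so it is a facet. Any other
    facet comes later, since an initial segment of the sequence is contained in it and maximality
    makes the two equal. *)
Lemma first_facetP w t : nc w ->
  (exists2 G, first_facet W alpha s h w G & t \in G) <->
  [/\ t \in L, moved w t & - (w^T *m t) \in L].
Proof.
move=> ncw; have wW := nc_group ncw.
have [A [Asub Aex Aw At Afirst]] := first_sequence_exists W_orth b_def root_moved pL f_mono ncw.
pose G0 := [fset x | x in A]%fset.
have G0E : [seq x <- L | x \in G0] = A by exact: filter_fset_subseq.
have posE G : {subset G <= L} -> positions alpha s h G = map f [seq x <- L | x \in G].
  by move=> GL; rewrite /positions increasing_pos.
have G0L : {subset G0 <= L} by move=> x; rewrite inE => /(mem_subseq Asub).
have G0X : X W alpha s h w G0.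
  by apply/XP => //; split; rewrite ?G0E // => x; rewrite inE => /At[].
have Lr x : x \in L -> unit_root x := pos_root pL (t := x).
have szA : size A = codim w.
  by rewrite Aw (exceptional_codim W_orth b_def) // => x /(mem_subseq Asub)/Lr.
have G0f : facets (X W alpha s h w) G0.
  split=> // G /(XP _ wW)[GL Gex Gw] G0G; apply/eqP; rewrite eq_sym eqEfcard G0G /=.
  rewrite -(size_filter_fset L_uniq GL) -(size_filter_fset L_uniq G0L) G0E szA.
  rewrite -(exceptional_codim W_orth b_def _ Gex); last first.
    by move=> x; rewrite mem_filter => /andP[_ /Lr].
  apply: codim_leq; apply: moved_refl_prod_ind; [exact: moved0|exact: movedD|exact: movedZ|].
  by move=> x; rewrite mem_rev mem_filter => /andP[/Gw].
have Gle G : facets (X W alpha s h w) G ->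
    G = G0 \/ (positions alpha s h G0 < positions alpha s h G)%O.
  move=> [/(XP _ wW)[GL Gex Gw] Gmax].
  have [|lt|[s0 sE]] := Afirst [seq x <- L | x \in G] (filter_subseq _ _) Gex.
  - by move=> x; rewrite mem_filter => /andP[/Gw].
  - by right; rewrite !posE // G0E.
  left; apply/esym/Gmax => //; apply/fsubsetP => x xG.
  by rewrite inE sE mem_cat mem_filter xG GL.
have G0first : first_facet W alpha s h w G0.
  by split=> // G /Gle[->|/ltW].
split=> [[G [Gf Gfirst] tG]|tP]; last by exists G0; rewrite ?inE //; exact/At.
apply/At; have [GE|] := Gle G Gf; first by move: tG; rewrite GE inE.
by rewrite ltNge Gfirst.
Qed.

Lemma forward_filter (P : pred 'cV[R]_n) g ts :
  (forall A t B, ts = A ++ t :: B -> P t = (t \in L) && (g *m refl_prod A *m t \in L)) ->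
  forward_roots L g ts = [seq t <- ts | P t].
Proof.
elim: ts g => //= t ts IH g H.
have := H [::] t ts erefl; rewrite refl_prod_nil mulmx1 => ->.
rewrite (IH (g *m reflmx t)) // => A x B tsE.
by have := H (t :: A) x B; rewrite tsE refl_prod_cons !mulmxA => ->.
Qed.

Context (AX_tail : exists2 ts, AX_vertices alpha h = L ++ ts & forall t, t \in ts -> t \notin L).

(** A forward vertex is a positive root, being a vertex of some [X(v)], so the negative ends of both
    lists contribute nothing. At a positive [t] the partial product is that of the cut at [t], and
    [first_facetP] becomes positivity of the deciding root. *)
Lemma phi_forward F : cluster L c 'lst F -> phi W alpha s h F = forward_prod L 'lst F.
Proof.
move=> Fc; have [ts AE tsL] := AX_tail; rewrite /phi /forward_prod; congr (refl_prod (rev _)).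
have Lpos t : forward W alpha s h F t -> t \in L.
  move=> [G [[[_ GX] _] _] tG]; by have [] := GX t tG.
rewrite /increasing AE /window !filter_cat forward_roots_cat.
have -> : [seq t <- [seq x <- ts | x \in F] | `[< forward W alpha s h F t >]] = [::].
  apply/eqP; rewrite -[_ == _]negbK -has_filter; apply/hasPn => t.
  rewrite mem_filter => /andP[_ /tsL]; apply: contra => /asboolP; exact: Lpos.
rewrite cats0 [X in _ ++ X](_ : _ = [::]); last first.
  rewrite (@forward_filter pred0) ?filter_pred0 // => A t B E.
  have : t \in [seq x <- map -%R L | x \in F] by rewrite E mem_cat mem_head orbT.
  rewrite mem_filter => /andP[_ /mapP[x xL ->]]; case: pL => _ _ _ /(_ x xL)/negPf-> //.
rewrite cats0; apply/esym/forward_filter => A t B E; rewrite mul1mx.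
have [_ Fex _ _] := Fc; have Fr := cluster_root pL Fc.
have lE : 'lst F = A ++ t :: (B ++ [seq x <- map -%R L | x \in F]).
  by rewrite /window filter_cat E -catA.
have tL : t \in L.
  have : t \in [seq x <- L | x \in F] by rewrite E mem_cat mem_head orbT.
  by rewrite mem_filter => /andP[].
rewrite tL /=; rewrite lE in Fex Fr.
have vE : partial_prod alpha h F t = refl_prod (rev (rcons A t)).
  rewrite /partial_prod /increasing AE filter_cat E -catA /=; congr (refl_prod (rev _)).
  have tA : t \notin A.
    have := filter_uniq (fun x => x \in F) L_uniq; rewrite E cat_uniq /=.
    by case/and3P => _ /norP[].
  rewrite index_cat (negPf tA) /= eqxx addn0 -cat_rcons.
  by rewrite take_size_cat // size_rcons.
have [ncv tv ut] : [/\ nc (refl_prod (rev (rcons A t))), moved (refl_prod (rev (rcons A t))) t &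
    (refl_prod (rev (rcons A t)))^T *m t = - (refl_prod A *m t)].
  split; [exact: (split_nc W_orth b_def Fex Fr) | exact: (split_moved W_orth b_def Fex Fr) |].
  exact: (split_tr W_orth b_def Fex Fr).
apply/asboolP/idP; rewrite /forward vE.
  by move=> /(first_facetP _ ncv)[_ _]; rewrite ut opprK.
by move=> uL; apply/(first_facetP _ ncv); rewrite ut opprK.
Qed.

Lemma phi_bijection : set_bij (facets (AX W alpha s h)) (NCP W c) (phi W alpha s h).
Proof.
have NCPE := NCP_nc W_orth b_def root_moved ncc c_full W_gen.
have uniqC D : nc D -> unique_cluster b L c D.
  move=> ncD; apply: (cluster_bijection W_orth b_def root_moved ncc pL ncD) => x _.
  exact: c_full.
have phi_nc F : cluster L c 'lst F -> nc (phi W alpha s h F).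
  by move=> Fc; rewrite phi_forward //; have [] := forward_nc W_orth b_def pL Fc.
split.
- by move=> F /facetsP[_ Fc]; apply/NCPE; exact: phi_nc.
- move=> F G; rewrite !inE => /facetsP[Fw Fc] /facetsP[Gw Gc] E.
  have [A _ AU] := uniqC _ (phi_nc F Fc); apply: (filter_fset_inj Fw Gw).
  transitivity A; [|apply/esym]; apply: AU; split=> //; last by rewrite E phi_forward.
  by rewrite phi_forward.
- move=> D /NCPE ncD; have [A [Ac AD] _] := uniqC D ncD; have [Asub _ _ _] := Ac.
  pose F := [fset x | x in A]%fset.
  have FE : 'lst F = A by exact: filter_fset_subseq.
  have Fc : cluster L c 'lst F by rewrite FE.
  exists F; last by rewrite phi_forward // FE.
  by apply/facetsP; split=> // x; rewrite inE => /(mem_subseq Asub).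
Qed.

End Facets.

Theorem theorem4p8 (R : realType) (n : nat) (W : set 'M[R]_n)
    (alpha : n.-tuple 'cV[R]_n) (s h : nat)
    (W_refl : finite_reflection_group W)
    (W_ess : essential W)
    (W_irr : irreducible_group W)
    (alpha_simple : simple_roots W alpha)
    (alpha_bip : bipartite_order alpha s)
    (h_order : mx_order (coxeter alpha) h) :
  set_bij (facets (AX W alpha s h)) (NCP W (coxeter alpha))
    (phi W alpha s h).
Proof.
have [n_gt0 _] := W_irr.
have [lam [p [p_gt0 pE]]] :=
  perron_positive W_refl W_ess alpha_simple alpha_bip h_order W_irr.
have cpE := sprod_cplus alpha_bip.
apply: (@phi_bijection _ _ _ (W_orth W_refl) (euler_mx alpha)).
- exact: (euler_def W_refl W_ess alpha_simple alpha_bip).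
- move=> w /nc_group; exact: (root_in_moved W_refl W_ess alpha_simple alpha_bip h_order).
- move=> g gW; have [_ _ /(_ g gW)[ts tsW gE]] := W_refl.
  by exists (size ts), ts.
- exact: (coxeter_nc W_refl W_ess alpha_simple alpha_bip).
- exact: (coxeter_moved W_refl W_ess alpha_simple alpha_bip).
- exact: (pos_roots_ordered W_refl W_ess alpha_simple alpha_bip h_order n_gt0 p_gt0 pE).
- by move=> v; rewrite cpE (cplusK alpha_simple alpha_bip).
- by move=> x y; rewrite cpE (bil_cplus W_refl W_ess alpha_simple alpha_bip).
- exact: (EX_uniq W_refl W_ess alpha_simple alpha_bip h_order n_gt0 p_gt0 pE).
- exact: (EX_root W_refl W_ess alpha_simple alpha_bip h_order n_gt0 p_gt0 pE).
- by rewrite cpE; exact: (mem_EX_cplus W_refl W_ess alpha_simple alpha_bip h_order n_gt0 p_gt0 pE).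
- by rewrite cpE; exact: (EX_cplus_order W_refl W_ess alpha_simple alpha_bip h_order n_gt0 p_gt0 pE).
- rewrite (EX_verticesE W_refl W_ess alpha_simple alpha_bip h_order n_gt0 p_gt0 pE).
  exact: subseq_trans (prefix_subseq _ _) (suffix_subseq _ _).
- exact: (AX_vertices_cat W_refl W_ess alpha_simple alpha_bip h_order n_gt0 p_gt0 pE).
Qed.
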